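(* Let $m_{11},m_{12},m_{23},m_{33}$ be non-negative integers, and for partitions $\lambda,\mu,\nu$ define $$c_{\lambda,\mu,\nu}=\sum_{\sigma,\tau}d^{(m_{33})^{m_{12}}}_{\lambda,\sigma}\;d^{(m_{11})^{m_{23}}}_{\tau,\nu}\;c^\mu_{\sigma\tau},$$ the sum over all partitions $\sigma$ and $\tau$. Then $c_{\lambda,\mu,\nu}$ is equal to $(-1)^{|\lambda|+|\mu|+|\nu|-m_{33}m_{12}-m_{11}m_{23}}$ times the number of pairs $(\sigma,T)$ of a partition $\sigma$ contained in the rectangle $(m_{33})^{m_{12}}$ (with $m_{12}$ rows and $m_{33}$ columns), and a set-valued tableau $T$ whose shape is a partition contained in $(m_{11})^{m_{23}}$, satisfying the following conditions. (i) If $\sigma$ is placed in the upper-left corner of the rectangle $(m_{33})^{m_{12}}$ and the 180 degree rotation of $\lambda$ is placed in the lower-right corner, then their union is the whole rectangle and their overlap is a rook-strip. (ii) If (the shape of) $T$ is placed in the upper-left corner of the rectangle $(m_{11})^{m_{23}}$ and the 180 degree rotation of $\nu$ is placed in the lower-right corner, then their union is the whole rectangle and their overlap is a rook-strip. (iii) The composition $w(T)u(\sigma)$ is a reverse lattice word with content $\mu$.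
   Context: Partitions are identified with Young diagrams; $|\lambda|$ is the sum of the parts; $(c)^r$ is the rectangular partition with $r$ rows and $c$ columns. A rook-strip is a set of boxes containing at most one box in any row or column. (Conditions (i) and (ii) include that $\lambda\subset(m_{33})^{m_{12}}$ and $\nu\subset(m_{11})^{m_{23}}$.) A set-valued tableau $T$ of shape $\lambda$ is a filling of the boxes of $\lambda$ with finite non-empty sets of positive integers such that the largest integer in any box is at most the smallest integer in the box to its right and strictly smaller than the smallest integer in the box below it; $x^T$ is the monomial in which the exponent of $x_i$ is the number of boxes containing $i$; $|T|=\deg x^T$. Put $\mathcal{G}_\lambda=\sum_T(-1)^{|T|-|\lambda|}x^T$ over set-valued tableaux of shape $\lambda$. The $\mathcal{G}_\lambda$ are linearly independent and their $\mathbb{Z}$-span is a commutative ring; $\mathcal{G}_\lambda\mathcal{G}_\mu=\sum_\nu c^\nu_{\lambda\mu}\mathcal{G}_\nu$ defines $c^\nu_{\lambda\mu}$. Define $d^\nu_{\lambda\mu}=c^\rho_{R\nu}$, where $R=(q)^p$ is any rectangle containing $\lambda$ and $\mu$ and $\rho=(q+\mu_1,\dots,q+\mu_p,\lambda_1,\lambda_2,\dots)$ (independent of $R$). The word $w(T)$ is the sequence of integers in the boxes of $T$ read one row at a time from left to right, with rows ordered from bottom to top, and integers in the same box arranged in increasing order. For a partition $\sigma=(\sigma_1,\dots,\sigma_l)$, $u(\sigma)=(l^{\sigma_l},\dots,2^{\sigma_2},1^{\sigma_1})$ (exponents are repetitions). A word of positive integers is a reverse lattice word if every occurrence of an integer $i\ge2$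 is followed by more occurrences of $i-1$ than of $i$. The content of a word is $(\nu_1,\nu_2,\dots)$ with $\nu_i$ the number of occurrences of $i$. *)

(* Defs.v *)
From HB Require Import structures.
From mathcomp Require Import all_boot all_order all_algebra.
From mathcomp Require Import finmap.
From mathcomp Require Import all_classical.
From mathcomp Require Import monalg.

Set Implicit Arguments.
Unset Strict Implicit.
Unset Printing Implicit Defensive.

Import Order.TTheory GRing.Theory Num.Theory.

Local Open Scope nat_scope.

Definition is_part (s : seq nat) : bool := sorted geq s && (0 \notin s).

Record intpart : predArgType :=
  IntPart { part_seq :> seq nat; part_seqP : is_part part_seq }.

HB.instance Definition _ := [isSub for part_seq].
HB.instance Definition _ := [Countable of intpart by <:].

(* Rows are numbered from 0, and [part p i] is 0 beyond the last row. *)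
Definition part (p : intpart) (i : nat) : nat := nth 0 p i.

Definition sub_part (p q : intpart) : Prop := forall i, part p i <= part q i.

(* The rectangle (c)^r with r rows and c columns. *)
Definition rect_seq (r c : nat) : seq nat := if c == 0 then [::] else nseq r c.

Fact rect_subproof (r c : nat) : is_part (rect_seq r c).
Proof.
rewrite /is_part /rect_seq; case: c => [|c] //=.
by rewrite mem_nseq andbF andbT; elim: r => [|[|r] IH] //=; rewrite leqnn.
Qed.

Definition rect (r c : nat) : intpart := IntPart (rect_subproof r c).

(* (hull_cols)^(hull_rows) = (q)^p is the smallest rectangle containing la and
   mu; rho = (q + mu_1, ..., q + mu_p, la_1, la_2, ...). *)
Definition hull_rows (la mu : intpart) : nat := maxn (size la) (size mu).
Definition hull_cols (la mu : intpart) : nat := maxn (part la 0) (part mu 0).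

Definition rho_seq (la mu : intpart) : seq nat :=
  [seq hull_cols la mu + part mu i | i <- iota 0 (hull_rows la mu)] ++ la.

Fact part_anti (p : intpart) (i j : nat) : i <= j -> part p j <= part p i.
Proof.
move=> ij; rewrite /part; have [jp|] := ltnP j (size p); last first.
  by move=> pj; rewrite (nth_default _ pj).
have /andP[sp _] := part_seqP p.
have geq_trans : transitive geq by move=> y x z /= yx zy; exact: leq_trans zy yx.
by apply: (sorted_leq_nth geq_trans leqnn 0 sp) => //; rewrite inE // (leq_ltn_trans ij).
Qed.

Fact rho_subproof (la mu : intpart) : is_part (rho_seq la mu).
Proof.
have geq_trans : transitive geq by move=> y x z /= yx zy; exact: leq_trans zy yx.
have /andP[sla la0] := part_seqP la.
apply/andP; split; last first.
  rewrite mem_cat negb_or la0 andbT; apply/mapP => -[i].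
  rewrite mem_iota add0n => /andP[_ ilt] /esym/eqP.
  rewrite addn_eq0 /hull_cols => /andP[/eqP h _].
  have: 0 < hull_rows la mu by case: (hull_rows la mu) ilt.
  have pos (p : intpart) : 0 < size p -> 0 < part p 0.
    have /andP[_] := part_seqP p; rewrite /part.
    by case: (part_seq p) => [|[|x] s].
  move: h; rewrite /hull_rows leq_max => h /orP[]/pos p0.
    by move: (leq_maxl (part la 0) (part mu 0)); rewrite h leqNgt p0.
  by move: (leq_maxr (part la 0) (part mu 0)); rewrite h leqNgt p0.
rewrite (sorted_pairwise geq_trans) pairwise_cat -!(sorted_pairwise geq_trans).
rewrite sla andbT; apply/andP; split.
  apply/allrelP => x y /mapP[i _ ->] /(nthP 0)[j jla <-] /=.
  apply: leq_trans (leq_addr _ _); apply: leq_trans (leq_maxl _ _).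
  exact: part_anti.
apply: (homo_sorted (e := leq)); last exact: iota_sorted.
by move=> i j ij /=; rewrite leq_add2l part_anti.
Qed.

Definition rho (la mu : intpart) : intpart := IntPart (rho_subproof la mu).

(* A filling is the list of its rows; [box t i j] is empty outside the shape,
   so that the comparisons with the neighbouring boxes in [is_svt] are vacuous
   for boxes at the boundary. *)
Definition box (t : seq (seq {fset nat})) (i j : nat) : {fset nat} :=
  nth fset0 (nth [::] t i) j.

Definition is_svt (t : seq (seq {fset nat})) : bool :=
  is_part (shape t) &&
  all (fun i => all (fun j =>
         [&& box t i j != fset0, 0 \notin box t i j,
             allrel leq (box t i j) (box t i j.+1)
           & allrel ltn (box t i j) (box t i.+1 j)])
       (iota 0 (nth 0 (shape t) i)))
    (iota 0 (size t)).

Record svtableau : predArgType :=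
  SVTableau { svt_rows :> seq (seq {fset nat}); svt_rowsP : is_svt svt_rows }.

HB.instance Definition _ := [isSub for svt_rows].
HB.instance Definition _ := [Choice of svtableau by <:].

Fact svt_shape_subproof (T : svtableau) : is_part (shape T).
Proof. by case/andP: (svt_rowsP T). Qed.

Definition svt_shape (T : svtableau) : intpart :=
  IntPart (svt_shape_subproof T).

(* The monomial x^T, in variables indexed by nat (x_0 never occurs). *)
Definition svt_mon (T : svtableau) : {cmonom nat} :=
  \big[mmul/mone]_(A <- flatten T) \big[mmul/mone]_(i <- enum_fset A) ucm i.

Definition svt_word (T : svtableau) : seq nat :=
  flatten [seq flatten [seq sort leq (enum_fset A) | A <- r] | r <- rev T].

(* The word u(sigma) = (l^{sigma_l}, ..., 2^{sigma_2}, 1^{sigma_1}). *)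
Definition part_word (si : intpart) : seq nat :=
  flatten (rev (mkseq (fun i => nseq (part si i) i.+1) (size si))).

Definition reverse_lattice (w : seq nat) : Prop :=
  forall k, k < size w -> let i := nth 0 w k in 2 <= i ->
    count_mem i (drop k.+1 w) < count_mem i.-1 (drop k.+1 w).

Definition has_content (w : seq nat) (mu : intpart) : Prop :=
  forall i, count_mem i.+1 w = part mu i.

Section Grothendieck.
Local Open Scope ring_scope.
Local Open Scope classical_set_scope.

(* Formal power series over int in infinitely many variables, given by their
   coefficients. *)
Definition fpseries := {cmonom nat} -> int.

Definition fpseries_mul (f g : fpseries) : fpseries := fun m =>
  \sum_(p \in [set p : {cmonom nat} * {cmonom nat} | mmul p.1 p.2 = m])
    f p.1 * g p.2.

(* Only finitely many tableaux contribute to the coefficient of a given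
   monomial; the truncated subtraction is exact, since |la| <= |T|. *)
Definition groth (la : intpart) : fpseries := fun m =>
  \sum_(T \in [set T : svtableau | svt_shape T = la /\ svt_mon T = m])
    (-1 : int) ^+ (mdeg (svt_mon T) - sumn la)%N.

Definition groth_expansion (f : fpseries) (a : {fsfun intpart -> int with 0}) :
    Prop :=
  forall m, f m = \sum_(nu <- finsupp a) a nu * groth nu m.

(* [Kc la mu nu] is c^nu_{la mu}: the expansion of G_la * G_mu exists and is
   unique, so the default value of [xget] is never used. *)
Definition Kc (la mu nu : intpart) : int :=
  xget [fsfun]
    [set a : {fsfun intpart -> int with 0} |
       groth_expansion (fpseries_mul (groth la) (groth mu)) a] nu.

(* [Kd la mu nu] is d^nu_{la mu} = c^rho_{R nu}; it does not depend on the
   rectangle R containing la and mu, and R is taken to be the smallest one. *)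
Definition Kd (la mu nu : intpart) : int :=
  Kc (rect (hull_rows la mu) (hull_cols la mu)) nu (rho la mu).

(* For fixed la, mu, nu only finitely many pairs of partitions contribute. *)
Definition c_three (m11 m12 m23 m33 : nat) (la mu nu : intpart) : int :=
  \sum_(st \in [set: intpart * intpart])
    Kd la st.1 (rect m12 m33) * Kd st.2 nu (rect m23 m11) * Kc st.1 st.2 mu.

End Grothendieck.

Section Rook.
Variables r c : nat.

Definition diagram (p : intpart) : {set 'I_r * 'I_c} :=
  [set b : 'I_r * 'I_c | b.2 < part p b.1].

(* Rotated by 180 degrees into the lower-right corner of the rectangle. *)
Definition rotated_diagram (p : intpart) : {set 'I_r * 'I_c} :=
  [set b : 'I_r * 'I_c | rev_ord b.2 < part p (rev_ord b.1)].

Definition rook_strip (A : {set 'I_r * 'I_c}) : Prop :=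
  forall b b', b \in A -> b' \in A -> b.1 = b'.1 \/ b.2 = b'.2 -> b = b'.

Definition rook_complementary (si la : intpart) : Prop :=
  [/\ sub_part si (rect r c), sub_part la (rect r c),
      diagram si :|: rotated_diagram la = [set: 'I_r * 'I_c]
    & rook_strip (diagram si :&: rotated_diagram la)].

End Rook.

(* Main.v *)
Require Import Defs.
From HB Require Import structures.
From mathcomp Require Import all_boot all_order all_algebra all_fingroup.
From mathcomp Require Import finmap.
From mathcomp Require Import all_classical.
From mathcomp Require Import mpoly.
From mathcomp Require Import(coercions, canonicals) monalg.
From mathcomp Require Import zify.

Set Implicit Arguments.
Unset Strict Implicit.
Unset Printing Implicit Defensive.

Import Order.TTheory GRing.Theory Num.Theory.

Local Open Scope nat_scope.

(**
Both kinds of structure constants are counted by one rule, which is proved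
first: c^nu_{sigma tau} is, up to the sign (-1)^(|nu|-|sigma|-|tau|), the number
of set-valued tableaux T of shape tau such that w(T) u(sigma) is a reverse
lattice word of content nu ([Kc_LR]).

In n variables let A(alpha) be the antisymmetrization of
x^(alpha+delta) (1-x_1)^0 (1-x_2)^1 ... (1-x_n)^(n-1), where delta is
(n-1, ..., 1, 0).  As G_tau is symmetric ([gpoly_sym], by the Bender-Knuth
involution), G_tau A(sigma) is the signed sum of A(sigma + x^T) over all T of
shape tau, and the point is that the T violating the lattice condition cancel
([gpoly_bialt]).  This is Stembridge's argument for Schur functions, with one
new feature.  Read the columns from right to left, let j be the first column
where a violation occurs, and i+1 the largest letter of that column involved in
one: column j contains i+1 without an i above it, while sigma together with the
columns to the right of j contains as many i as i+1.  Adding or removing the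
letter i in the leftmost box that contains i+1, in the row of this violating
letter, changes the sign and multiplies the monomial by x_i; so the sum is
(1-x_i) times the sum over the tableaux where that letter i is absent.  For
those tableaux the Bender-Knuth involution on the columns before j exchanges the
exponents of x_i and x_{i+1} in x^(T+sigma+delta).  Since (1-x_i) makes the
remaining factor symmetric in x_i and x_{i+1} as well, the antisymmetrization
of the sum is zero.

For sigma empty, the only tableau that survives is the one with row s filled
with s, so G_tau A(0) = A(tau) ([Gpoly_bialt0]).  Cancelling A(0), which is not
zero, gives the expansion of G_sigma G_tau ([Gpoly_prod]), and the lowest terms
of the A(tau) show that the G_tau are independent ([Gpoly_free]).  A coefficient
of a series only involves finitely many variables, hence the rule in infinitely
many variables.  The cancellation reads columns while w(T) reads rows; both
orders give the same lattice condition ([rowgood_colgood], [colgood_rowgood]).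

Next, d^R_{lambda sigma} for a rectangle R is found by listing the tableaux of
shape R that the rule counts for the content rho = (q + sigma, lambda).  The
letters up to p must fill the boxes of sigma with s in row s; the letters
beyond p must fill the rotated lambda, each column being numbered downwards
from p+1.  There is thus at most one tableau ([rect_fill_uniq]), and it exists
exactly when the two regions cover R and overlap in a rook-strip, which is what
the row and column conditions on the boxes of the overlap say
([rect_rook_cells], [rect_fill_tab], [rect_fill_colgood]).

Substituting both results in the definition of c_{lambda,mu,nu} and collecting
the signs gives the statement.
*)

(** * Partitions and counting *)

Lemma part_r (p : intpart) s : (size p <= s) -> part p s = 0.
Proof. exact: nth_default. Qed.

Lemma part_c (p : intpart) s : (part p s <= part p 0).
Proof. exact: part_anti. Qed.

Lemma part_gt0 (p : intpart) s : (s < size p) -> (0 < part p s).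
Proof.
move=> sp; have /andP[_ p0] := part_seqP p; rewrite lt0n; apply: contra p0 => /eqP <-.
exact: mem_nth.
Qed.

Lemma part_inj (p q : intpart) : part p =1 part q -> p = q.
Proof.
move=> e; apply: val_inj => /=; have sz : size p = size q.
  case: (ltngtP (size p) (size q)) => // h; have := part_gt0 h.
    by rewrite -e part_r.
  by rewrite e part_r.
apply: (@eq_from_nth _ 0) => // i _; exact: e.
Qed.

Lemma sum_ltn m r : m <= r -> \sum_(0 <= s < r) (s < m) = m.
Proof.
move=> mr; rewrite (big_cat_nat (leq0n _) mr) /= (eq_big_nat _ _ (F2 := fun=> 1)) =>
  [|s /andP[_ ->]//].
rewrite sum_nat_const_nat subn0 muln1 big_nat_cond big1 ?addn0 // => s /andP[/andP[h _] _].
by rewrite ltnNge h.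
Qed.

Lemma sum_geq m s : \sum_(0 <= s' < s) (m <= s') = s - m.
Proof.
elim: s => [|s IH]; first by rewrite big_geq.
by rewrite big_nat_recr //= IH; case: leqP => h; lia.
Qed.

Lemma prefix_count (k : nat -> bool) r : (forall s s', k s -> s' < s -> k s') ->
  (forall s, k s -> s < r) -> forall s, k s = (s < \sum_(0 <= s' < r) k s').
Proof.
move=> down kr; have ex : exists m, ~~ k m by exists r; apply/negP => /kr; rewrite ltnn.
case: (ex_minnP ex) => m km mmin; have E s : k s = (s < m).
  apply/idP/idP => [ks|sm]; last by apply: contraLR sm => /mmin; rewrite -leqNgt.
  by case: (ltngtP s m) => // h; [move: km; rewrite (down _ _ ks h)|move: km; rewrite -h ks].
move=> s; rewrite E (eq_bigr (fun s' => (s' < m) : nat)) => [|s' _]; last by rewrite E.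
by rewrite sum_ltn // mmin //; apply/negP => /kr; rewrite ltnn.
Qed.

Lemma suffix_count (k : nat -> bool) r : (forall s s', k s -> s < s' -> s' < r -> k s') ->
  (forall s, k s -> s < r) ->
  forall s, k s = (s < r) && (r - \sum_(0 <= s' < r) k s' <= s).
Proof.
move=> up kr; have ex : exists m, (r <= m) || k m by exists r; rewrite leqnn.
case: (ex_minnP ex) => m km mmin; have mr : m <= r by apply: mmin; rewrite leqnn.
have E s : k s = (s < r) && (m <= s).
  apply/idP/andP => [ks|[sr]]; first by rewrite kr // mmin // ks orbT.
  rewrite leq_eqVlt => /orP[/eqP e|h].
    by move: km; rewrite e leqNgt sr.
  by case/orP: km => [rm|km]; [lia|exact: up km h sr].
move=> s; have -> : \sum_(0 <= s' < r) k s' = r - m.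
  by rewrite -sum_geq; apply: eq_big_nat => s' /andP[_ s'r]; rewrite E s'r.
by rewrite E subKn.
Qed.

(** The set is an interval ending at r-1, so both sides say that it has more than y
    elements. *)
Lemma depth_count (k : nat -> bool) r y : (forall s s', k s -> s < s' -> s' < r -> k s') ->
  (forall s, k s -> s < r) ->
  \sum_(0 <= s < r) (k s && (y == \sum_(0 <= s' < s) k s')) = (y < r) && k (r - y.+1).
Proof.
move=> up kr; have [m mr E] : exists2 m, m <= r & forall s, k s = (s < r) && (m <= s).
  by exists (r - \sum_(0 <= s' < r) k s'); [exact: leq_subr|exact: suffix_count].
have D s : s < r -> \sum_(0 <= s' < s) k s' = s - m.
  move=> sr; rewrite -sum_geq; apply: eq_big_nat => s' /andP[_ s's]; rewrite E.
  by rewrite (ltn_trans s's sr).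
rewrite (eq_big_nat _ _ (F2 := fun s => (s == m + y) : nat)); last first.
  move=> s /andP[_ sr]; rewrite D // E sr; congr nat_of_bool; apply/andP/eqP;
    [case=> /= ms /eqP|move=> e; split; [|apply/eqP]]; lia.
case: (ltnP (m + y) r) => h.
  rewrite (bigD1_seq (m + y)) ?mem_index_iota ?iota_uniq //= eqxx big1 => [|s /negbTE->//].
  rewrite E; have -> : y < r by lia.
  have -> : m <= r - y.+1 by lia.
  by have -> : r - y.+1 < r by lia.
rewrite big_nat_cond big1 => [|s /andP[/andP[_ sr] _]].
  rewrite E; case: (ltnP y r) => //= yr; have -> : (m <= r - y.+1) = false by lia.
  by rewrite andbF.
by have -> : s == m + y = false by lia.
Qed.

(** * Set-valued tableaux as relations *)

Definition above (f : nat -> nat -> nat -> bool) (s t a : nat) : bool :=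
  if s is s'.+1 then f s' t a else false.

(** A set-valued tableau with rows of lengths L s, as the relation f s t a: the box in
    row s and column t contains the letter a+1.  Letters are shifted to start from 0,
    like rows and columns. *)
Record tab (L : nat -> nat) (f : nat -> nat -> nat -> bool) : Prop := Tab {
  tab_sub : forall s t a, f s t a -> t < L s;
  tab_ex : forall s t, t < L s -> exists a, f s t a;
  tab_row : forall s t a b, f s t a -> f s t.+1 b -> a <= b;
  tab_col : forall s t a b, f s t a -> f s.+1 t b -> a < b }.

Section Tableau.
Variables (L : nat -> nat) (f : nat -> nat -> nat -> bool).
Hypothesis Lanti : forall s s', s <= s' -> L s' <= L s.
Hypothesis tf : tab L f.

Lemma tab_rows s t t' a b : f s t a -> f s t' b -> t < t' -> a <= b.
Proof.
move=> fa fb; elim: t' b fb => [|t' IH] b fb //; rewrite ltnS leq_eqVlt => /orP[/eqP e|tt'].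
  by rewrite -e in fb; exact: (tab_row tf fa fb).
have [x fx] : exists x, f s t' x by apply: (tab_ex tf); have := tab_sub tf fb; lia.
exact: leq_trans (IH _ fx tt') (tab_row tf fx fb).
Qed.

Lemma tab_cols s s' t a b : f s t a -> f s' t b -> s < s' -> a + (s' - s) <= b.
Proof.
move=> fa fb; elim: s' b fb => [|s' IH] b fb //; rewrite ltnS leq_eqVlt => /orP[/eqP e|ss'].
  by rewrite -e in fb; have := tab_col tf fa fb; lia.
have [x fx] : exists x, f s' t x.
  by apply: (tab_ex tf); apply: leq_trans (tab_sub tf fb) (Lanti (leqnSn _)).
have := IH _ fx ss'; have := tab_col tf fx fb; lia.
Qed.

Lemma tab_mono s s' t t' a b : s < s' -> t <= t' -> f s t a -> f s' t' b ->
  a + (s' - s) <= b.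
Proof.
move=> ss'; rewrite leq_eqVlt => /orP[/eqP<-|tt'] fa fb; first exact: (tab_cols fa fb ss').
have [x fx] : exists x, f s t' x.
  by apply: (tab_ex tf); apply: leq_trans (tab_sub tf fb) (Lanti (ltnW ss')).
have := tab_rows fa fx tt'; have := tab_cols fx fb ss'; lia.
Qed.

Lemma tab_ge s t a : f s t a -> s <= a.
Proof.
case: s => [//|s] fa.
have [x fx] : exists x, f 0 t x.
  by apply: (tab_ex tf); apply: leq_trans (tab_sub tf fa) (Lanti (leq0n _)).
by have := tab_cols fx fa (ltn0Sn s); lia.
Qed.

Lemma tab_above s t a b : above f s t a -> f s t b -> a < b.
Proof. by case: s => [//|s] /=; exact: (tab_col tf). Qed.

End Tableau.

(** * The Bender-Knuth involution *)

Section Reflection.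
Variables (l : seq nat).
Hypothesis ls : sorted ltn l.

Definition reflect_in (t : nat) : nat := nth 0 (rev l) (index t l).

Lemma reflect_in_mem t : t \in l -> reflect_in t \in l.
Proof. by move=> tl; rewrite -mem_rev mem_nth // size_rev index_mem. Qed.

Lemma reflect_uniq : uniq l.
Proof. by apply: sorted_uniq ls; [exact: ltn_trans|exact: ltnn]. Qed.

Lemma index_reflect t : t \in l -> index (reflect_in t) l = size l - (index t l).+1.
Proof.
move=> tl; rewrite /reflect_in nth_rev ?index_mem //.
by rewrite index_uniq ?reflect_uniq // ltn_subrL /= (leq_ltn_trans _ (_ : index t l < _))
  ?index_mem.
Qed.

Lemma reflect_inK t : t \in l -> reflect_in (reflect_in t) = t.
Proof.
move=> tl; rewrite {1}/reflect_in index_reflect // nth_rev; last first.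
  by rewrite ltn_subrL /= (leq_ltn_trans _ (_ : index t l < _)) ?index_mem.
rewrite -[RHS](nth_index 0 tl); congr nth.
have il : index t l < size l by rewrite index_mem.
by rewrite subnSK // subKn // ltnW.
Qed.

Lemma reflect_in_anti t t' : t \in l -> t' \in l -> t < t' ->
  reflect_in t' < reflect_in t.
Proof.
have lt_index x y : x \in l -> y \in l -> (index x l < index y l) = (x < y).
  move=> xl yl; have mono := sorted_ltn_nth ltn_trans 0 ls.
  have lti u v : u \in l -> v \in l -> index u l < index v l -> u < v.
    move=> ul vl uv; rewrite -(nth_index 0 ul) -(nth_index 0 vl).
    by apply: mono; rewrite ?inE ?index_mem.
  case: (ltngtP (index x l) (index y l)) => h; first by rewrite (lti _ _ xl yl h).
    by have := lti _ _ yl xl h; lia.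
  by rewrite -(nth_index 0 xl) -(nth_index 0 yl) h ltnn.
move=> tl t'l tt'; have ii : index t l < index t' l by rewrite lt_index.
rewrite -lt_index ?reflect_in_mem // !index_reflect //.
by apply: ltn_sub2l => //; apply: leq_ltn_trans ii _; rewrite index_mem.
Qed.

Lemma sum_reflect_in (F : nat -> nat) :
  \sum_(t <- l) F (reflect_in t) = \sum_(t <- l) F t.
Proof.
rewrite -(big_map reflect_in xpredT F); apply: perm_big.
have -> : map reflect_in l = rev l.
  apply: (@eq_from_nth _ 0) => [|k]; first by rewrite size_map size_rev.
  rewrite size_map => kl; rewrite (nth_map 0) // /reflect_in index_uniq ?reflect_uniq //.
by rewrite perm_rev.
Qed.
End Reflection.

(** The entries of a vertical pair i, i+1 are forced by column strictness; all other boxes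
    meeting {i, i+1} can be modified. *)
Definition mobile f (i s t : nat) : bool :=
  [&& f s t i || f s t i.+1, ~~ (f s t i && f s.+1 t i.+1)
    & ~~ (f s t i.+1 && above f s t i)].

Definition mobilecols f (i j s : nat) := [seq t <- iota 0 j | mobile f i s t].

(** The Bender-Knuth involution before column j: in each row the mobile boxes are
    reversed in order and the letters i and i+1 exchanged.  Reversing the order makes
    the exchange compatible with rows that increase weakly, and keeps the boxes that
    contain both letters. *)
Definition bk f (i j : nat) : nat -> nat -> nat -> bool := fun s t a =>
  if (t < j) && mobile f i s t then
    let t' := reflect_in (mobilecols f i j s) t in
    if a == i then f s t' i.+1 else if a == i.+1 then f s t' i else f s t a
  else f s t a.

Section BenderKnuth.
Variables (L : nat -> nat) (f : nat -> nat -> nat -> bool).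
Hypothesis Lanti : forall s s', s <= s' -> L s' <= L s.
Hypothesis tf : tab L f.
Variables (i j : nat).
(* An entry i+1 created next to column j would break the row condition if column j
   contained i. *)
Hypothesis jnoi : forall s, ~~ f s j i.

Let fc s := mobilecols f i j s.
Let R s t := reflect_in (fc s) t.

Lemma mobilecols_sorted s : sorted ltn (fc s).
Proof. by apply: sorted_filter; [exact: ltn_trans|exact: iota_ltn_sorted]. Qed.

Lemma mem_mobilecols s t : (t \in fc s) = (t < j) && mobile f i s t.
Proof. by rewrite mem_filter mem_iota add0n andbC. Qed.

Lemma mobile_meet s t : mobile f i s t -> exists2 a, f s t a & (a == i) || (a == i.+1).
Proof. by case/and3P => /orP[h|h] _ _; [exists i|exists i.+1]; rewrite ?eqxx ?orbT. Qed.

Lemma bk_nonmobile s t a : ~~ ((t < j) && mobile f i s t) -> bk f i j s t a = f s t a.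
Proof. by rewrite /bk => /negbTE->. Qed.

Lemma bk_other s t a : a != i -> a != i.+1 -> bk f i j s t a = f s t a.
Proof. by rewrite /bk => /negbTE-> /negbTE->; case: ifP. Qed.

Lemma bk_i s t : (t < j) && mobile f i s t -> bk f i j s t i = f s (R s t) i.+1.
Proof. by rewrite /bk => ->; rewrite eqxx. Qed.

Lemma bk_i1 s t : (t < j) && mobile f i s t -> bk f i j s t i.+1 = f s (R s t) i.
Proof. by rewrite /bk => ->; rewrite eqxx; case: eqP => // e; lia. Qed.

Lemma R_mobile s t : (t < j) && mobile f i s t -> (R s t < j) && mobile f i s (R s t).
Proof. by rewrite -!mem_mobilecols; exact: reflect_in_mem. Qed.

Lemma bk_meet s t : (bk f i j s t i || bk f i j s t i.+1) = (f s t i || f s t i.+1).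
Proof.
case: (boolP ((t < j) && mobile f i s t)) => h; last by rewrite !bk_nonmobile.
rewrite bk_i // bk_i1 //; have /andP[_ /and3P[+ _ _]] := R_mobile h.
by have /andP[_ /and3P[-> _ _]] := h; rewrite orbC.
Qed.

Lemma bk_old s t a : bk f i j s t a ->
  f s t a \/ (mobile f i s t /\ ((a == i) || (a == i.+1))).
Proof.
case: (boolP ((t < j) && mobile f i s t)) => h; last by rewrite bk_nonmobile //; left.
have [ai|ai] := boolP (a == i); first by move=> _; right; split=> //; case/andP: h.
have [ai1|ai1] := boolP (a == i.+1); first by move=> _; right; split=> //; case/andP: h.
by rewrite bk_other //; left.
Qed.

Lemma nonmobile_i s t : f s t i -> ~~ mobile f i s t -> f s.+1 t i.+1.
Proof.
move=> fi; rewrite /mobile fi /= negb_and !negbK => /orP[//|/andP[_ ab]].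
by have := tab_above tf ab fi; lia.
Qed.

Lemma nonmobile_i1 s t : f s t i.+1 -> ~~ mobile f i s t -> above f s t i.
Proof.
move=> fi; rewrite /mobile fi /= orbT /= negb_and !negbK => /orP[/andP[_ ab]|//].
by have := tab_col tf fi ab; lia.
Qed.

Lemma mobile_not_above s t : mobile f i s t -> f s t i -> f s.+1 t i.+1 -> False.
Proof. by case/and3P=> _ + _ => /[swap] -> /[swap] ->. Qed.

Lemma mobile_not_below s t : mobile f i s.+1 t -> f s t i -> f s.+1 t i.+1 -> False.
Proof. by case/and3P=> _ _ + => /= /[swap] -> /[swap] ->. Qed.

(** Vertical neighbours that both meet {i, i+1} are a forced pair. *)
Lemma mobile_col s t : mobile f i s t -> mobile f i s.+1 t -> False.
Proof.
move=> h1 h2; have [a fa ai] := mobile_meet h1; have [b fb bi] := mobile_meet h2.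
have ab := tab_col tf fa fb.
have ea : a = i by lia.
have eb : b = i.+1 by lia.
by rewrite ea in fa; rewrite eb in fb; exact: (mobile_not_above h1 fa fb).
Qed.

(** Between two mobile boxes, order is kept because [reflect_in] is decreasing.  A fixed
    box containing i has i+1 below it, which forces the box on its left to be fixed too
    if it contains i; symmetrically for i+1. *)
Lemma bk_row s t a b : bk f i j s t a -> bk f i j s t.+1 b -> a <= b.
Proof.
case: (boolP ((t < j) && mobile f i s t)) => h1;
  case: (boolP ((t.+1 < j) && mobile f i s t.+1)) => h2.
- have /andP[_ /mobile_meet[x fx xi]] := h1; have /andP[_ /mobile_meet[y fy yi]] := h2.
  move=> Ha Hb.
  have [ai|ai] := boolP ((a == i) || (a == i.+1)); last first.
    move: Ha; rewrite negb_or in ai; case/andP: ai => n1 n2; rewrite bk_other // => fa.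
    have := tab_row tf fa fy; have [bi|bi] := boolP ((b == i) || (b == i.+1)).
      by lia.
    move: Hb; rewrite negb_or in bi; case/andP: bi => m1 m2; rewrite bk_other // => fb _.
    exact: (tab_row tf fa fb).
  have [bi|bi] := boolP ((b == i) || (b == i.+1)); last first.
    move: Hb; rewrite negb_or in bi; case/andP: bi => m1 m2; rewrite bk_other // => fb.
    have := tab_row tf fx fb.
    by lia.
  case/orP: ai Ha => /eqP ->; case/orP: bi Hb => /eqP -> //.
  rewrite bk_i // bk_i1 // => Ha Hb.
  have lt : R s t.+1 < R s t.
    by apply: reflect_in_anti => //; rewrite ?mem_mobilecols //; exact: mobilecols_sorted.
  exact: (tab_rows tf Ha Hb lt).
- rewrite [bk f i j s t.+1 b]bk_nonmobile // => Ha Hb.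
  have [fa|[_ ai]] := bk_old Ha; first exact: (tab_row tf fa Hb).
  have /andP[_ /mobile_meet[x fx xi]] := h1.
  have xb := tab_row tf fx Hb.
  suff : b != i by lia.
  apply/eqP => bi; rewrite {}bi in Hb xb.
  have t1j : t.+1 < j.
    rewrite ltn_neqAle; have /andP[-> _] := h1; rewrite andbT; apply/eqP => e.
    by move: Hb; rewrite e; apply/negP.
  rewrite t1j /= in h2.
  have f1 := nonmobile_i Hb h2.
  have fi : f s t i.
    have -> : i = x by lia.
    by [].
  have [y fy] : exists y, f s.+1 t y by apply: (tab_ex tf); have := tab_sub tf f1; lia.
  have := tab_col tf fi fy; have := tab_row tf fy f1 => y1 y2.
  have ey : y = i.+1 by lia.
  by rewrite ey in fy; case/andP: h1 => _ h1; exact: (mobile_not_above h1 fi fy).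
- rewrite [bk f i j s t a]bk_nonmobile // => Ha Hb.
  have [fb|[_ bi]] := bk_old Hb; first exact: (tab_row tf Ha fb).
  have /andP[_ /mobile_meet[y fy yi]] := h2.
  have ay := tab_row tf Ha fy.
  suff : a != i.+1 by lia.
  apply/eqP => ai; rewrite {}ai in Ha ay.
  have tj : t < j by case/andP: h2; lia.
  rewrite tj /= in h1.
  have := nonmobile_i1 Ha h1; case: s Ha Hb fy h2 h1 => [//|s] Ha Hb fy h2 h1 /= f1.
  have ey : y = i.+1 by lia.
  rewrite {}ey in fy.
  have [z fz] : exists z, f s t.+1 z.
    by apply: (tab_ex tf); apply: leq_trans (tab_sub tf fy) (Lanti (leqnSn _)).
  have := tab_col tf fz fy; have := tab_row tf f1 fz => z1 z2.
  have ez : z = i by lia.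
  by rewrite ez in fz; case/andP: h2 => _ h2; exact: (mobile_not_below h2 fz fy).
- by rewrite !bk_nonmobile //; exact: (tab_row tf).
Qed.

Lemma bk_col s t a b : bk f i j s t a -> bk f i j s.+1 t b -> a < b.
Proof.
move=> /bk_old[fa|[h1 ai]] /bk_old[fb|[h2 bi]].
- exact: (tab_col tf fa fb).
- have [y fy yi] := mobile_meet h2; have ay := tab_col tf fa fy.
  suff : a != i by lia.
  apply/eqP => e; rewrite e in fa ay.
  have ey : y = i.+1 by lia.
  by rewrite ey in fy; exact: (mobile_not_below h2 fa fy).
- have [x fx xi] := mobile_meet h1; have xb := tab_col tf fx fb.
  suff : b != i.+1 by lia.
  apply/eqP => e; rewrite e in fb xb.
  have ex : x = i by lia.
  by rewrite ex in fx; exact: (mobile_not_above h1 fx fb).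
- by case: (mobile_col h1 h2).
Qed.

Lemma bk_tab : tab L (bk f i j).
Proof.
split; [|move=> s t tL|exact: bk_row|exact: bk_col].
  move=> s t a /bk_old[|[/mobile_meet[b fb _] _]]; first exact: (tab_sub tf).
  exact: (tab_sub tf fb).
case: (boolP ((t < j) && mobile f i s t)) => h; last first.
  by have [a fa] := tab_ex tf tL; exists a; rewrite bk_nonmobile.
have := bk_meet s t; have /andP[_ /and3P[-> _ _]] := h.
by case/orP; [exists i|exists i.+1].
Qed.

(** The involution preserves the set of mobile boxes, hence its own reflections. *)
Lemma mobile_bk s t : t < j -> mobile (bk f i j) i s t = mobile f i s t.
Proof.
move=> tj.
have nf s0 : mobile f i s0 t = false -> bk f i j s0 t =1 f s0 t.
  by move=> h a; rewrite bk_nonmobile // h andbF.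
case h: (mobile f i s t); rewrite /mobile bk_meet.
- have -> : f s t i || f s t i.+1 by case/and3P: h.
  rewrite andTb.
  apply/andP; split.
    apply/negP => /andP[Ha Hb]; have [h1|h1] := boolP (mobile f i s.+1 t).
      by case: (mobile_col h h1).
    rewrite nf ?(negbTE h1) // in Hb; have /= Hi := nonmobile_i1 Hb h1.
    exact: (mobile_not_above h Hi Hb).
  apply/negP; case: s h => [|s] h; first by rewrite andbF.
  rewrite [above _ _ _ _]/= => /andP[Ha Hb]; have [h1|h1] := boolP (mobile f i s t).
    by case: (mobile_col h1 h).
  rewrite nf ?(negbTE h1) // in Hb; have Hi := nonmobile_i Hb h1.
  exact: (mobile_not_below h Hb Hi).
- case m: (f s t i || f s t i.+1) => //=.
  have nh : ~~ mobile f i s t by rewrite h.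
  rewrite !(nf _ h); case/orP: m => fi.
    have f1 := nonmobile_i fi nh; suff h1 : mobile f i s.+1 t = false by rewrite (nf _ h1) fi f1.
    by apply/negbTE/negP => h1; exact: (mobile_not_below h1 fi f1).
  have := nonmobile_i1 fi nh; case: s h nh fi => [//|s] h nh fi.
  rewrite [above f _ _ _]/= [above _ _ _ _]/= => f1.
  suff h1 : mobile f i s t = false by rewrite (nf _ h1) fi f1 andbF.
  by apply/negbTE/negP => h1; exact: (mobile_not_above h1 f1 fi).
Qed.

Lemma mobilecols_bk s : mobilecols (bk f i j) i j s = fc s.
Proof.
apply: eq_in_filter => t; rewrite mem_iota add0n => /andP[_ tj]; exact: mobile_bk.
Qed.

Lemma bkK s t a : bk (bk f i j) i j s t a = f s t a.
Proof.
rewrite {1}/bk mobilecols_bk.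
case: (boolP (t < j)) => tj; last by rewrite /= bk_nonmobile ?(negbTE tj).
rewrite mobile_bk //; case: ifP => /= h; last by rewrite bk_nonmobile ?h ?andbF.
have ht : (t < j) && mobile f i s t by rewrite tj.
have Rt := R_mobile ht; rewrite -/(R s t).
have RK : R s (R s t) = t.
  by apply: reflect_inK; [exact: mobilecols_sorted|rewrite mem_mobilecols].
case: eqP => [->|ai]; first by rewrite bk_i1 // RK.
case: eqP => [->|ai1]; first by rewrite bk_i // RK.
by rewrite bk_other //; apply/eqP.
Qed.

Lemma bk_ge s t a : j <= t -> bk f i j s t a = f s t a.
Proof. by move=> jt; rewrite bk_nonmobile // ltnNge jt. Qed.

Variable r : nat.
Hypothesis Lr : forall s, r <= s -> L s = 0.

Lemma f_out s t a : r <= s -> f s t a = false.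
Proof. by move=> rs; apply/negP => /(tab_sub tf); rewrite Lr. Qed.

(** The fixed letters i and i+1 come in vertical pairs. *)
Lemma nonmobile_sum t :
  \sum_(0 <= s < r) (~~ mobile f i s t && f s t i) =
  \sum_(0 <= s < r) (~~ mobile f i s t && f s t i.+1).
Proof.
pose g s := f s t i && f s.+1 t i.+1.
have -> : \sum_(0 <= s < r) (~~ mobile f i s t && f s t i) = \sum_(0 <= s < r) g s.
  apply: eq_bigr => s _; rewrite /g; congr nat_of_bool; apply/andP/andP => -[h1 h2].
    by split=> //; exact: nonmobile_i.
  by split=> //; apply/negP => h; exact: (mobile_not_above h h1 h2).
have E s : (~~ mobile f i s.+1 t && f s.+1 t i.+1) = g s.
  rewrite /g; apply/andP/andP => -[h1 h2].
    by split=> //; have := nonmobile_i1 h2 h1.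
  by split=> //; apply/negP => h; exact: (mobile_not_below h h1 h2).
have E0 : (~~ mobile f i 0 t && f 0 t i.+1) = false.
  by apply/negP => /andP[h1 h2]; have := nonmobile_i1 h2 h1.
case: r Lr f_out => [|r'] Lr' fo; first by rewrite !big_geq.
have gr : g r' = false by rewrite /g (fo r'.+1) ?andbF.
rewrite big_nat_recr //= gr addn0.
rewrite big_nat_recl // E0 add0n; apply: eq_bigr => s _; by rewrite E.
Qed.

Lemma bk_row_sum s (a b : nat) :
  ((a == i) && (b == i.+1)) || ((a == i.+1) && (b == i)) ->
  \sum_(0 <= t < j) bk f i j s t a =
  \sum_(0 <= t < j) (mobile f i s t && f s t b)
  + \sum_(0 <= t < j) (~~ mobile f i s t && f s t a).
Proof.
move=> ab; have bf t : t < j -> mobile f i s t -> bk f i j s t a = f s (R s t) b.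
  move=> tj fr; have h : (t < j) && mobile f i s t by rewrite tj.
  by case/orP: ab => /andP[/eqP-> /eqP->]; rewrite ?bk_i ?bk_i1.
rewrite (eq_big_nat _ _ (F2 := fun t => (mobile f i s t && f s (R s t) b)
   + (~~ mobile f i s t && f s t a))); last first.
  move=> t /andP[_ tj]; case h: (mobile f i s t); first by rewrite /= addn0 bf.
  by rewrite bk_nonmobile // h andbF.
rewrite big_split /=; congr (_ + _).
have G (F : nat -> bool) : \sum_(0 <= t < j) (mobile f i s t && F t) =
    \sum_(t <- fc s) F t.
  rewrite /fc /mobilecols big_filter /index_iota subn0 [RHS]big_mkcond /=.
  by apply: eq_bigr => t _; case: (mobile f i s t).
rewrite !G; exact: (sum_reflect_in (mobilecols_sorted s) (fun t => f s t b)).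
Qed.

Lemma bk_sum (a b : nat) :
  ((a == i) && (b == i.+1)) || ((a == i.+1) && (b == i)) ->
  \sum_(0 <= s < r) \sum_(0 <= t < j) bk f i j s t a =
  \sum_(0 <= s < r) \sum_(0 <= t < j) f s t b.
Proof.
move=> ab; under eq_bigr do rewrite (bk_row_sum _ ab).
have E s : \sum_(0 <= t < j) f s t b = \sum_(0 <= t < j) (mobile f i s t && f s t b)
  + \sum_(0 <= t < j) (~~ mobile f i s t && f s t b).
  rewrite -big_split /=; apply: eq_bigr => t _.
  by case: (mobile f i s t); rewrite /= ?addn0.
under [RHS]eq_bigr do rewrite E.
rewrite !big_split /=; congr (_ + _).
rewrite exchange_big /= [RHS]exchange_big /=; apply: eq_bigr => t _.
by case/orP: ab => /andP[/eqP-> /eqP->]; rewrite nonmobile_sum.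
Qed.

End BenderKnuth.

(** * Toggling a letter *)

(** A letter i+1 of column j without an i above it: in columns read from right to left,
    these are the letters where the number of i+1 can overtake that of i. *)
Definition starts f (i j s : nat) : bool := f s j i.+1 && ~~ above f s j i.

(** The letter to toggle: an i in the leftmost box containing i+1 of the row where
    column j contains i+1.  It depends only on the letters i+1, so that toggling it is
    an involution. *)
Definition zone f (i j s t a : nat) : bool :=
  [&& a == i, f s j i.+1, f s t i.+1 & all (fun t' => ~~ f s t' i.+1) (iota 0 t)].

Definition toggle f (i j : nat) : nat -> nat -> nat -> bool :=
  fun s t a => f s t a (+) zone f i j s t a.

Section Toggle.
Variables (L : nat -> nat) (f : nat -> nat -> nat -> bool).
Hypothesis Lanti : forall s s', s <= s' -> L s' <= L s.
Hypothesis tf : tab L f.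
Variables (i j s0 : nat).
Hypothesis st : starts f i j s0.

Lemma starts_i1 : f s0 j i.+1. Proof. by case/andP: st. Qed.

Lemma col_uniq s : f s j i.+1 -> s = s0.
Proof.
move=> fs; have fs0 := starts_i1; case: (ltngtP s s0) => // h.
  by have := tab_cols Lanti tf fs fs0 h; lia.
by have := tab_cols Lanti tf fs0 fs h; lia.
Qed.

Lemma zoneP : {t0 | [/\ t0 <= j, f s0 t0 i.+1, forall t, t < t0 -> ~~ f s0 t i.+1
  & forall s t a, zone f i j s t a = [&& s == s0, t == t0 & a == i]]}.
Proof.
have ex : exists t, f s0 t i.+1 by exists j; exact: starts_i1.
exists (ex_minn ex); case: ex_minnP => t0 ft0 mt0.
have lt t : t < t0 -> ~~ f s0 t i.+1.
  by move=> h; apply/negP => /mt0; rewrite leqNgt h.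
split=> // [|s t a]; first exact: mt0 starts_i1.
apply/and4P/and3P => [[ai fj ft al]|[/eqP-> /eqP-> ai]]; last first.
  split=> //; first exact: starts_i1.
  by apply/allP => t'; rewrite mem_iota add0n => /andP[_]; exact: lt.
have es := col_uniq fj; rewrite es in ft al *; split=> //.
rewrite eqn_leq mt0 // andbT leqNgt; apply/negP => h.
by move/allP: al => /(_ t0); rewrite mem_iota h => /(_ isT); rewrite ft0.
Qed.

(** The letter i fits in this box: its left neighbour does not contain i+1, and the box
    above does not contain i, for otherwise the boxes above would contain i up to
    column j, against [starts]. *)
Lemma toggle_tab : tab L (toggle f i j).
Proof.
have [t0 [t0j ft0 lt Z]] := zoneP.
have old s t a : toggle f i j s t a -> f s t a \/ [/\ s = s0, t = t0 & a = i].
  rewrite /toggle Z; case: (f s t a); first by left.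
  by case/and3P=> /eqP-> /eqP-> /eqP->; right.
split.
- move=> s t a /old[|[-> -> _]]; first exact: (tab_sub tf).
  exact: (tab_sub tf ft0).
- move=> s t /(tab_ex tf)[a fa].
  case z: (zone f i j s t a); last by exists a; rewrite /toggle fa z.
  move: z; rewrite Z => /and3P[/eqP-> /eqP-> _]; exists i.+1.
  by rewrite /toggle ft0 Z (_ : (i.+1 == i) = false) ?andbF //; lia.
- move=> s t a b /old[fa|[es et ea]] /old[fb|[es' et' eb]].
  + exact: (tab_row tf fa fb).
  + subst s b; rewrite -et' in ft0; have := tab_row tf fa ft0.
    suff : a != i.+1 by lia.
    by apply/eqP => ea; rewrite ea in fa; have := lt _ (_ : t < t0); rewrite fa; lia.
  + subst s t a; have := tab_row tf ft0 fb; lia.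
  + by lia.
- move=> s t a b /old[fa|[es et ea]] /old[fb|[es' et' eb]].
  + exact: (tab_col tf fa fb).
  + subst t b; rewrite -es' in ft0; have := tab_col tf fa ft0.
    suff : a != i by lia.
    apply/eqP => ea; subst a.
    have fj := starts_i1; move: st; rewrite /starts -es' /= => /andP[fsj /negP na].
    move: t0j; rewrite leq_eqVlt => /orP[/eqP e|h]; first by apply: na; rewrite -e.
    have [x fx] : exists x, f s j x.
      by apply: (tab_ex tf); apply: leq_trans (tab_sub tf fsj) (Lanti (leqnSn _)).
    have := tab_rows tf fa fx h; have := tab_col tf fx fsj => ? ?.
    by have e : x = i by [lia]; rewrite e in fx.
  + by subst s t a; have := tab_col tf ft0 fb; lia.
  + by lia.
Qed.

Lemma toggle_other s t a : a != i -> toggle f i j s t a = f s t a.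
Proof. by move=> /negbTE ai; rewrite /toggle /zone ai /= addbF. Qed.

Lemma toggle_gt s t a : j < t -> toggle f i j s t a = f s t a.
Proof.
have [t0 [t0j _ _ Z]] := zoneP; move=> jt; rewrite /toggle Z.
by have -> : t == t0 = false by [lia]; rewrite andbF addbF.
Qed.

Lemma zone_toggle s t a : zone (toggle f i j) i j s t a = zone f i j s t a.
Proof.
have n : i.+1 != i by lia.
rewrite /zone !toggle_other //; congr [&& _, _, _ & _].
by apply: eq_all => t'; rewrite toggle_other.
Qed.

Lemma toggleK s t a : toggle (toggle f i j) i j s t a = f s t a.
Proof. by rewrite {1}/toggle zone_toggle /toggle -addbA addbb addbF. Qed.

Lemma starts_toggle : starts (toggle f i j) i j s0.
Proof.
have [t0 [_ _ _ Z]] := zoneP.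
move: st; rewrite /starts toggle_other; last by lia.
case: s0 Z => [|s] Z //=; rewrite /toggle Z.
by have -> : s == s.+1 = false by [lia]; rewrite addbF.
Qed.

(** Some box of the row contains both i and i+1; it is then the box of [zone]. *)
Definition mixed (g : nat -> nat -> nat -> bool) := exists t, g s0 t i && g s0 t i.+1.

Lemma mixed_zone t0 : f s0 t0 i.+1 -> (forall t, t < t0 -> ~~ f s0 t i.+1) ->
  mixed f <-> f s0 t0 i.
Proof.
move=> ft0 lt; split=> [[t /andP[f1 f2]]|fi]; last by exists t0; rewrite fi.
case: (ltngtP t t0) f1 f2 => [h|h|->//] f1 f2; first by rewrite (negbTE (lt _ h)) in f2.
by have := tab_rows tf ft0 f1 h; lia.
Qed.

(** When the toggled letter is absent, column j contains no i, so that the Bender-Knuth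
    involution applies before column j. *)
Lemma unmixed_col : ~ mixed f -> forall s, ~~ f s j i.
Proof.
move=> nm s; apply/negP => fs; have fj := starts_i1.
case: (ltngtP s s0) => h; last by apply: nm; exists j; rewrite -h fs h fj.
  have /= hh := tab_cols Lanti tf fs fj h.
  have e : s0 = s.+1 by lia.
  by move: st; rewrite /starts e /= fs andbF.
by have := tab_cols Lanti tf fj fs h; lia.
Qed.

Lemma unmixed_bk : ~ mixed f -> ~ mixed (bk f i j).
Proof.
move=> nm [t]; case: (boolP ((t < j) && mobile f i s0 t)) => h.
  rewrite bk_i // bk_i1 // => /andP[h1 h2]; apply: nm.
  by exists (reflect_in (mobilecols f i j s0) t); rewrite h1 h2.
by rewrite !bk_nonmobile // => h1; apply: nm; exists t.
Qed.

Lemma starts_bk : starts (bk f i j) i j s0.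
Proof.
move: st; rewrite /starts bk_ge //; case: s0 => [|s] //=.
by rewrite bk_ge.
Qed.

End Toggle.

(** * Fillings *)

Section Fillings.
Variables r c n : nat.

(** Finitely many boxes and letters: a filling is its set of triples (row, column,
    letter), which makes the tableaux a finite type to sum over. *)
Definition filling := {set 'I_r * 'I_c * 'I_n}.

Definition inbox (F : filling) (s t a : nat) : bool :=
  [exists x in F, [&& x.1.1 == s :> nat, x.1.2 == t :> nat & x.2 == a :> nat]].

Definition fill (f : nat -> nat -> nat -> bool) : filling :=
  [set x : 'I_r * 'I_c * 'I_n | f x.1.1 x.1.2 x.2].

Lemma inboxE F (x : 'I_r * 'I_c * 'I_n) : inbox F x.1.1 x.1.2 x.2 = (x \in F).
Proof.
apply/existsP/idP => [[y /andP[yF /and3P[/eqP h1 /eqP h2 /eqP h3]]]|xF].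
  suff <- : y = x by [].
  move: x y h1 h2 h3 {yF} => [[x1 x2] x3] [[y1 y2] y3] /= *.
  by congr (_, _, _); exact: val_inj.
by exists x; rewrite xF !eqxx.
Qed.

Lemma inbox_bound F s t a : inbox F s t a -> [/\ s < r, t < c & a < n].
Proof. by case/existsP => x /andP[_ /and3P[/eqP<- /eqP<- /eqP<-]]. Qed.

Lemma inbox_fill f s t a : inbox (fill f) s t a = [&& s < r, t < c, a < n & f s t a].
Proof.
apply/idP/and4P => [h|[sr tc an fa]].
  have [sr tc an] := inbox_bound h; split=> //.
  by move: h; rewrite (inboxE _ ((Ordinal sr, Ordinal tc), Ordinal an)) inE.
by rewrite (inboxE _ ((Ordinal sr, Ordinal tc), Ordinal an)) inE.
Qed.

Lemma inbox_inj F F' : (forall s t a, inbox F s t a = inbox F' s t a) -> F = F'.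
Proof. by move=> h; apply/setP => x; rewrite -!inboxE h. Qed.

Lemma tab_eq L f g : (forall s t a, f s t a = g s t a) -> tab L f -> tab L g.
Proof.
move=> e [h1 h2 h3 h4]; split=> [s t a|s t /h2[a ha]|s t a b|s t a b]; rewrite -?e.
- exact: h1.
- by exists a; rewrite -e.
- exact: h3.
- exact: h4.
Qed.

Definition count_boxes (f : nat -> nat -> nat -> bool) (P : pred nat) (a : nat) : nat :=
  \sum_(0 <= s < r) \sum_(0 <= t < c | P t) f s t a.

Lemma eq_cnt f g (P P' : pred nat) a : (forall t, t < c -> P t = P' t) ->
  (forall s t, P t -> f s t a = g s t a) -> count_boxes f P a = count_boxes g P' a.
Proof.
move=> PP h; apply: eq_bigr => s _; rewrite [LHS]big_nat_cond [RHS]big_nat_cond.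
rewrite (eq_bigl (fun t => (0 <= t < c) && P' t)).
  by apply: eq_bigr => t /andP[/andP[_ tc]]; rewrite -PP // => Pt; rewrite h.
by move=> t; case: (ltnP t c) => tc //=; rewrite PP.
Qed.

Lemma cnt_split f (P Q : pred nat) a :
  count_boxes f P a =
  count_boxes f (fun t => P t && Q t) a + count_boxes f (fun t => P t && ~~ Q t) a.
Proof. by rewrite /count_boxes -big_split /=; apply: eq_bigr => s _; rewrite (bigID Q). Qed.

Lemma cnt_lt f j a : j <= c ->
  count_boxes f (fun t => t < j) a = \sum_(0 <= s < r) \sum_(0 <= t < j) f s t a.
Proof.
move=> jc; apply: eq_bigr => s _; rewrite (big_cat_nat (leq0n j) jc) /=.
rewrite [X in _ + X]big_nat_cond [X in _ + X]big_pred0 ?addn0 => [|t]; last by lia.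
by rewrite [LHS]big_nat_cond [RHS]big_nat_cond; apply: eq_bigl => t; lia.
Qed.

Lemma cnt_parts f j a : count_boxes f predT a =
  count_boxes f (fun t => t < j) a + count_boxes f (fun t => t == j) a
  + count_boxes f (fun t => j < t) a.
Proof.
rewrite (cnt_split f predT (fun t => t < j)) -addnA; congr (_ + _).
rewrite (cnt_split f _ (fun t => t == j)).
congr (_ + _); apply: eq_cnt => // t _ /=; lia.
Qed.

Lemma cnt0 f (P : pred nat) a : (forall s t, P t -> ~~ f s t a) -> count_boxes f P a = 0.
Proof. by move=> h; rewrite /count_boxes big1 // => s _; rewrite big1 // => t /h/negbTE->. Qed.

Lemma cnt_one f (P : pred nat) a s0 t0 : s0 < r -> t0 < c ->
  P t0 -> (forall s t, P t -> f s t a = (s == s0) && (t == t0)) -> count_boxes f P a = 1.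
Proof.
move=> sr tc Pt h; rewrite /count_boxes (bigD1_seq s0) ?mem_index_iota ?iota_uniq //=.
rewrite [X in _ + X]big1 ?addn0 => [|s /negbTE ss]; last first.
  by rewrite big1 // => t Pt'; rewrite h // ss.
rewrite big_mkcond (bigD1_seq t0) ?mem_index_iota ?iota_uniq //= Pt h // !eqxx.
rewrite big1 // => t /negbTE tt; by case: ifP => // Pt'; rewrite h // tt andbF.
Qed.

End Fillings.

(** * Lattice conditions by columns and by rows *)

Section Lattice.
Variables (r c : nat).

Definition cells (Q : nat -> nat -> bool) : nat :=
  \sum_(0 <= s < r) \sum_(0 <= t < c) Q s t.

Lemma eq_cells Q Q' : (forall s t, Q s t = Q' s t) -> cells Q = cells Q'.
Proof. by move=> h; apply: eq_bigr => s _; apply: eq_bigr => t _; rewrite h. Qed.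

Lemma leq_cells (Q Q' : nat -> nat -> bool) : (forall s t, Q s t -> Q' s t) -> cells Q <= cells Q'.
Proof.
move=> h; apply: leq_sum => s _; apply: leq_sum => t _.
by case: (Q s t) (h s t) => // ->.
Qed.

Lemma cells1 s0 t0 : s0 < r -> t0 < c -> cells (fun s t => (s == s0) && (t == t0)) = 1.
Proof.
move=> sr tc; rewrite -(@cnt_one r c (fun s t a => (s == s0) && (t == t0)) predT 0 s0 t0) //.
Qed.

Lemma cells0 (Q : nat -> nat -> bool) : (forall s t, ~~ Q s t) -> cells Q = 0.
Proof.
by move=> h; rewrite /cells big1 // => s _; rewrite big1 // => t _; rewrite (negbTE (h s t)).
Qed.

Lemma cellsU (Q1 Q2 : nat -> nat -> bool) : (forall s t, ~~ (Q1 s t && Q2 s t)) ->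
  cells (fun s t => Q1 s t || Q2 s t) = cells Q1 + cells Q2.
Proof.
move=> h; rewrite /cells -big_split /=; apply: eq_bigr => s _.
rewrite -big_split /=; apply: eq_bigr => t _.
by move: (h s t); case: (Q1 s t); case: (Q2 s t).
Qed.

Lemma ltn_cells (Q Q' : nat -> nat -> bool) s0 t0 : s0 < r -> t0 < c ->
  (forall s t, Q s t -> Q' s t) ->
  ~~ Q s0 t0 -> Q' s0 t0 -> cells Q < cells Q'.
Proof.
move=> sr tc h nq q'; rewrite -addn1 -(cells1 sr tc) -cellsU; last first.
  by move=> s t; apply/negP => /and3P[q /eqP es /eqP et]; move: nq; rewrite -es -et q.
by apply: leq_cells => s t /orP[/h//|/andP[/eqP-> /eqP->]].
Qed.

Lemma cells_ex (Q : nat -> nat -> bool) : 0 < cells Q -> exists s t, Q s t.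
Proof.
case: (boolP [exists s : 'I_r, exists t : 'I_c, Q s t]) => [/existsP[s /existsP[t q]] _|].
  by exists s, t.
move=> /existsPn h; rewrite /cells !big_mkord big1 // => s _; rewrite big_mkord big1 // => t _.
by have /existsPn/(_ t)/negbTE -> := h s.
Qed.

Lemma cntE f (P : pred nat) a : count_boxes r c f P a = cells (fun s t => P t && f s t a).
Proof. by apply: eq_bigr => s _; rewrite big_mkcond; apply: eq_bigr => t _; case: (P t). Qed.

Definition before (s t s' t' : nat) : bool := (s' < s) || ((s' == s) && (t < t')).

Definition bef (f : nat -> nat -> nat -> bool) (s t a : nat) : nat :=
  cells (fun s' t' => before s t s' t' && f s' t' a).

Variable al : nat -> nat.

(** The lattice condition for columns read from right to left, with al counting the
    letters already read.  Forbidding equality is enough: the excess of i over i+1 can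
    only drop by one at a time, see [colgood_ge]. *)
Definition colgood (f : nat -> nat -> nat -> bool) := forall i j s, starts f i j s ->
  al i.+1 + count_boxes r c f (fun t => j < t) i.+1 <> al i + count_boxes r c f (fun t => j < t) i.

(** The reverse lattice condition of w(T) u(sigma): it looks at what follows a letter, hence
    rows from top to bottom and each row from right to left. *)
Definition rowgood (f : nat -> nat -> nat -> bool) := forall s t i, f s t i.+1 ->
  al i.+1 + bef f s t i.+1 < al i + bef f s t i.

Variables (L : nat -> nat) (f : nat -> nat -> nat -> bool).
Hypothesis Lanti : forall s s', s <= s' -> L s' <= L s.
Hypothesis Lr : forall s, r <= s -> L s = 0.
Hypothesis Lc : forall s, L s <= c.
Hypothesis tf : tab L f.

Lemma box_in s t a : f s t a -> s < r /\ t < c.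
Proof.
move=> /(tab_sub tf) h; split; last exact: leq_trans h (Lc s).
by rewrite ltnNge; apply/negP => /Lr e; rewrite e in h.
Qed.

(** The boxes read in only one of the two orders lie to the northwest or strictly southeast
    of the letter i+1; strictness excludes both letters there, except for an i in the row
    directly above, which would force an i into the box above. *)
Lemma starts_bef i s t a : starts f i t s -> (a == i) || (a == i.+1) ->
  count_boxes r c f (fun t' => t < t') a = bef f s t a.
Proof.
move=> /andP[fi1 na] ai; rewrite cntE; apply: eq_cells => s' t'.
case fa: (f s' t' a); rewrite ?andbF // !andbT /before.
case: (ltngtP s' s) => //= h; last first.
  apply/negbTE/negP => tt'.
  by have := tab_mono Lanti tf h (ltnW tt') fi1 fa; lia.
apply/negPn; rewrite -leqNgt; apply/negP => t't.
have m := tab_mono Lanti tf h t't fa fi1.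
have ea : a = i by lia.
have es : s = s'.+1 by lia.
subst a s; move/negP: na; apply => /=; move: t't; rewrite leq_eqVlt => /orP[/eqP <- //|t't].
have [x fx] : exists x, f s' t x.
  by apply: (tab_ex tf); apply: leq_trans (tab_sub tf fi1) (Lanti (leqnSn _)).
have := tab_rows tf fa fx t't; have := tab_col tf fx fi1 => ? ?.
by have <- : x = i by lia.
Qed.

Lemma rowgood_colgood : rowgood f -> colgood f.
Proof.
move=> rg i j s st; rewrite !(starts_bef st) ?eqxx ?orbT //.
by have := rg s j i (starts_i1 st); lia.
Qed.

Hypothesis al_anti : forall i, al i.+1 <= al i.

(** The excess of i over i+1 in the columns from j on never becomes negative. *)
Lemma colgood_ge i j : colgood f ->
  al i.+1 + count_boxes r c f (fun t => j <= t) i.+1 <=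
  al i + count_boxes r c f (fun t => j <= t) i.
Proof.
move=> cg; have big : forall j, c <= j -> al i.+1 + count_boxes r c f (fun t => j <= t) i.+1
    <= al i + count_boxes r c f (fun t => j <= t) i.
  move=> j' cj; rewrite !cnt0 ?addn0 // => s t jt; apply/negP => /box_in[_]; lia.
have [d] := ubnP (c - j); elim: d j => // d IH j jd.
case: (leqP c j) => cj; first exact: big.
have {}IH := IH j.+1 (_ : c - j.+1 < d); have {}IH := IH ltac:(lia).
have S a : count_boxes r c f (fun t => j <= t) a =
    count_boxes r c f (fun t => t == j) a + count_boxes r c f (fun t => j < t) a.
  by rewrite (cnt_split r c f _ (fun t => t == j) a); congr (_ + _); apply: eq_cnt => // t _ /=;
    lia.
rewrite !S; case: (boolP [exists s : 'I_r, f s j i.+1]) => [/existsP[s fs]|/existsPn nf];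
  last first.
  rewrite [X in al i.+1 + (X + _)]cnt0 ?add0n; first by lia.
  move=> s t /eqP->; apply/negP => h; have [sr _] := box_in h.
  by move: (nf (Ordinal sr)); rewrite h.
have C1 : count_boxes r c f (fun t => t == j) i.+1 = 1.
  apply: (cnt_one (ltn_ord s) cj) => // s' t /eqP->; rewrite eqxx andbT; apply/idP/eqP => [h|->//].
  by case: (ltngtP s' s) => // ss; [have := tab_cols Lanti tf h fs ss|have := tab_cols Lanti tf
    fs h ss]; lia.
rewrite C1; case: (boolP (above f s j i)) => [ab|na]; last first.
  have st : starts f i j s by rewrite /starts fs.
  by have := cg _ _ _ st; lia.
suff : 0 < count_boxes r c f (fun t => t == j) i by lia.
case es : (nat_of_ord s) ab => [//|s'] /= ab.
have [s'r _] := box_in ab.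
rewrite -(cells0 (fun _ _ => isT : ~~ false)) cntE.
by apply: (@ltn_cells _ _ s' j) => //; rewrite eqxx ab.
Qed.

(** A letter i+1 of the row reading with an i above it needs an argument of its own: the
    i read before it are those of the columns from u on, where u is the column of the
    leftmost i in the row above, and the i+1 read before it are among those of the same
    columns, which also contain the present i+1. *)
Lemma colgood_rowgood : colgood f -> rowgood f.
Proof.
move=> cg s t i fi1; case: (boolP (above f s t i)) => [ab|na]; last first.
  have st : starts f i t s by rewrite /starts fi1.
  rewrite -!(starts_bef st) ?eqxx ?orbT //.
  have := cg _ _ _ st; have /= := @colgood_ge i t.+1 cg; lia.
case: s fi1 ab => [//|s] fi1 /= ab.
have ex : exists u, f s u i by exists t.
case: (ex_minnP ex) => u fu mu.
have ut : u <= t by apply: mu.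
have E : bef f s.+1 t i = count_boxes r c f (fun t' => u <= t') i.
  rewrite cntE; apply: eq_cells => s' t'; case fa: (f s' t' i); rewrite ?andbF // !andbT /before.
  have ss : (s' == s.+1) && (t < t') = false.
    by apply/negP => /andP[/eqP e tt']; rewrite e in fa; have := tab_rows tf fi1 fa tt'; lia.
  rewrite ss orbF ltnS; apply/idP/idP => [|h].
    rewrite leq_eqVlt => /orP[/eqP e|s's]; first by rewrite e in fa; exact: mu.
    by rewrite leqNgt; apply/negP => t'u; have := tab_mono Lanti tf s's (ltnW t'u) fa fu; lia.
  by rewrite leqNgt; apply/negP => s's; have := tab_mono Lanti tf s's h fu fa; lia.
have E1 : bef f s.+1 t i.+1 < count_boxes r c f (fun t' => u <= t') i.+1.
  have [sr tc] := box_in fi1.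
  rewrite cntE; apply: (ltn_cells sr tc); last 2 first.
  - by rewrite /before ltnn eqxx ltnn.
  - by rewrite ut fi1.
  move=> s' t' /andP[bf fa]; rewrite fa andbT leqNgt; apply/negP => t'u.
  case/orP: bf => [|/andP[/eqP _ tt']]; last by lia.
  rewrite ltnS leq_eqVlt => /orP[/eqP e|s's].
    by rewrite e in fa; have := tab_rows tf fa fu t'u; lia.
  by have := tab_mono Lanti tf s's (ltnW t'u) fa fu; lia.
by have := @colgood_ge i u cg; rewrite -E; lia.
Qed.

(** A letter i+1 must be preceded by an i when al does not provide one; this i is in a row
    strictly above. *)
Lemma rowgood_step s t i : rowgood f -> al i <= al i.+1 -> f s t i.+1 ->
  exists s' t', s' < s /\ f s' t' i.
Proof.
move=> rg ali fa; have h : 0 < bef f s t i by have := rg _ _ _ fa; lia.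
have [s' [t' /andP[bf fi]]] := cells_ex h; exists s', t'; split=> //.
case/orP: bf => // /andP[/eqP e tt']; rewrite e in fi.
by have := tab_rows tf fa fi tt'; lia.
Qed.

(** Going back through the letters i, i-1, ... one moves to strictly higher rows, so the row
    index is at least the letter; by column strictness it is at most the letter. *)
Lemma rowgood_row p : (forall i, i.+1 < p -> al i.+1 = al i) -> rowgood f ->
  forall s t a, f s t a -> a < p -> a = s.
Proof.
move=> alp rg s t a fa ap; apply/eqP; rewrite eqn_leq (tab_ge Lanti tf fa) andbT.
elim: a s t ap fa => [//|i IH] s t ip fa.
have [|s' [t' [s's fi]]] := rowgood_step rg _ fa; first by rewrite alp.
by apply: leq_trans s's; rewrite ltnS; apply: IH fi; lia.
Qed.

Lemma rowgood_bound k : (forall i, k <= i -> al i = 0) -> rowgood f ->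
  forall s t a, f s t a -> a <= k + s.
Proof.
move=> al0 rg s t a; elim: a s t => [//|i IH] s t fa.
case: (ltnP i k) => ik; first by lia.
have [|s' [t' [s's /IH h]]] := rowgood_step rg _ fa; first by rewrite (al0 i).
lia.
Qed.

End Lattice.

(** * Reverse lattice words *)

(** Splitting off the suffix v makes the condition compatible with concatenation, see
    [lattice_over_cat]. *)
Definition lattice_over (w v : seq nat) : Prop := forall w1 x w2,
  w = w1 ++ x.+2 :: w2 -> count_mem x.+2 (w2 ++ v) < count_mem x.+1 (w2 ++ v).

Lemma reverse_lattice_over w : reverse_lattice w <-> lattice_over w [::].
Proof.
split=> [rl w1 x w2 e|ov k ks /=].
  have := rl (size w1); rewrite e size_cat /= -addSnnS leq_addr => /(_ isT).
  rewrite nth_cat ltnn subnn /= => /(_ isT).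
  by rewrite -[w1 ++ _]/(w1 ++ [:: x.+2] ++ w2) catA drop_size_cat ?cats0 // size_cat addn1.
case e: (nth 0 w k) => [|[|x]] // _.
have := ov (take k w) x (drop k.+1 w); rewrite cats0; apply.
by rewrite -e -drop_nth // cat_take_drop.
Qed.

Lemma lattice_over_nil v : lattice_over [::] v.
Proof. by move=> [|? ?] ? ?. Qed.

Lemma lattice_over_cons y w v : lattice_over (y :: w) v <->
  (forall x, y = x.+2 -> count_mem x.+2 (w ++ v) < count_mem x.+1 (w ++ v)) /\
  lattice_over w v.
Proof.
split=> [h|[h1 h2] [|z w1] x w2 [e1 e2]].
- split=> [x e|w1 x w2 e]; first by apply: (h [::]); rewrite e.
  by apply: (h (y :: w1)); rewrite e.
- by rewrite -e2; exact: h1.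
- exact: (h2 _ _ _ e2).
Qed.

Lemma lattice_over_cat a b v :
  lattice_over (a ++ b) v <-> lattice_over a (b ++ v) /\ lattice_over b v.
Proof.
elim: a => [|y a IH] /=; first by split=> [h|[]//]; split=> //; exact: lattice_over_nil.
rewrite !lattice_over_cons IH catA; tauto.
Qed.

Lemma lattice_over_flatten (ws : seq (seq nat)) v : lattice_over (flatten ws) v <->
  forall k, k < size ws -> lattice_over (nth [::] ws k) (flatten (drop k.+1 ws) ++ v).
Proof.
elim: ws v => [|w ws IH] v /=; first by split=> // _; exact: lattice_over_nil.
rewrite lattice_over_cat IH; split=> [[h1 h2] [|k] ks /=|h]; first by rewrite drop0.
- exact: h2.
- split=> [|k ks]; first by have := h 0 isT; rewrite /= drop0.
  exact: (h k.+1 ks).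
Qed.

(** The letters of a box are read from the largest one, so that none of them helps
    another one. *)
Lemma lattice_over_box (A : {fset nat}) v : lattice_over (sort leq (enum_fset A)) v <->
  forall x, x.+2 \in A -> count_mem x.+2 v < count_mem x.+1 v.
Proof.
have us : uniq (sort leq (enum_fset A)) by rewrite sort_uniq fset_uniq.
have ss : sorted leq (sort leq (enum_fset A)) by apply: sort_sorted; exact: leq_total.
have tail w1 x w2 : sort leq (enum_fset A) = w1 ++ x.+2 :: w2 ->
    count_mem x.+2 w2 = 0 /\ count_mem x.+1 w2 = 0.
  move=> e; move: us ss; rewrite e cat_uniq /= => /and3P[_ _ /andP[xw _]].
  rewrite (sorted_pairwise leq_trans) pairwise_cat /= => /and3P[_ _ /andP[/allP al _]].
  split; apply/count_memPn; first exact: xw.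
  by apply/negP => /al; rewrite ltnn.
split=> [h x xA|h w1 x w2 e].
  have := xA; rewrite -(mem_sort leq) => /path.splitPr.
  case e: {1}_ / => [w1 w2]; have [c1 c2] := tail _ _ _ e.
  by have := h _ _ _ e; rewrite !count_cat c1 c2.
have [c1 c2] := tail _ _ _ e; rewrite !count_cat c1 c2; apply: h.
by rewrite -(mem_sort leq) e mem_cat inE eqxx orbT.
Qed.

Definition row_word (r : seq {fset nat}) : seq nat :=
  flatten [seq sort leq (enum_fset A) | A <- r].

Lemma count_row_word y r : count_mem y (row_word r) = \sum_(A <- r) (y \in A).
Proof.
rewrite /row_word count_flatten sumnE !big_map; apply: eq_bigr => A _.
by rewrite count_uniq_mem ?sort_uniq ?fset_uniq // mem_sort.
Qed.

Lemma lattice_over_row r v : lattice_over (row_word r) v <->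
  forall t x, t < size r -> x.+2 \in nth fset0 r t ->
    count_mem x.+2 (row_word (drop t.+1 r) ++ v) < count_mem x.+1 (row_word (drop t.+1 r) ++ v).
Proof.
rewrite /row_word lattice_over_flatten size_map; split=> h t.
  move=> x tr xA; have := h t tr; rewrite (nth_map fset0) // -map_drop.
  by move/lattice_over_box; apply.
by move=> tr; rewrite (nth_map fset0) // -map_drop; apply/lattice_over_box => x; exact: h.
Qed.

Definition rows_word (t : seq (seq {fset nat})) : seq nat := flatten [seq row_word r | r <- rev t].

Lemma lattice_over_rows t v : lattice_over (rows_word t) v <->
  forall s, s < size t -> lattice_over (row_word (nth [::] t s)) (rows_word (take s t) ++ v).
Proof.
rewrite /rows_word lattice_over_flatten size_map size_rev.
have E k : k < size t ->
    nth [::] [seq row_word r | r <- rev t] k = row_word (nth [::] t (size t - k.+1)) /\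
    drop k.+1 [seq row_word r | r <- rev t] =
      [seq row_word r | r <- rev (take (size t - k.+1) t)].
  move=> kt; rewrite (nth_map [::]) ?size_rev // nth_rev //; split=> //.
  by rewrite -map_drop drop_rev.
split=> h s st.
  have ks : size t - s.+1 < size t by lia.
  have := h _ ks; have [-> ->] := E _ ks.
  by have -> : size t - (size t - s.+1).+1 = s by lia.
by have [-> ->] := E _ st; apply: h; lia.
Qed.

Lemma count_rows_word y t : count_mem y (rows_word t) = \sum_(r <- t) \sum_(A <- r) (y \in A).
Proof.
rewrite /rows_word count_flatten sumnE !big_map (perm_big t) ?perm_rev //=.
by apply: eq_bigr => r _; rewrite count_row_word.
Qed.

Lemma count_part_word si y : count_mem y.+1 (part_word si) = part si y.
Proof.
rewrite /part_word count_flatten sumnE big_map (perm_big (mkseq (fun i =>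
  nseq (part si i) i.+1) (size si))) ?perm_rev //=.
rewrite /mkseq big_map (eq_bigr (fun i => (i == y) * part si i)) => [|i _]; last first.
  by rewrite count_nseq /= eqSS.
case: (ltnP y (size si)) => ys.
  rewrite (bigD1_seq y) ?mem_iota ?iota_uniq //= eqxx mul1n big1 ?addn0 // => i /negbTE->;
    by rewrite mul0n.
rewrite /part (nth_default _ ys) big_seq big1 // => i; rewrite mem_iota add0n => /andP[_ ilt].
by have -> : i == y = false by lia.
Qed.

Lemma lattice_part_word si : lattice_over (part_word si) [::].
Proof.
rewrite /part_word lattice_over_flatten size_rev size_mkseq => k ks; rewrite cats0.
rewrite nth_rev ?size_mkseq // drop_rev size_mkseq.
set i := size si - k.+1; have il : i < size si by rewrite /i; lia.
rewrite nth_mkseq // => w1 x w2 e.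
have ex : x.+2 = i.+1.
  have : x.+2 \in nseq (part si i) i.+1 by rewrite e mem_cat inE eqxx orbT.
  by rewrite mem_nseq => /andP[_ /eqP].
have cw2 : count_mem x.+2 w2 < part si i.
  have := congr1 (count_mem x.+2) e; rewrite count_nseq /= ex eqxx mul1n count_cat /= => ->.
  by rewrite eqxx; lia.
have cz : take i (mkseq (fun i => nseq (part si i) i.+1) (size si)) =
    mkseq (fun i => nseq (part si i) i.+1) i.
  by rewrite /mkseq -map_take take_iota; congr (map _ (iota _ _)); apply/minn_idPl; lia.
rewrite cz !count_cat.
have C y : count_mem y.+1 (flatten (rev (mkseq (fun i => nseq (part si i) i.+1) i))) =
    if y < i then part si y else 0.
  rewrite count_flatten sumnE big_map (perm_big (mkseq (fun i =>
    nseq (part si i) i.+1) i)) ?perm_rev //=.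
  rewrite /mkseq big_map (eq_bigr (fun i => (i == y) * part si i)) => [|i' _]; last first.
    by rewrite count_nseq /= eqSS.
  case: (ltnP y i) => ys.
    rewrite (bigD1_seq y) ?mem_iota ?iota_uniq //= eqxx mul1n big1 ?addn0 // => i' /negbTE->;
      by rewrite mul0n.
  rewrite big_seq big1 // => i'; rewrite mem_iota add0n => /andP[_ ilt].
  by have -> : i' == y = false by lia.
rewrite !C; have -> : x.+1 < i = false by lia.
have -> : x < i by lia.
have := part_anti si (_ : x <= i); lia.
Qed.

(** * Words and letters of set-valued tableaux *)

Definition svf (T : seq (seq {fset nat})) (s t a : nat) : bool := a.+1 \in box T s t.

Section SvTableau.
Variable T : svtableau.
Let p := svt_shape T.

Lemma size_svt_shape : size p = size T.
Proof. by rewrite size_map. Qed.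

Lemma part_svt_shape s : part p s = size (nth [::] T s).
Proof.
rewrite /part /p /= /shape; case: (ltnP s (size T)) => sT; first by rewrite (nth_map [::]).
by rewrite !nth_default ?size_map.
Qed.

Lemma box_out s t : part p s <= t -> box T s t = fset0.
Proof. by rewrite part_svt_shape => h; rewrite /box nth_default. Qed.

Lemma box_cond s t : t < part p s -> [/\ box T s t != fset0, 0 \notin box T s t,
  allrel leq (box T s t) (box T s t.+1) & allrel ltn (box T s t) (box T s.+1 t)].
Proof.
move=> ts; have sT : s < size T.
  by rewrite ltnNge; apply/negP => h; move: ts; rewrite part_svt_shape nth_default.
have /andP[_ /allP/(_ s)] := svt_rowsP T; rewrite mem_iota add0n sT => /(_ isT)/allP/(_ t).
rewrite mem_iota add0n; have -> : nth 0 (shape T) s = part p s by [].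
by rewrite ts => /(_ isT)/and4P[].
Qed.

Lemma svf_tab : tab (part p) (svf T).
Proof.
split=> [s t a|s t ts|s t a b fa fb|s t a b fa fb].
- by rewrite ltnNge; apply: contraL => h; rewrite /svf box_out.
- have [n0 z _ _] := box_cond ts; have /fset0Pn[[|a] ha] := n0; first by rewrite ha in z.
  by exists a.
- have ts : t < part p s by rewrite ltnNge; apply/negP => h; move: fa; rewrite /svf box_out.
  by have [_ _ /allrelP/(_ _ _ fa fb) + _] := box_cond ts.
- have ts : t < part p s by rewrite ltnNge; apply/negP => h; move: fa; rewrite /svf box_out.
  by have [_ _ _ /allrelP/(_ _ _ fa fb)] := box_cond ts.
Qed.

Lemma zero_notin_box s t : 0 \notin box T s t.
Proof.
case: (ltnP t (part p s)) => ts; first by have [] := box_cond ts.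
by rewrite box_out.
Qed.

Lemma svf_box s t k : (k \in box T s t) = (if k is a.+1 then svf T s t a else false).
Proof. by case: k => //; apply/negbTE; exact: zero_notin_box. Qed.

Lemma sum_row s r0 (y : nat) : part p s <= r0 ->
  \sum_(A <- nth [::] T s) (y.+1 \in A) = \sum_(0 <= t < r0) svf T s t y.
Proof.
move=> pr; rewrite (big_nth fset0) -part_svt_shape (big_cat_nat (leq0n _) pr) /=.
rewrite [X in _ + X]big_nat_cond [X in _ + X]big1 ?addn0 // => t /andP[/andP[h _] _].
by rewrite /svf box_out.
Qed.

Let r := size p.
Let c := part p 0.

Lemma count_svt_word y : count_mem y.+1 (svt_word T) = count_boxes r c (svf T) predT y.
Proof.
have -> : svt_word T = rows_word T by [].
rewrite count_rows_word (big_nth [::]) /r size_svt_shape.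
by apply: eq_bigr => s _; rewrite (@sum_row s c) // part_anti.
Qed.

Lemma count_before s t y v : t < part p s ->
  count_mem y.+1 (row_word (drop t.+1 (nth [::] T s)) ++ rows_word (take s T) ++ v) =
  count_mem y.+1 v + bef r c (svf T) s t y.
Proof.
move=> ts; have sT : s < size T.
  by rewrite ltnNge; apply/negP => h; move: ts; rewrite part_svt_shape nth_default.
have sr : s < r by rewrite /r size_svt_shape.
have tc : t < c by apply: leq_trans ts _; exact: part_anti.
rewrite !count_cat addnA addnC; congr (_ + _).
rewrite count_row_word count_rows_word /bef /cells.
rewrite (big_cat_nat (leq0n s) (ltnW sr)) /= addnC; congr (_ + _).
  rewrite (big_nth [::]) size_take sT; apply: eq_big_nat => s' /andP[_ s's].
  rewrite nth_take // (@sum_row s' c) ?part_anti //; apply: eq_bigr => t' _.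
  by rewrite /before s's.
rewrite (big_ltn sr) [X in _ + X]big_nat_cond [X in _ + X]big1 ?addn0; last first.
  move=> s' /andP[/andP[ss' _] _]; rewrite big1 // => t' _; rewrite /before.
  by rewrite ltnNge (ltnW ss') /= gtn_eqF.
rewrite (big_cat_nat (leq0n t.+1) tc) /= [X in X + _]big_nat_cond [X in X + _]big1 ?add0n;
  last first.
  by move=> t' /andP[/andP[_ t't] _]; rewrite /before ltnn eqxx /= ltnNge -ltnS t't.
rewrite (eq_big_nat _ _ (F2 := fun t' => svf T s t' y : nat)); last first.
  by move=> t' /andP[tt' _]; rewrite /before ltnn eqxx tt'.
rewrite (big_nth fset0) size_drop -part_svt_shape.
rewrite [RHS](_ : _ = \sum_(0 + t.+1 <= t' < c) svf T s t' y) // big_addn.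
rewrite [RHS](big_cat_nat (leq0n (part p s - t.+1))) /=; last by apply: leq_sub2r; exact: part_anti.
rewrite [X in _ + X]big_nat_cond [X in _ + X]big1 ?addn0; last first.
  by move=> t' /andP[/andP[h _] _]; rewrite /svf box_out //; lia.
by apply: eq_big_nat => t' _; rewrite nth_drop addnC.
Qed.

Lemma reverse_lattice_rowgood (si : intpart) :
  reverse_lattice (svt_word T ++ part_word si) <-> rowgood r c (part si) (svf T).
Proof.
rewrite reverse_lattice_over lattice_over_cat cats0.
have -> : svt_word T = rows_word T by [].
rewrite lattice_over_rows; split=> [[h _] s t x fx|h].
  have ts := tab_sub svf_tab fx.
  have sT : s < size T.
    by rewrite ltnNge; apply/negP => h'; move: ts; rewrite part_svt_shape nth_default.
  have /lattice_over_row/(_ t x) := h s sT; rewrite -part_svt_shape => /(_ ts fx).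
  by rewrite !count_before // !count_part_word.
split; last exact: lattice_part_word.
move=> s sT; apply/lattice_over_row => t x; rewrite -part_svt_shape => ts fx.
by rewrite !count_before // !count_part_word; exact: h.
Qed.

Lemma has_content_cnt (si nu : intpart) : has_content (svt_word T ++ part_word si) nu <->
  forall i, count_boxes r c (svf T) predT i + part si i = part nu i.
Proof.
by split=> h i; have := h i; rewrite count_cat count_svt_word count_part_word.
Qed.

End SvTableau.

Lemma svt_ext (T T' : svtableau) : svt_shape T = svt_shape T' ->
  (forall s t a, svf T s t a = svf T' s t a) -> T = T'.
Proof.
move=> es ef; apply: val_inj => /=; apply: (@eq_from_nth _ [::]).
  by rewrite -!size_svt_shape es.
move=> s _; apply: (@eq_from_nth _ fset0); first by rewrite -!part_svt_shape es.
by move=> t _; apply/fsetP => k; rewrite -!/(box _ s t) !svf_box; case: k.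
Qed.

Section Build.
Variables (n : nat) (p : intpart) (f : nat -> nat -> nat -> bool).
Hypothesis tf : tab (part p) f.
Hypothesis fn : forall s t a, f s t a -> a < n.

Definition letters_box s t : {fset nat} := [fset a.+1 | a in [seq a <- iota 0 n | f s t a]]%fset.

Lemma letters_boxS s t a : (a.+1 \in letters_box s t) = f s t a.
Proof.
apply/imfsetP/idP => [[b /=]|fa].
  by rewrite mem_filter => /andP[fb _] [->].
by exists a; rewrite //= mem_filter fa mem_iota add0n (fn fa).
Qed.

Lemma letters_box0 s t : 0 \notin letters_box s t.
Proof. by apply/negP => /imfsetP[b]. Qed.

Definition build_rows : seq (seq {fset nat}) :=
  mkseq (fun s => mkseq (letters_box s) (part p s)) (size p).

Lemma shape_build : shape build_rows = p.
Proof.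
apply: (@eq_from_nth _ 0); rewrite size_map size_mkseq // => s sp.
by rewrite (nth_map [::]) ?size_mkseq // nth_mkseq // size_mkseq.
Qed.

Lemma box_build s t : box build_rows s t = if t < part p s then letters_box s t else fset0.
Proof.
rewrite /box; case: (ltnP s (size p)) => sp; last first.
  rewrite [nth [::] _ _]nth_default ?size_mkseq // nth_nil.
  by rewrite /part nth_default.
rewrite nth_mkseq //; case: ltnP => ts; first by rewrite nth_mkseq.
by rewrite nth_default ?size_mkseq.
Qed.

Lemma box_buildS s t k : (k \in box build_rows s t) = (if k is a.+1 then f s t a else false).
Proof.
rewrite box_build; case: ltnP => ts; case: k => [|a] //.
- by apply/negbTE; exact: letters_box0.
- exact: letters_boxS.
- by rewrite in_fset0; apply/esym/negbTE/negP => /(tab_sub tf); rewrite ltnNge ts.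
Qed.

Lemma is_svt_build : is_svt build_rows.
Proof.
apply/andP; split; first by rewrite shape_build; exact: part_seqP.
apply/allP => s; rewrite mem_iota => _; apply/allP => t.
rewrite mem_iota add0n shape_build => /= ts; apply/and4P; split.
- have [a fa] := tab_ex tf ts; apply/fset0Pn; exists a.+1; by rewrite box_buildS.
- by rewrite box_buildS.
- apply/allrelP => -[|a] [|b]; rewrite !box_buildS // ltnS => fa fb; exact: (tab_row tf fa fb).
- apply/allrelP => -[|a] [|b]; rewrite !box_buildS //= ltnS => fa fb; exact: (tab_col tf fa fb).
Qed.

Definition build : svtableau := SVTableau is_svt_build.

Lemma build_shape : svt_shape build = p.
Proof. by apply: val_inj; exact: shape_build. Qed.

Lemma build_svf s t a : svf build s t a = f s t a.
Proof. by rewrite /svf box_buildS. Qed.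
End Build.

(** * Lattice fillings of a rectangle *)

Section Rect.
Variables (r c p q : nat) (la mu : intpart).

Definition rectL (s : nat) : nat := if s < r then c else 0.
(** The letters of u((q)^p), which are read before the tableau. *)
Definition hullA (i : nat) : nat := if i < p then q else 0.

(** The boxes of the partition la rotated into the lower-right corner. *)
Definition rotc (s t : nat) : bool := [&& s < r, t < c & c - t.+1 < part la (r - s.+1)].

(** The covering and rook-strip conditions of [rook_complementary], on natural numbers. *)
Definition rook_cells : Prop :=
  [/\ forall s, part mu s <= rectL s, forall s, part la s <= rectL s,
      forall s t, s < r -> t < c -> (t < part mu s) || rotc s t
    & forall s t s' t', t < part mu s -> rotc s t -> t' < part mu s' -> rotc s' t' ->
        s = s' \/ t = t' -> s = s' /\ t = t'].

Definition rdepth (s t : nat) : nat := \sum_(0 <= s' < s) rotc s' t.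

(** The only candidate for a tableau of shape (c)^r counted with content rho, see
    [rect_fill_uniq]. *)
Definition rect_fill (s t a : nat) : bool :=
  if a < p then (a == s) && (t < part mu s) else rotc s t && (a == p + rdepth s t).

Hypotheses (lap : size la <= p) (mup : size mu <= p) (laq : part la 0 <= q).

Section Forward.
Variable f : nat -> nat -> nat -> bool.
Hypothesis tf : tab rectL f.
Hypothesis rg : rowgood r c hullA f.
Hypothesis cmu : forall i, i < p -> count_boxes r c f predT i = part mu i.
Hypothesis cla : forall y, count_boxes r c f predT (p + y) = part la y.

Lemma rectL_anti s s' : s <= s' -> rectL s' <= rectL s.
Proof. by rewrite /rectL => h; case: (ltnP s' r) => // s'r; rewrite (leq_ltn_trans h s'r). Qed.

Lemma rectL_out s : r <= s -> rectL s = 0.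
Proof. by rewrite /rectL ltnNge => ->. Qed.

Lemma rectL_le s : rectL s <= c.
Proof. by rewrite /rectL; case: ifP. Qed.

Lemma in_rect s t a : f s t a -> s < r /\ t < c.
Proof. exact: (box_in rectL_out rectL_le tf). Qed.

Lemma rect_ex s t : s < r -> t < c -> exists a, f s t a.
Proof. by move=> sr tc; apply: (tab_ex tf); rewrite /rectL sr. Qed.

Lemma low_row s t a : f s t a -> a < p -> a = s.
Proof.
apply: (rowgood_row rectL_anti tf) rg _ _ _ => i ip.
by rewrite /hullA ip (ltnW ip).
Qed.

Lemma low_letters s t : s < p -> f s t s = (t < part mu s).
Proof.
move=> sp; have down t1 t2 : f s t1 s -> t2 < t1 -> f s t2 s.
  move=> f1 t21; have [sr tc] := in_rect f1.
  have [x fx] := rect_ex sr (ltn_trans t21 tc).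
  have xs := tab_rows tf fx f1 t21.
  by rewrite -{2}(low_row fx (leq_ltn_trans xs sp)).
rewrite (prefix_count down (r := c)) => [|t' /in_rect[]//].
rewrite -cmu // /count_boxes; case: (ltnP s r) => sr; last first.
  rewrite [in RHS]big_nat_cond [in RHS]big1 => [|s' /andP[/andP[_ s'r] _]].
    by rewrite big1 // => t' _; apply/eqP; rewrite eqb0; apply/negP => /in_rect[]; lia.
  rewrite big1 // => t' _; apply/eqP; rewrite eqb0; apply/negP => h.
  by have := low_row h sp; lia.
rewrite [in RHS](bigD1_seq s) ?mem_index_iota ?iota_uniq //= [X in _ + X]big1 ?addn0 // => s' s's.
rewrite big1 // => t' _; apply/eqP; rewrite eqb0; apply/negP => h.
by rewrite (low_row h sp) eqxx in s's.
Qed.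

Lemma rg_colgood : colgood r c hullA f.
Proof. exact: (rowgood_colgood rectL_anti tf rg). Qed.

(** Otherwise, by the lattice condition, b and b+1 would not be equally frequent in the
    columns on the right; by induction one of these columns ends with b in the bottom row,
    weakly below and to the right of a letter b+1, which is impossible. *)
Lemma no_start t s y : f s t (p + y).+1 -> above f s t (p + y).
Proof.
have [d] := ubnP (c - t); elim: d t s y => // d IH t s y dt fs.
apply/negPn/negP => na; have st : starts f (p + y) t s by rewrite /starts fs.
have [sr tc] := in_rect fs.
have hp1 : (p + y).+1 < p = false by lia.
have hp2 : p + y < p = false by lia.
have := rg_colgood st; rewrite /hullA hp1 hp2.
apply; rewrite !add0n /count_boxes exchange_big /= [RHS]exchange_big /=.
have chain t' s' x d' : t < t' -> f s' t' (p + (x + d')) -> d' <= s' /\ f (s' - d') t' (p + x).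
  move=> tt'; elim: d' s' => [|d' IHd] s' fs'; first by rewrite subn0 addn0 in fs' *.
  have := IH t' s' (x + d'); rewrite -addnS -addnS => /(_ _ fs').
  have dd : c - t' < d by have [_ ?] := in_rect fs'; lia.
  move=> /(_ dd); case: s' fs' => [//|s'] fs' /= /IHd[h1 h2].
  by rewrite subSS.
apply: eq_bigr => t' tt'.
have f0 : f 0 t' (p + y).+1 = false.
  apply/negP => h; have := @chain t' 0 y 1 tt'; rewrite addn1 addnS => /(_ h)[]//.
have [r' er] : exists r', r = r'.+1 by exists r.-1; lia.
rewrite er in sr *.
rewrite big_nat_recl // f0 add0n big_nat_recr //=.
have -> : f r' t' (p + y) = false.
  apply/negP => h; move: sr; rewrite ltnS leq_eqVlt => /orP[/eqP e|sr].
    by rewrite e in fs; have := tab_rows tf fs h tt'; lia.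
  by have := tab_mono rectL_anti tf sr (ltnW tt') fs h; lia.
rewrite addn0; apply: eq_big_nat => s' /andP[_ s'r]; congr nat_of_bool.
apply/idP/idP => h.
  by have := @chain t' s'.+1 y 1 tt'; rewrite addn1 addnS subn1 => /(_ h)[].
have [x fx] : exists x, f s'.+1 t' x.
  by apply: rect_ex; [rewrite er ltnS|have [] := in_rect h].
have xl := tab_col tf h fx.
have [D ex] : exists D, x = p + (y.+1 + D) by exists (x - (p + y.+1)); lia.
rewrite ex in fx; have [h1 h2] := chain _ _ _ _ tt' fx.
rewrite addnS in h2; case: (ltngtP (s'.+1 - D) s'.+1) => e; [|lia|by rewrite e in h2].
case: (ltngtP (s'.+1 - D) s') => e'; last first.
- rewrite e' in h2; have := @chain t' s' y 1 tt'; rewrite addn1 addnS => /(_ h2)[s0 h3].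
  by have := tab_cols rectL_anti tf h3 h; lia.
- by lia.
- by have := tab_cols rectL_anti tf h2 h e'; lia.
Qed.

Lemma high_chain s t x d : f s t (p + (x + d)) -> d <= s /\ f (s - d) t (p + x).
Proof.
elim: d s => [|d IHd] s fs; first by rewrite subn0 addn0 in fs *.
rewrite !addnS in fs; have := no_start fs.
by case: s {fs} => [//|s] /= /IHd[h1 h2]; rewrite subSS.
Qed.

Definition high (s t : nat) : bool := `[< exists y, f s t (p + y) >].

Lemma highP s t : reflect (exists y, f s t (p + y)) (high s t).
Proof. exact: asboolP. Qed.

Lemma high_in s t : high s t -> s < r /\ t < c.
Proof. by move=> /highP[y /in_rect]. Qed.

Lemma high_down t s s' : high s t -> s < s' -> s' < r -> high s' t.
Proof.
move=> hs ss' s'r; have [_ tc] := high_in hs; have /highP[y fy] := hs.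
have [x fx] := rect_ex s'r tc; have := tab_cols rectL_anti tf fy fx ss' => h.
by apply/highP; exists (x - p); have -> : p + (x - p) = x by lia.
Qed.

Lemma high_right s t t' : high s t -> t < t' -> t' < c -> high s t'.
Proof.
move=> hs tt' t'c; have [sr _] := high_in hs; have /highP[y fy] := hs.
have [x fx] := rect_ex sr t'c; have := tab_rows tf fy fx tt' => h.
by apply/highP; exists (x - p); have -> : p + (x - p) = x by lia.
Qed.

(** Going up from a letter p+y one meets p+y-1, ..., p, and nothing beyond p is above p. *)
Lemma high_depth s t y : f s t (p + y) -> y = \sum_(0 <= s' < s) high s' t.
Proof.
move=> fy; have [ys f0] : y <= s /\ f (s - y) t (p + 0) by apply: high_chain.
rewrite (eq_big_nat _ _ (F2 := fun s' => (s - y <= s') : nat)); first by rewrite sum_geq; lia.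
move=> s' /andP[_ s's]; congr nat_of_bool; apply/highP/idP => [[x fx]|h].
  by rewrite leqNgt; apply/negP => h; have := tab_cols rectL_anti tf fx f0 h; lia.
exists (y - (s - s')); have -> : s' = s - (s - s') by lia.
have ey : y = y - (s - s') + (s - s') by lia.
rewrite {1}ey in fy; have [_] := high_chain fy.
by have -> : s - (s - (s - s')) = s - s' by lia.
Qed.

Lemma high_letters s t y :
  f s t (p + y) = high s t && (y == \sum_(0 <= s' < s) high s' t).
Proof.
apply/idP/andP => [fy|[/highP[x fx] /eqP->]]; last by rewrite -(high_depth fx).
by split; [apply/highP; exists y|apply/eqP; exact: high_depth].
Qed.

Lemma part_la y : part la y = if y < r then \sum_(0 <= t < c) high (r - y.+1) t else 0.
Proof.
rewrite -cla /count_boxes exchange_big /=.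
rewrite (eq_bigr (fun t => ((y < r) && high (r - y.+1) t) : nat)) => [|t _].
  by case: ifP => // _; rewrite big1.
rewrite -(@depth_count (fun s => high s t) r y) => [|s s'|s /high_in[]//]; last exact: high_down.
by apply: eq_bigr => s _; rewrite high_letters.
Qed.

(** The number of letters p+y is the length of a row of the region of letters beyond p,
    and must be a part of la; the region is right-justified, so this determines it. *)
Lemma high_rot s t : high s t = rotc s t.
Proof.
rewrite /rotc; case: (ltnP s r) => sr /=; last first.
  by apply/negP => /high_in[]; lia.
rewrite (suffix_count (k := high s) (r := c)) => [|t1 t2|t1 /high_in[]//]; last exact: high_right.
rewrite part_la; have -> : r - s.+1 < r by lia.
have -> : r - (r - s.+1).+1 = s by lia.
case: (ltnP t c) => //= tc; set m := \sum_(_ <= _ < _) _; move: m => m.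
by apply/idP/idP; lia.
Qed.

Lemma rect_fill_uniq s t a : f s t a = rect_fill s t a.
Proof.
rewrite /rect_fill; case: (ltnP a p) => ap.
  apply/idP/andP => [fa|[/eqP e]]; last by rewrite -e => h; rewrite low_letters.
  by have e := low_row fa ap; subst s; rewrite eqxx -low_letters.
have {1}-> : a = p + (a - p) by lia.
rewrite high_letters high_rot /rdepth; congr (_ && _).
rewrite (eq_bigr (fun s' => rotc s' t : nat)) => [|s' _]; last by rewrite high_rot.
set m := \sum_(_ <= _ < _) _; move: m => m; apply/eqP/eqP; lia.
Qed.

Lemma rect_rook_cells : rook_cells.
Proof.
have mup' s t : t < part mu s -> s < p.
  by move=> h; apply: leq_trans mup; rewrite ltnNge; apply/negP => /part_r e; rewrite e in h.
split.
- move=> s; case e: (part mu s) => [//|t]; have ts : t < part mu s by rewrite e.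
  by have := ts; rewrite -low_letters ?(mup' _ _ ts) // => /(tab_sub tf).
- move=> s; rewrite part_la /rectL; case: ifP => // _.
  rewrite -[X in _ <= X]subn0 -[X in _ <= X]muln1 -sum_nat_const_nat.
  by apply: leq_sum => t _; case: (high _ _).
- move=> s t sr tc; have [a fa] := rect_ex sr tc.
  move: fa; rewrite rect_fill_uniq /rect_fill; case: ifP => _ /andP[h1 h2]; first by rewrite h2.
  by rewrite h1 orbT.
- move=> s t s' t' h1 h2 h3 h4.
  have f1 := h1; rewrite -low_letters ?(mup' _ _ h1) // in f1.
  have f3 := h3; rewrite -low_letters ?(mup' _ _ h3) // in f3.
  rewrite -high_rot in h2; rewrite -high_rot in h4.
  have /highP[y f2] := h2; have /highP[y' f4] := h4.
  have := mup' _ _ h1; have := mup' _ _ h3 => sp s'p.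
  case=> e; subst; split=> //.
    by case: (ltngtP t t') => // tt; [have := tab_rows tf f2 f3 tt|have := tab_rows tf f4 f1 tt];
      lia.
  by case: (ltngtP s s') => // ss; [have := tab_cols rectL_anti tf f2 f3 ss|have := tab_cols
    rectL_anti tf f4 f1 ss]; lia.
Qed.
End Forward.

Section Backward.
Hypothesis rook : rook_cells.

Lemma mu_rect s t : t < part mu s -> [/\ s < r, t < c & s < p].
Proof.
move=> h; have [h1 _ _ _] := rook; have := leq_trans h (h1 s); rewrite /rectL;
  case: ifP => // sr tc.
split=> //; apply: leq_trans mup; rewrite ltnNge; apply/negP => /part_r e.
by rewrite e in h.
Qed.

Lemma rot_down t s s' : rotc s t -> s < s' -> s' < r -> rotc s' t.
Proof.
rewrite /rotc => /and3P[sr tc h] ss' s'r; rewrite s'r tc /=; apply: leq_trans h _.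
by apply: part_anti; lia.
Qed.

Lemma rot_right s t t' : rotc s t -> t < t' -> t' < c -> rotc s t'.
Proof. by rewrite /rotc => /and3P[-> tc h] tt' t'c; rewrite t'c /=; lia. Qed.

Lemma rdepthS s t : rotc s t -> s.+1 < r -> rdepth s.+1 t = (rdepth s t).+1.
Proof. by move=> rs sr; rewrite /rdepth big_nat_recr //= rs addn1. Qed.

Lemma rot_in s t : rotc s t -> s < r /\ t < c.
Proof. by case/and3P. Qed.

Lemma part_mu_down s t : t < part mu s.+1 -> t < part mu s.
Proof. by move=> h; apply: leq_trans h _; exact: part_anti. Qed.

Lemma overlap s t s' t' : t < part mu s -> rotc s t -> t' < part mu s' -> rotc s' t' ->
  s = s' \/ t = t' -> s = s' /\ t = t'.
Proof. by have [_ _ _] := rook; apply. Qed.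

Lemma rect_fill_tab : tab rectL rect_fill.
Proof.
have [muR _ cov _] := rook.
have inR s t a : rect_fill s t a -> s < r /\ t < c.
  by rewrite /rect_fill; case: ifP => _ /andP[]; [move=> _ /mu_rect[]|move=> /rot_in].
split.
- by move=> s t a /inR[sr tc]; rewrite /rectL sr.
- move=> s t; rewrite /rectL; case: ifP => // sr tc; have /orP[h|h] := cov _ _ sr tc.
    by exists s; rewrite /rect_fill; have [_ _ ->] := mu_rect h; rewrite eqxx.
  by exists (p + rdepth s t); rewrite /rect_fill ltnNge leq_addr h eqxx.
- move=> s t a b; rewrite {1}/rect_fill; case: (ltnP a p) => ap.
    case/andP=> /eqP-> ta; rewrite /rect_fill; case: (ltnP b p) => bp.
      by case/andP=> /eqP->.
    by move=> _; have [_ _ sp] := mu_rect ta; lia.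
  case/andP=> rt /eqP->; rewrite /rect_fill; case: (ltnP b p) => bp.
    case/andP=> _ h; have [sr tc _] := mu_rect h.
    have := @overlap s t s t.+1 (ltnW h) rt h (rot_right rt (leqnn _) tc) (or_introl erefl).
    by case=> _; lia.
  case/andP=> rt1 /eqP->; rewrite leq_add2l /rdepth; apply: leq_sum => s' _.
  case: (boolP (rotc s' t)) => // h; have [_ tc] := rot_in rt1.
  by rewrite (rot_right h (leqnn _) tc).
- move=> s t a b; rewrite {1}/rect_fill; case: (ltnP a p) => ap.
    case/andP=> /eqP-> ta; rewrite /rect_fill; case: (ltnP b p) => bp.
      by case/andP=> /eqP->.
    by move=> _; have [_ _ sp] := mu_rect ta; lia.
  case/andP=> rt /eqP->; rewrite /rect_fill; case: (ltnP b p) => bp.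
    case/andP=> _ h; have [sr tc _] := mu_rect h.
    have := @overlap s t s.+1 t (part_mu_down h) rt h (rot_down rt (leqnn _) sr) (or_intror erefl).
    by case; lia.
  by case/andP=> rt1 /eqP->; have [sr _] := rot_in rt1; rewrite rdepthS // addnS.
Qed.

Lemma cnt_low i : i < p -> count_boxes r c rect_fill predT i = part mu i.
Proof.
move=> ip; rewrite /count_boxes; have E s : \sum_(0 <= t < c) rect_fill s t i =
    (s == i) * part mu i.
  case: eqP => [->|ne]; last first.
    by rewrite big1 // => t _; rewrite /rect_fill ip; case: eqP => // e; rewrite e in ne.
  rewrite mul1n (eq_bigr (fun t => (t < part mu i) : nat)) => [|t _]; last first.
    by rewrite /rect_fill ip eqxx.
  rewrite sum_ltn //; have [h _ _ _] := rook; apply: leq_trans (h i) _; exact: rectL_le.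
rewrite (eq_bigr _ (fun s _ => E s)); case: (ltnP i r) => ir.
  rewrite (bigD1_seq i) ?mem_index_iota ?iota_uniq //= eqxx mul1n big1 ?addn0 // => s /negbTE->.
  by rewrite mul0n.
rewrite big_nat_cond big1 => [|s /andP[/andP[_ sr] _]].
  by have [h _ _ _] := rook; have := h i; rewrite /rectL ltnNge ir /=; lia.
by have -> : s == i = false by lia.
Qed.

Lemma cnt_high y : count_boxes r c rect_fill predT (p + y) = part la y.
Proof.
have [_ laR _ _] := rook.
rewrite /count_boxes exchange_big /=.
rewrite (eq_bigr (fun t => ((y < r) && rotc (r - y.+1) t) : nat)) => [|t _]; last first.
  rewrite -(@depth_count (fun s => rotc s t) r y) => [|s s'|s /rot_in[]//]; last exact: rot_down.
  apply: eq_bigr => s _; rewrite /rect_fill ltnNge leq_addr /= eqn_add2l; done.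
case: (ltnP y r) => yr; last first.
  by rewrite big1 //; have := laR y; rewrite /rectL ltnNge yr /=; lia.
have yc : part la y <= c by have := laR y; rewrite /rectL yr.
have -> : part la y = c - (c - part la y) by lia.
rewrite -[RHS]sum_geq; apply: eq_big_nat => t /andP[_ tc]; congr nat_of_bool.
rewrite /rotc tc /=; have -> : r - y.+1 < r by lia.
have -> : r - (r - y.+1).+1 = y by lia.
by apply/idP/idP => /=; lia.
Qed.

(** Only the letters p can lack their predecessor above: their number, the first part of la,
    is at most q, which is the number of letters p-1 read beforehand. *)
Lemma rect_fill_colgood : colgood r c hullA rect_fill.
Proof.
move=> i j s /andP[]; rewrite {1}/rect_fill; case: (ltnP i.+1 p) => ip.
  case/andP=> /eqP e js; subst s; rewrite /above /rect_fill (ltnW ip) eqxx /=.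
  by rewrite part_mu_down.
case/andP=> rj /eqP e na; have [sr jc] := rot_in rj.
move: ip; rewrite leq_eqVlt => /orP[/eqP ei|ip].
  have hp : i < p by lia.
  rewrite /hullA hp -ei ltnn add0n => H.
  have : count_boxes r c rect_fill (fun t => j < t) p < count_boxes r c rect_fill predT p.
    rewrite !cntE; apply: (ltn_cells sr jc) => [s' t' /andP[_ ->]//||].
      by rewrite ltnn.
    by rewrite /= /rect_fill ltnn rj /=; apply/eqP; lia.
  by have := cnt_high 0; rewrite addn0 => ->; lia.
exfalso; move/negP: na; apply.
have up : forall s', rotc s' j -> s' < s -> rotc s.-1 j.
  move=> s' rs s's; case: (ltngtP s' s.-1) => h; [|lia|by rewrite -h].
  by apply: (rot_down rs h); lia.
have dpos : 0 < rdepth s j by lia.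
have [s' [s's rs]] : exists s', s' < s /\ rotc s' j.
  apply: contrapT => h; move: dpos; rewrite /rdepth big_nat_cond big1 // =>
    s' /andP[/andP[_ s's] _].
  by apply/eqP; rewrite eqb0; apply/negP => rs; apply: h; exists s'.
have := up s' rs s's; case: s sr e rj {up dpos} s's => // s sr e rj s's /= rs'.
rewrite /rect_fill ltnNge; have -> : p <= i by lia.
by move: e; rewrite rdepthS // rs' => e /=; apply/eqP; lia.
Qed.
End Backward.
End Rect.

Local Open Scope ring_scope.

(** * Antisymmetrization *)

Section Alt.
Variable n : nat.
Implicit Types (p q : {mpoly int[n]}) (i j : 'I_n).

Definition alt p : {mpoly int[n]} := \sum_(s : 'S_n) (-1) ^+ s *: msym s p.

Fact alt_is_linear : linear alt.
Proof.
move=> a p q; rewrite /alt scaler_sumr -big_split /=; apply: eq_bigr => s _.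
by rewrite linearP scalerDr !scalerA [a * _]mulrC.
Qed.
HB.instance Definition _ :=
  GRing.isLinear.Build int {mpoly int[n]} {mpoly int[n]} _ alt alt_is_linear.

Lemma alt_symM q p : q \is symmetric -> alt (q * p) = q * alt p.
Proof.
move=> /issymP qs; rewrite /alt mulr_sumr; apply: eq_bigr => s _.
by rewrite msymM qs scalerAr.
Qed.

Lemma alt_tperm0 i j p : i != j -> msym (tperm i j) p = p -> alt p = 0.
Proof.
move=> ij ps; suff e : alt p = - alt p.
  have : alt p *+ 2 = 0 by rewrite mulr2n {2}e subrr.
  by move/eqP; rewrite -mulr_natr mulf_eq0 -mpolyC_nat mpolyC_eq0 orbF => /eqP.
rewrite {1}/alt (reindex_inj (mulgI (tperm i j))) /= -sumrN; apply: eq_bigr => s _.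
by rewrite odd_mul_tperm ij /= msymMm ps signrN scaleNr.
Qed.

(** Adjacent transpositions generate the symmetric group. *)
Lemma symmetric_adjacent p :
  (forall i j, j = i.+1 :> nat -> msym (tperm i j) p = p) -> p \is symmetric.
Proof.
move=> adj; have tp i j : msym (tperm i j) p = p.
  wlog ij : i j / (i < j)%N => [H|].
    case: (ltngtP i j) => h; [exact: H|by rewrite tpermC; exact: H|].
    by rewrite (val_inj h) tperm1 msym1m.
  have [d] := ubnP (j - i); elim: d i j ij => // d IH i j ij dle.
  have [e|ne] := eqVneq (nat_of_ord j) i.+1; first exact: adj.
  have kn : (j.-1 < n)%N by have := ltn_ord j; lia.
  pose k := Ordinal kn.
  have -> : tperm i j = (tperm i k ^ tperm k j)%g.
    rewrite tpermJ tpermL tpermD //; apply/eqP => /(congr1 val) /=; lia.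
  rewrite conjgE tpermV !msymMm (adj k j) /=; last by lia.
  by rewrite IH ?(adj k j) //=; lia.
apply/issymP => s; have [ts -> _] := prod_tpermP s.
elim: ts => [|t ts IH]; first by rewrite big_nil msym1m.
by rewrite big_cons msymMm tp.
Qed.

(** The factor by which the numerator of G_lambda differs from that of a Schur function. *)
Definition stair : {mpoly int[n]} := \prod_(j < n) (1 - 'X_j) ^+ j.

(** The factors of index i and i+1 acquire the same exponent i+1. *)
Lemma stair_sym i i' : i' = i.+1 :> nat ->
  msym (tperm i i') ((1 - 'X_i) * stair) = (1 - 'X_i) * stair.
Proof.
move=> e; pose d (j : 'I_n) : nat := if j == i then i.+1 else j.
have -> : (1 - 'X_i) * stair = \prod_(j < n) (1 - 'X_j) ^+ d j.
  rewrite /stair (bigD1 i) //= mulrA -exprS [RHS](bigD1 i) //= /d eqxx.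
  by congr (_ * _); apply: eq_bigr => j /negbTE->.
rewrite rmorph_prod /= [RHS](reindex_inj (@perm_inj _ (tperm i i'))) /=.
apply: eq_bigr => j _; rewrite rmorphXn rmorphB rmorph1 /= msymX; congr ((1 - 'X_[_]) ^+ _).
  apply/mnmP => k; rewrite !mnmE tpermV.
  by rewrite -(inj_eq (@perm_inj _ (tperm i i'))) tpermK.
rewrite /d; case: tpermP => [->|->|/eqP/negbTE -> _] //.
  by rewrite eqxx; case: eqP => [<-|].
by rewrite eqxx; case: eqP => // ->.
Qed.
End Alt.

(** * Cancellation of the tableaux that violate the lattice condition *)

Lemma eq_bk f g i j : (forall s t a, f s t a = g s t a) ->
  forall s t a, bk f i j s t a = bk g i j s t a.
Proof.
move=> e s t a; have eu s' t' : mobile f i s' t' = mobile g i s' t'.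
  by rewrite /mobile !e; case: s' => [|s'] //=; rewrite !e.
have ec : mobilecols f i j s = mobilecols g i j s by apply: eq_filter => x; rewrite eu.
by rewrite /bk ec eu !e.
Qed.

Lemma eq_toggle f g i j : (forall s t a, f s t a = g s t a) ->
  forall s t a, toggle f i j s t a = toggle g i j s t a.
Proof.
move=> e s t a; rewrite /toggle /zone !e; congr (_ (+) [&& _, _, _ & _]).
by apply: eq_all => x; rewrite e.
Qed.

Section Cancellation.
Variables (r c n : nat) (L : nat -> nat).
Hypothesis Lanti : forall s s', (s <= s')%N -> (L s' <= L s)%N.
Hypothesis Lr : forall s, (r <= s)%N -> L s = 0%N.
Hypothesis Lc : forall s, (L s <= c)%N.
Implicit Types F : filling r c n.
Notation cnt := (count_boxes r c).

Definition weight F : 'X_{1..n} := [multinom cnt (inbox F) predT a | a < n].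
Definition istab F : bool := `[< tab L (inbox F) >].

Lemma inbox_fill_tab f : tab L f -> (forall s t a, f s t a -> (a < n)%N) ->
  forall s t a, inbox (fill r c n f) s t a = f s t a.
Proof.
move=> tf fn s t a; rewrite inbox_fill; apply/and4P/idP => [[]//|fa].
by have [? ?] := box_in Lr Lc tf fa; split=> //; exact: fn fa.
Qed.

Lemma istab_fill f : tab L f -> (forall s t a, f s t a -> (a < n)%N) ->
  istab (fill r c n f).
Proof.
by move=> tf fn; apply/asboolP; apply: (tab_eq _ tf) => s t a; rewrite inbox_fill_tab.
Qed.

Lemma cnt_bk F i j a b (jc : (j <= c)%N) : istab F -> (forall s, ~~ inbox F s j i) ->
  ((a == i) && (b == i.+1)) || ((a == i.+1) && (b == i)) ->
  cnt (bk (inbox F) i j) (fun t => (t < j)%N) a = cnt (inbox F) (fun t => (t < j)%N) b.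
Proof.
move=> /asboolP tF nj ab; rewrite !cnt_lt //.
exact: (bk_sum tF j Lr ab).
Qed.

Lemma cnt_bk_gt F i j a (P : pred nat) : (forall t, P t -> (j <= t)%N) ->
  cnt (bk (inbox F) i j) P a = cnt (inbox F) P a.
Proof. by move=> h; apply: eq_cnt => // s t /h jt; rewrite bk_ge. Qed.

Lemma cnt_bk_other F i j a (P : pred nat) : a != i -> a != i.+1 ->
  cnt (bk (inbox F) i j) P a = cnt (inbox F) P a.
Proof. by move=> ai ai1; apply: eq_cnt => // s t _; rewrite bk_other. Qed.

Section BK.
Variables (i j : nat).
Hypotheses (i1n : (i.+1 < n)%N) (jc : (j <= c)%N).

Definition bkF F := fill r c n (bk (inbox F) i j).

Lemma bk_letters F s t a : bk (inbox F) i j s t a -> (a < n)%N.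
Proof.
move/bk_old => [/inbox_bound[] //|[_]]; case/orP => /eqP-> //.
exact: leq_trans i1n.
Qed.

Lemma inbox_bkF F : istab F -> (forall s, ~~ inbox F s j i) ->
  forall s t a, inbox (bkF F) s t a = bk (inbox F) i j s t a.
Proof.
move=> /asboolP tF nj; apply: inbox_fill_tab; first exact: bk_tab.
exact: bk_letters.
Qed.

Lemma istab_bkF F : istab F -> (forall s, ~~ inbox F s j i) -> istab (bkF F).
Proof.
move=> /asboolP tF nj; apply: istab_fill; first exact: bk_tab.
exact: bk_letters.
Qed.

Lemma bkFK F : istab F -> (forall s, ~~ inbox F s j i) -> bkF (bkF F) = F.
Proof.
move=> tF nj; apply: inbox_inj => s t a.
have nj' s' : ~~ inbox (bkF F) s' j i by rewrite inbox_bkF // bk_ge.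
rewrite inbox_bkF ?istab_bkF // (eq_bk _ _ (inbox_bkF tF nj)).
by move/asboolP: tF => tF; exact: (bkK tF).
Qed.
End BK.

Definition term F : {mpoly int[n]} := (-1) ^+ mdeg (weight F) *: 'X_[weight F].

(** The sign counts all letters; it differs from the usual one by (-1)^|L|. *)
Definition gpoly : {mpoly int[n]} := \sum_(F | istab F) term F.

Definition mswap (i i' : 'I_n) (m : 'X_{1..n}) : 'X_{1..n} :=
  [multinom m (tperm i i' a) | a < n].

Lemma mswapP (i i' : 'I_n) (m m' : 'X_{1..n}) : m' i = m i' -> m' i' = m i ->
  (forall a, a != i -> a != i' -> m' a = m a) -> m' = mswap i i' m.
Proof.
move=> h1 h2 h3; apply/mnmP => a; rewrite mnmE.
by case: tpermP => [->|->|/eqP ? /eqP ?] //; exact: h3.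
Qed.

Lemma msym_mswap (i i' : 'I_n) (m : 'X_{1..n}) :
  msym (tperm i i') 'X_[m] = 'X_[mswap i i' m] :> {mpoly int[n]}.
Proof. by rewrite msymX tpermV. Qed.

Lemma mdeg_mswap i i' m : mdeg (mswap i i' m) = mdeg m.
Proof. exact: mdeg_mperm. Qed.

Lemma gpoly_sym : gpoly \is symmetric.
Proof.
apply: symmetric_adjacent => i i' e.
have i1n : (i.+1 < n)%N by rewrite -e.
have nc F s : ~~ inbox F s c i.
  by apply/negP => /inbox_bound[_]; rewrite ltnn.
have full F a : cnt (inbox F) predT a = cnt (inbox F) (fun t => (t < c)%N) a.
  exact: eq_cnt.
have w F : istab F -> weight (bkF i c F) = mswap i i' (weight F).
  move=> tF; have hb := inbox_bkF i1n tF (nc F).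
  have E a : cnt (inbox (bkF i c F)) predT a = cnt (bk (inbox F) i c) (fun t => (t < c)%N) a.
    by apply: eq_cnt => // s t _; rewrite hb.
  have i'E : nat_of_ord i' = i.+1 by [].
  apply: mswapP => [||a ai ai']; rewrite !mnmE E.
  - by rewrite i'E (@cnt_bk _ _ _ _ i.+1) // ?eqxx // full.
  - by rewrite i'E (@cnt_bk _ _ _ _ i) // ?eqxx ?orbT // full.
  - by rewrite cnt_bk_other ?full // -?i'E.
rewrite /gpoly raddf_sum /= (reindex_onto (bkF i c) (bkF i c)) /=; last first.
  by move=> F tF; rewrite bkFK.
rewrite [RHS](eq_bigl (fun F => istab (bkF i c F) && (bkF i c (bkF i c F) == F))); last first.
  move=> F; apply/idP/andP => [tF|[tF /eqP <-]]; last exact: istab_bkF.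
  by rewrite istab_bkF // bkFK.
apply: eq_bigr => F /andP[tF /eqP FK].
have tF' : istab F by rewrite -FK; exact: istab_bkF.
rewrite /term w // linearZ /= msym_mswap mdeg_mswap; congr (_ *: 'X_[_]).
by apply/mnmP => a; rewrite !mnmE tpermK.
Qed.

Variable al : nat -> nat.

Definition mnm_of (A : nat -> nat) : 'X_{1..n} := [multinom A a | a < n].
Definition delta : 'X_{1..n} := mnm_of (fun a => n - a.+1)%N.

(** The numerator of the bialternant formula for the exponent m. *)
Definition bialt (m : 'X_{1..n}) : {mpoly int[n]} := alt ('X_[m + delta] * stair n).

(** With [starts], equality of the two numbers says that reading i+1 in column j makes it
    more frequent than i. *)
Definition viol F (i j : nat) : bool :=
  [exists s : 'I_r, starts (inbox F) i j s] &&
  (al i.+1 + cnt (inbox F) (fun t => (j < t)%N) i.+1 ==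
   al i + cnt (inbox F) (fun t => (j < t)%N) i)%N.

Definition good F : bool := [forall i : 'I_n, forall j : 'I_c, ~~ viol F i j].

(** The violation that is dealt with: the rightmost column, then the largest letter.  With
    the largest letter, toggling an i cannot create a violation that comes first. *)
Definition lastviol F (x : 'I_c * 'I_n) : bool :=
  viol F x.2 x.1 &&
  [forall y : 'I_c * 'I_n, viol F y.2 y.1 ==>
     ((y.1 < x.1) || (y.1 == x.1) && (y.2 <= x.2))%N].

Lemma lastviol_uniq F x y : lastviol F x -> lastviol F y -> x = y.
Proof.
move=> /andP[vx /forallP hx] /andP[vy /forallP hy].
have := hx y; have := hy x; rewrite vx vy /=.
move: x y {vx vy hx hy} => [x1 x2] [y1 y2] /= h1 h2.
by congr (_, _); apply: val_inj => /=; move: h1 h2; rewrite -!val_eqE /=; lia.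
Qed.

Lemma lastviol_ex F : ~~ good F -> exists x, lastviol F x.
Proof.
rewrite negb_forall => /existsP[i]; rewrite negb_forall => /existsP[j].
rewrite negbK => v0.
pose key (x : 'I_c * 'I_n) := (x.1 * n + x.2)%N.
have v0' : viol F (j, i).2 (j, i).1 by [].
case: (@arg_maxnP _ (j, i) (fun x : 'I_c * 'I_n => viol F x.2 x.1) key v0') => x vx mx.
exists x; rewrite /lastviol vx /=; apply/forallP => y; apply/implyP => /mx.
have := ltn_ord x.2; have := ltn_ord y.2; rewrite /key -val_eqE /=.
case: (ltngtP y.1 x.1) => //= h; last by rewrite h leq_add2l.
move: h; set a := nat_of_ord x.1; set b := nat_of_ord y.1 => h h1 h2.
have : (a.+1 * n <= b * n)%N by rewrite leq_mul2r h orbT.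
by rewrite mulSn; lia.
Qed.

End Cancellation.

Section Toggled.
Variables (r c n : nat) (L : nat -> nat).
Hypothesis Lanti : forall s s', (s <= s')%N -> (L s' <= L s)%N.
Hypothesis Lr : forall s, (r <= s)%N -> L s = 0%N.
Hypothesis Lc : forall s, (L s <= c)%N.
Variable al : nat -> nat.
Implicit Types F : filling r c n.
Notation cnt := (count_boxes r c).
Notation istab := (@istab r c n L).
Notation lastviol := (@lastviol r c n al).

Definition toggleF i j F := fill r c n (toggle (inbox F) i j).

Definition mixedF i j F : bool := [exists s : 'I_r, exists t : 'I_c,
  [&& inbox F s j i.+1, inbox F s t i & inbox F s t i.+1]].

Lemma mixedP F i j s0 : istab F -> starts (inbox F) i j s0 ->
  reflect (mixed i s0 (inbox F)) (mixedF i j F).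
Proof.
move=> /asboolP tF st; apply: (iffP existsP) => [[s /existsP[t /and3P[h1 h2 h3]]]|[t /andP[h1 h2]]].
  by exists t; rewrite -(col_uniq Lanti tF st h1) h2 h3.
have [sr _ _] := inbox_bound (starts_i1 st); have [_ tc _] := inbox_bound h1.
by exists (Ordinal sr); apply/existsP; exists (Ordinal tc); rewrite /= (starts_i1 st) h1 h2.
Qed.

Lemma inbox_toggleF F i j s0 : istab F -> starts (inbox F) i j s0 ->
  forall s t a, inbox (toggleF i j F) s t a = toggle (inbox F) i j s t a.
Proof.
move=> /asboolP tF st; apply: (inbox_fill_tab Lr Lc); first exact: (toggle_tab Lanti tF st).
move=> s t a; have [ai|ai] := eqVneq a i; last first.
  by rewrite toggle_other // => /inbox_bound[].
by have [_ _] := inbox_bound (starts_i1 st); rewrite ai; lia.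
Qed.

Lemma istab_toggleF F i j s0 : istab F -> starts (inbox F) i j s0 -> istab (toggleF i j F).
Proof.
move=> tF st; apply/asboolP; apply: tab_eq (fun s t a => esym (inbox_toggleF tF st s t a)) _.
by apply: toggle_tab; [exact: Lanti|exact/asboolP|exact: st].
Qed.

Lemma eq_starts f g i j s : (forall s t a, f s t a = g s t a) -> starts f i j s = starts g i j s.
Proof. by move=> e; rewrite /starts e; case: s => [|s] //=; rewrite e. Qed.

Lemma starts_toggleF F i j s0 : istab F -> starts (inbox F) i j s0 ->
  starts (inbox (toggleF i j F)) i j s0.
Proof.
move=> tF st; rewrite (eq_starts _ _ _ (inbox_toggleF tF st)).
exact: (starts_toggle Lanti (asboolW tF) st).
Qed.

Lemma toggleFK F i j s0 : istab F -> starts (inbox F) i j s0 ->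
  toggleF i j (toggleF i j F) = F.
Proof.
move=> tF st; apply: inbox_inj => s t a.
rewrite (inbox_toggleF (istab_toggleF tF st) (starts_toggleF tF st)).
by rewrite (eq_toggle _ _ (inbox_toggleF tF st)) (toggleK st).
Qed.

Lemma mixed_toggleF F i j s0 : istab F -> starts (inbox F) i j s0 ->
  mixedF i j (toggleF i j F) = ~~ mixedF i j F.
Proof.
move=> tF st; have tF' := istab_toggleF tF st; have st' := starts_toggleF tF st.
have tFp := asboolW tF; have [t0 [_ ft0 lt Z]] := zoneP Lanti tFp st.
have i1 : i.+1 != i by lia.
have e1 : mixedF i j F = inbox F s0 t0 i.
  by apply/(mixedP tF st)/idP => /(mixed_zone tFp st ft0 lt).
have e2 : mixedF i j (toggleF i j F) = inbox (toggleF i j F) s0 t0 i.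
  have tFp' := asboolW tF'.
  by apply/(mixedP tF' st')/idP => /(mixed_zone tFp' st' _ _);
    apply=> [|t tt]; rewrite (inbox_toggleF tF st) toggle_other //; exact: lt.
by rewrite e2 e1 (inbox_toggleF tF st) /toggle Z !eqxx addbT.
Qed.

Lemma weight_toggleF F (i : 'I_n) j s0 : istab F -> starts (inbox F) i j s0 ->
  ~~ mixedF i j F -> weight (toggleF i j F) = (weight F + U_(i))%MM.
Proof.
move=> tF st nm; have tFp := asboolW tF; have [t0 [_ ft0 lt Z]] := zoneP Lanti tFp st.
have nt : ~~ inbox F s0 t0 i.
  by apply: contra nm => h; apply/(mixedP tF st)/(mixed_zone tFp st ft0 lt).
apply/mnmP => a; rewrite mnmDE !mnmE.
rewrite (@eq_cnt r c (inbox (toggleF i j F)) (toggle (inbox F) i j) predT predT a) //; last first.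
  by move=> s t _; rewrite (inbox_toggleF tF st).
have [e|ai] := eqVneq i a; last first.
  rewrite addn0; apply: eq_cnt => // s t _; rewrite toggle_other //.
  by apply: contra ai => /eqP h; apply/eqP/val_inj.
rewrite -{}e.
have [sr tc _] := inbox_bound ft0.
rewrite -[nat_of_bool true]/1%N -(@cnt_one r c (zone (inbox F) i j) predT i s0 t0) //; last first.
  by move=> s t _; rewrite Z eqxx andbT.
rewrite /count_boxes -big_split /=; apply: eq_bigr => s _.
rewrite -big_split /=; apply: eq_bigr => t _.
rewrite /toggle Z; have [es|es] := eqVneq s s0; last by rewrite addbF addn0.
have [et|et] := eqVneq t t0; last by rewrite addbF addn0.
by rewrite es et eqxx (negbTE nt).
Qed.

Lemma viol_starts F i j : viol al F i j -> exists s0, starts (inbox F) i j s0.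
Proof. by case/andP=> /existsP[s st] _; exists s. Qed.

Lemma exists_starts F i j s0 : starts (inbox F) i j s0 ->
  [exists s : 'I_r, starts (inbox F) i j s].
Proof.
move=> st; have [sr _ _] := inbox_bound (starts_i1 st).
by apply/existsP; exists (Ordinal sr).
Qed.

(** Only the columns to the right of j, and in column j only the letters above i, decide
    whether (j, i) is the violation that is dealt with. *)
Lemma lastviol_stable F F' (j : 'I_c) (i : 'I_n) s0 :
  starts (inbox F) i j s0 -> starts (inbox F') i j s0 ->
  (forall s t a, (j < t)%N -> inbox F' s t a = inbox F s t a) ->
  (forall s a, a != i :> nat -> inbox F' s j a = inbox F s j a) ->
  lastviol F (j, i) -> lastviol F' (j, i).
Proof.
move=> st st' hgt hj /andP[/andP[_ /= v] /forallP h].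
have hcnt (j' : nat) a : (j <= j')%N ->
    cnt (inbox F') (fun t => (j' < t)%N) a = cnt (inbox F) (fun t => (j' < t)%N) a.
  by move=> jj'; apply: eq_cnt => // s t tj'; apply: hgt; lia.
apply/andP; split.
  by apply/andP; rewrite /= (exists_starts st') !hcnt.
apply/forallP => y; have := h y; case v': (viol al F y.2 y.1) => //=; first by move=> ->;
  rewrite implybT.
move=> _; apply/implyP => /andP[vs vc].
have [//|] := boolP ((y.1 < j)%N || (y.1 == j) && (y.2 <= i)%N).
rewrite negb_or -leqNgt negb_and -ltnNge => /andP[jy jy2]; exfalso.
suff : viol al F y.2 y.1 by rewrite v'.
rewrite /viol -!(hcnt y.1) // vc andbT; move: vs => /existsP[s vs]; apply/existsP; exists s.
move: jy; rewrite leq_eqVlt => /orP[/eqP|] jy; last first.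
  by move: vs; rewrite /starts hgt //; case: (nat_of_ord s) => [|s'] //=; rewrite hgt.
have iy : (i < y.2)%N by move: jy2; rewrite -val_eqE /= jy eqxx.
move: vs; rewrite /starts -jy hj; last by apply/eqP => e; move: iy; rewrite -e ltnNge leqnSn.
by case: (nat_of_ord s) => [|s'] //=; rewrite hj // neq_ltn iy orbT.
Qed.

Section Fixed.
Variables (j : 'I_c) (i i' : 'I_n).
Hypothesis ii' : i' = i.+1 :> nat.

Definition bad F := istab F && lastviol F (j, i).

Lemma bad_starts F : bad F -> exists s0, starts (inbox F) i j s0.
Proof. by case/and3P=> _ /viol_starts. Qed.

Lemma bad_toggle F : bad F -> bad (toggleF i j F).
Proof.
move=> bF; have [s0 st] := bad_starts bF; case/andP: bF => tF lF.
rewrite /bad (istab_toggleF tF st) /=; have tFp := asboolW tF.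
apply: (lastviol_stable st (starts_toggleF tF st) _ _ lF) => [s t a|s a];
  rewrite (inbox_toggleF tF st).
  exact: (toggle_gt Lanti tFp st).
by move=> ai; rewrite toggle_other.
Qed.

(** Bad tableaux without the letter that can be toggled. *)
Definition pure F := bad F && ~~ mixedF i j F.

Lemma pure_col F : pure F -> forall s, ~~ inbox F s j i.
Proof.
move=> /andP[bF nm]; have [s0 st] := bad_starts bF; case/andP: bF => tF lF.
apply: (unmixed_col Lanti (asboolW tF) st).
by move=> h; move/negP: nm; apply; apply/(mixedP tF st).
Qed.

Lemma i1n : (i.+1 < n)%N. Proof. by rewrite -ii'. Qed.

Lemma pure_bk F : pure F -> pure (bkF i j F).
Proof.
move=> pF; have nj := pure_col pF; case/andP: pF => bF nm.
have [s0 st] := bad_starts bF; case/andP: bF => tF lF.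
have e := inbox_bkF Lanti Lr Lc i1n tF nj.
have tF' := istab_bkF Lanti Lr Lc i1n tF nj.
have st' : starts (inbox (bkF i j F)) i j s0.
  by rewrite (eq_starts _ _ _ e); exact: starts_bk.
apply/andP; split.
  rewrite /bad tF' /=; apply: (lastviol_stable st st' _ _ lF) => [s t a jt|s a _].
    by rewrite e bk_ge // ltnW.
  by rewrite e bk_ge.
apply/negP => /(mixedP tF' st')[t]; rewrite !e => h.
have : mixed i s0 (bk (inbox F) i j) by exists t.
by apply: unmixed_bk => h'; move/negP: nm; apply; apply/(mixedP tF st).
Qed.

(** Columns from j on contain one i+1 more than i, counting al; delta decreases by one from
    i to i+1 and restores the balance, so only the columns before j matter. *)
Lemma weight_bk F : pure F ->
  (weight (bkF i j F) + mnm_of n al + delta n)%MM =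
  mswap i i' (weight F + mnm_of n al + delta n)%MM.
Proof.
move=> pF; have nj := pure_col pF; case/andP: pF => bF nm.
have [s0 st] := bad_starts bF; case/andP: bF => tF /andP[/andP[_ /eqP /= v] _].
have tFp := asboolW tF.
have e := inbox_bkF Lanti Lr Lc i1n tF nj.
have jc : (j <= c)%N := ltnW (ltn_ord j).
have E a : cnt (inbox (bkF i j F)) predT a = cnt (bk (inbox F) i j) predT a.
  by apply: eq_cnt => // s t _; rewrite e.
have C0 : cnt (inbox F) (fun t => t == j) i = 0%N.
  by apply: cnt0 => s t /eqP->.
have [sr _ _] := inbox_bound (starts_i1 st).
have C1 : cnt (inbox F) (fun t => t == j) i.+1 = 1%N.
  apply: (cnt_one sr (ltn_ord j)) => // s t /eqP->; rewrite eqxx andbT.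
  apply/idP/eqP => [|->]; first exact: (col_uniq Lanti tFp st).
  exact: starts_i1 st.
have bounds : (i.+1 < n)%N := i1n.
apply: mswapP => [||a ai ai']; rewrite !mnmDE !mnmE E.
- rewrite (cnt_parts r c (bk _ _ _) j) (cnt_parts r c (inbox F) j i') ii'.
  rewrite (cnt_bk Lr jc tF nj (b := i.+1)) ?eqxx //.
  rewrite !cnt_bk_gt ?C0 ?C1; [lia| |]; move=> t /=; lia.
- rewrite (cnt_parts r c (bk _ _ _) j) (cnt_parts r c (inbox F) j i) ii'.
  rewrite (cnt_bk Lr jc tF nj (b := i)) ?eqxx ?orbT //.
  rewrite !cnt_bk_gt ?C0 ?C1; [lia| |]; move=> t /=; lia.
- by rewrite cnt_bk_other // -?ii'.
Qed.

(** The contribution of F to the product, before antisymmetrization. *)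
Definition bterm F : {mpoly int[n]} :=
  (-1) ^+ mdeg (weight F) *: ('X_[weight F + mnm_of n al + delta n] * stair n).

(** Toggling contributes the factor 1 - x_i to the sum over the pure tableaux, and the
    Bender-Knuth involution makes this sum symmetric in x_i and x_{i+1}. *)
Lemma alt_bad : alt (\sum_(F | bad F) bterm F) = 0.
Proof.
have dp F : bad F -> toggleF i j (toggleF i j F) = F.
  by move=> bF; have [s0 st] := bad_starts bF; case/andP: bF => tF _; exact: (toggleFK tF st).
have mt F : bad F -> mixedF i j (toggleF i j F) = ~~ mixedF i j F.
  by move=> bF; have [s0 st] := bad_starts bF; case/andP: bF => tF _; exact: (mixed_toggleF tF st).
have H : \sum_(F | bad F && mixedF i j F) bterm F = \sum_(F | pure F) bterm (toggleF i j F).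
  rewrite (reindex_onto (toggleF i j) (toggleF i j)) /=; last by move=> F /andP[/dp].
  apply: eq_bigl => F; apply/idP/idP => [/andP[/andP[bF mF] /eqP eF]|/andP[bF nm]].
    have bF' : bad F by rewrite -eF; exact: bad_toggle.
    by rewrite /pure bF' /= -mt.
  by rewrite bad_toggle // mt // nm dp ?eqxx.
rewrite (bigID (mixedF i j)) /= H addrC -big_split /=.
rewrite (eq_bigr (fun F => (-1) ^+ mdeg (weight F) *: 'X_[weight F + mnm_of n al + delta n]
    * ((1 - 'X_i) * stair n))); last first.
  move=> F /andP[bF nm]; have [s0 st] := bad_starts bF; case/andP: bF => tF _.
  rewrite /bterm (weight_toggleF tF st nm) mdegD mdeg1 addn1 exprS mulN1r scaleNr.
  rewrite -!addmA [(U_(i) + _)%MM]addmC !addmA mpolyXD -!scalerAl -scalerBr; congr (_ *: _).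
  by rewrite !mpolyXD mulrBl mul1r mulrBr !mulrA.
rewrite -mulr_suml; apply: (@alt_tperm0 _ i i').
  by apply/eqP => /(congr1 val) /=; rewrite ii'; lia.
rewrite rmorphM /= stair_sym //; congr (_ * _).
rewrite raddf_sum /= (reindex_onto (bkF i j) (bkF i j)) /=; last first.
  by move=> F pF; have := pure_col pF; case/andP: pF => /andP[tF _] _ nj;
    exact: (bkFK Lanti Lr Lc i1n tF nj).
rewrite [RHS](eq_bigl (fun F => pure (bkF i j F) && (bkF i j (bkF i j F) == F))); last first.
  move=> F; apply/idP/andP => [pF|[pF /eqP <-]]; last exact: pure_bk.
  rewrite pure_bk //; have := pure_col pF; case/andP: pF => /andP[tF _] _ nj.
  by rewrite (bkFK Lanti Lr Lc i1n).
apply: eq_bigr => F /andP[pF /eqP eF].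
have pF' : pure F by rewrite -eF; exact: pure_bk.
have w := weight_bk pF'.
rewrite linearZ /= msym_mswap w.
have -> : mswap i i' (mswap i i' (weight F + mnm_of n al + delta n)%MM) =
   (weight F + mnm_of n al + delta n)%MM by apply/mnmP => a; rewrite !mnmE tpermK.
congr (_ ^+ _ *: _); have := congr1 (@mdeg n) w; rewrite mdeg_mswap !mdegD; lia.
Qed.
End Fixed.

Theorem gpoly_bialt : gpoly r c n L * bialt (mnm_of n al) =
  \sum_(F | istab F && good al F)
     (-1) ^+ mdeg (weight F) *: bialt (weight F + mnm_of n al)%MM.
Proof.
have btermE F : alt (bterm F) = (-1) ^+ mdeg (weight F) *: bialt (weight F + mnm_of n al)%MM.
  by rewrite linearZ.
rewrite /bialt -alt_symM; last exact: gpoly_sym.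
have -> : gpoly r c n L * ('X_[mnm_of n al + delta n] * stair n) = \sum_(F | istab F) bterm F.
  rewrite /gpoly mulr_suml; apply: eq_bigr => F _.
  by rewrite /term /bterm -scalerAl mulrA -mpolyXD addmA.
rewrite (bigID (@good r c n al)) /= raddfD /= [X in _ + X](_ : _ = 0) ?addr0; last first.
  have -> : \sum_(F | istab F && ~~ good al F) bterm F =
      \sum_(x : 'I_c * 'I_n) \sum_(F | istab F && lastviol F x) bterm F.
    rewrite (exchange_big_dep (fun F => istab F)) /=; last by move=> x F _ /andP[].
    rewrite big_mkcondr /=; apply: eq_bigr => F tF; case: ifPn => [ng|gF].
      have [x lx] := lastviol_ex ng.
      rewrite (big_pred1 x) // => y; rewrite tF /=; apply/idP/eqP => [ly|-> //].
      exact: lastviol_uniq ly lx.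
    rewrite big_pred0 // => x; apply/negbTE/negP => /andP[_ /andP[v _]].
    move: gF; rewrite negbK => /forallP/(_ x.2)/forallP/(_ x.1); by rewrite v.
  rewrite raddf_sum /= big1 // => -[j i] _.
  case: (ltnP i.+1 n) => hi; first exact: (@alt_bad j i (Ordinal hi)).
  rewrite big_pred0 ?raddf0 // => F; apply/negbTE/negP => /andP[_ /andP[/viol_starts[s0 st] _]].
  by have [_ _] := inbox_bound (starts_i1 st); rewrite /= ltnNge hi.
rewrite raddf_sum /=; apply: eq_bigr => F _; exact: btermE.
Qed.

End Toggled.

(** * Bialternants and Grothendieck polynomials *)

Lemma perm_increasing n (s : 'S_n) :
  (forall i j : 'I_n, (i < j)%N -> (s i < s j)%N) -> s = 1%g.
Proof.
move=> inc; apply/permP => i; rewrite perm1.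
have [k] := ubnP i; elim: k i => // k IH i ik.
apply: val_inj; apply/eqP; rewrite eqn_leq; apply/andP; split; last first.
  rewrite leqNgt; apply/negP => si.
  by have /perm_inj e := IH (s i) (leq_trans si (ltnSE ik)); rewrite e ltnn in si.
rewrite leqNgt; apply/negP => si.
pose k0 := (s^-1)%g i; have sk : s k0 = i by rewrite permKV.
case: (ltngtP k0 i) => h.
- by have e := IH k0 (leq_trans h (ltnSE ik)); rewrite sk in e; rewrite -e ltnn in h.
- by have := inc _ _ h; rewrite sk ltnNge (ltnW si).
- by have e := val_inj h; rewrite e in sk; rewrite sk ltnn in si.
Qed.

Section Bialt.
Variable n : nat.
Implicit Types (A B : nat -> nat).

Lemma stair_coeff0 : (stair n)@_0 = 1.
Proof.
rewrite /stair (rmorph_prod (mcoeff 0)) big1 //= => j _.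
by rewrite rmorphXn rmorphB rmorph1 /= mcoeffX mnm1_eq0 subr0 expr1n.
Qed.

Lemma mcoeffXM_low (p : {mpoly int[n]}) (m k : 'X_{1..n}) : (mdeg k <= mdeg m)%N ->
  ('X_[m] * p)@_k = (k == m)%:R * p@_0.
Proof.
move=> km; rewrite mcoeffM; case: eqP => [->|ne]; last first.
  rewrite mul0r big1 // => -[/= x y] /eqP e; rewrite mcoeffX.
  case: eqP => [xm|]; last by rewrite mul0r.
  exfalso; have e' : k = (bmnm x + bmnm y)%MM by [].
  have := congr1 (@mdeg n) e'; rewrite mdegD -xm => d.
  have : mdeg (bmnm y) == 0%N by apply/eqP; lia.
  by rewrite mdeg_eq0 => /eqP y0; apply: ne; rewrite e' y0 addm0 -xm.
by rewrite mul1r -mcoeffM mulrC; have := mcoeffMX p m 0%MM; rewrite addm0.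
Qed.

(** At the lowest degree the factor [stair] counts as 1; and two strictly decreasing
    exponents agree up to a permutation only if they are equal. *)
Lemma bialt_coeff A B : (forall a, A a.+1 <= A a)%N -> (forall a, B a.+1 <= B a)%N ->
  (mdeg (mnm_of n B) <= mdeg (mnm_of n A))%N ->
  (bialt (mnm_of n A))@_(mnm_of n B + delta n) = (mnm_of n B == mnm_of n A)%:R.
Proof.
move=> hA hB dBA; rewrite /bialt /alt raddf_sum /=.
have anti (C : nat -> nat) : (forall a, C a.+1 <= C a)%N -> forall i j, (i <= j)%N ->
  (C j <= C i)%N.
  by move=> hC i j; elim: j => [|j IH]; [case: i|rewrite leq_eqVlt => /orP[/eqP->//|/IH];
    exact: leq_trans].
have E (s : 'S_n) :
    ((-1) ^+ s *: msym s ('X_[mnm_of n A + delta n] * stair n))@_(mnm_of n B + delta n)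
    = if s == 1%g then (mnm_of n B == mnm_of n A)%:R else 0.
  rewrite mcoeffZ mcoeff_sym mcoeffXM_low; last by rewrite mdeg_mperm !mdegD leq_add2r.
  rewrite stair_coeff0 mulr1; have [->|s1] := eqVneq s 1%g.
    rewrite odd_perm1 mul1r; congr ((_ : bool)%:R); rewrite -[in RHS](eqm_add2r (delta n)).
    by congr (_ == _); apply/mnmP => i; rewrite [LHS]mnmE perm1.
  case: eqP => [e|]; rewrite ?mulr0 //; exfalso; move/eqP: s1; apply;
    apply: perm_increasing => i j ij.
  have ei := congr1 (fun m : 'X_{1..n} => m i) e; have ej := congr1 (fun m : 'X_{1..n} => m j) e.
  rewrite /= !mnmE in ei ej.
  rewrite ltnNge; apply/negP => sji.
  have := anti _ hB _ _ sji; have := anti _ hA _ _ (ltnW ij).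
  have := ltn_ord (s i); have := ltn_ord i; have := ltn_ord j.
  move: ei ej sji ij.
  set x1 := nat_of_ord i; set x2 := nat_of_ord j; set x3 := nat_of_ord (s i);
    set x4 := nat_of_ord (s j).
  lia.
by rewrite (eq_bigr _ (fun s _ => E s)) -big_mkcond /= big_pred1_eq.
Qed.

Lemma bialt0_neq0 : bialt (mnm_of n (fun=> 0%N)) != 0.
Proof.
apply/eqP => h; have := @bialt_coeff (fun=> 0%N) (fun=> 0%N) (fun=> isT) (fun=> isT) (leqnn _).
by rewrite h mcoeff0 eqxx.
Qed.
End Bialt.

Section Shape.
Variable (n : nat).

Lemma mdeg_part (p : intpart) : (size p <= n)%N -> mdeg (mnm_of n (part p)) = sumn p.
Proof.
move=> pn; rewrite mdegE (eq_bigr (fun i : 'I_n => part p i)) => [|i _]; last by rewrite mnmE.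
rewrite -(big_mkord xpredT (part p)) (big_cat_nat (leq0n _) pn) /= [X in (_ + X)%N]big_nat_cond.
rewrite [X in (_ + X)%N]big1 => [|i /andP[/andP[pi _] _]]; last exact: part_r.
by rewrite addn0 sumnE [RHS](big_nth 0%N).
Qed.

Definition pfilling (p : intpart) := filling (size p) (part p 0) n.
Definition ptab (p : intpart) (F : pfilling p) : bool := istab (part p) F.

Definition Gpoly (p : intpart) : {mpoly int[n]} :=
  (-1) ^+ sumn p *: gpoly (size p) (part p 0) n (part p).

Definition pgood (si : intpart) (p : intpart) (F : pfilling p) : bool := good (part si) F.

Lemma goodP (al : nat -> nat) (p : intpart) (F : pfilling p) :
  reflect (colgood (size p) (part p 0) al (inbox F)) (good al F).
Proof.
apply: (iffP idP) => [/forallP h i j s st e|h].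
  have [sr tc an] := inbox_bound (starts_i1 st).
  have /forallP/(_ (Ordinal tc)) := h (Ordinal (ltnW an)); rewrite /viol /= e eqxx andbT.
  by move/negP; apply; apply/existsP; exists (Ordinal sr).
apply/forallP => i; apply/forallP => j; apply/negP => /andP[/existsP[s st] /eqP e].
exact: h st e.
Qed.

Definition content_of (si p : intpart) (F : pfilling p) : 'X_{1..n} :=
  (weight F + mnm_of n (part si))%MM.

Lemma Gpoly_bialt (si p : intpart) : Gpoly p * bialt (mnm_of n (part si)) =
  \sum_(F : pfilling p | ptab F && pgood si F)
    (-1) ^+ (mdeg (weight F) + sumn p) *: bialt (content_of si F).
Proof.
rewrite /Gpoly -scalerAl (@gpoly_bialt _ _ n _ (part_anti p) (@part_r p) (part_c p)) scaler_sumr.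
by apply: eq_bigr => F _; rewrite scalerA -exprD addnC.
Qed.

Definition superstd (p : intpart) : pfilling p :=
  fill _ _ _ (fun s t a => (t < part p s)%N && (a == s)).

Lemma superstd_tab (p : intpart) : tab (part p) (fun s t a => (t < part p s)%N && (a == s)).
Proof.
split=> [s t a /andP[]//|s t h|s t a b /andP[_ /eqP->] /andP[_ /eqP->] //|s t a b /andP[_ /eqP->]
  /andP[_ /eqP->] //].
by exists s; rewrite h eqxx.
Qed.

(** With nothing read beforehand, a lattice tableau has only the letter s in row s. *)
Lemma Gpoly_bialt0 (p : intpart) : (size p <= n)%N ->
  Gpoly p * bialt (mnm_of n (fun=> 0%N)) = bialt (mnm_of n (part p)).
Proof.
move=> pn; have nil_p : is_part [::] by [].
have -> : mnm_of n (fun=> 0%N) = mnm_of n (part (IntPart nil_p)).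
  by apply/mnmP => i; rewrite !mnmE /part /= nth_nil.
have let_n s t a : (t < part p s)%N && (a == s) -> (a < n)%N.
  case/andP=> ts /eqP->; apply: leq_trans pn; rewrite ltnNge; apply/negP => /part_r e.
  by rewrite e in ts.
have hb := inbox_fill_tab (@part_r p) (part_c p) (superstd_tab p) let_n.
rewrite Gpoly_bialt (big_pred1 (superstd p)) => [|F].
  have w : weight (superstd p) = mnm_of n (part p).
    apply/mnmP => a; rewrite !mnmE.
    rewrite (@eq_cnt _ _ _ (fun s t a => (t < part p s)%N && (a == s)) predT predT a) //.
    case: (ltnP a (size p)) => ap; last first.
      rewrite (part_r ap) cnt0 // => s t _; apply/negP => /andP[h /eqP e].
      by move: h; rewrite -e part_r.
    rewrite /count_boxes (bigD1_seq (nat_of_ord a)) ?mem_index_iota ?iota_uniq //=.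
    rewrite [X in (_ + X)%N]big1 ?addn0 => [|s /negbTE sa]; last first.
      by rewrite big1 // => t _; rewrite eq_sym sa andbF.
    rewrite (eq_bigr (fun t => (t < part p a)%N : nat)) => [|t _]; last by rewrite eqxx andbT.
    by rewrite sum_ltn // part_c.
  have c0 : content_of (IntPart nil_p) (superstd p) = mnm_of n (part p).
    by rewrite /content_of w; apply/mnmP => i; rewrite mnmDE !mnmE /part /= nth_nil addn0.
  by rewrite c0 w mdeg_part // addnn -signr_odd odd_double scale1r.
apply/andP/eqP => [[/asboolP tF /goodP cg]|->]; last first.
  split; first by apply: istab_fill let_n; [exact: part_r|exact: part_c|exact: superstd_tab].
  apply/goodP => i j s /andP[]; rewrite hb => /andP[js /eqP es].
  have ab : above (inbox (superstd p)) s j i.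
    by rewrite -es /= hb eqxx andbT; apply: leq_trans js (part_anti _ _); rewrite -es.
  by rewrite ab.
have al0 : forall i, part (IntPart nil_p) i = 0%N by move=> i; rewrite /part /= nth_nil.
have rg := colgood_rowgood (part_anti p) (@part_r p) (part_c p) tF
  (fun i => part_anti (IntPart nil_p) (leqnSn i)) cg.
have rr := rowgood_row (part_anti p) tF (p := n) (fun i _ => etrans (al0 _) (esym (al0 _))) rg.
apply: inbox_inj => s t a; rewrite hb; apply/idP/andP => [fa|[ts /eqP->]].
  have [_ _ an] := inbox_bound fa.
  by split; [exact: (tab_sub tF fa)|apply/eqP; exact: rr fa an].
have [b fb] := tab_ex tF ts; have [_ _ bn] := inbox_bound fb.
by rewrite -{2}(rr _ _ _ fb bn).
Qed.

End Shape.

Definition nil_part : intpart := @IntPart [::] isT.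

Definition part_of (s : seq nat) : intpart := insubd nil_part (take (find (pred1 0%N) s) s).

Lemma part_ofP (s : seq nat) : sorted geq s ->
  (size (part_of s) <= size s)%N /\ forall a, part (part_of s) a = nth 0%N s a.
Proof.
move=> ss; pose k := find (pred1 0%N) s.
have tr : transitive geq by move=> y x z /= yx zy; exact: leq_trans zy yx.
have ip : is_part (take k s).
  rewrite /is_part take_sorted //=; apply/negP => /(nthP 0%N)[a].
  rewrite size_take_min leq_min => /andP[ak _]; rewrite nth_take // => e.
  by have := before_find 0%N ak; rewrite /= e.
have e : part_of s = take k s :> seq nat by rewrite /part_of val_insubd ip.
split=> [|a]; first by rewrite e size_take_min geq_minr.
rewrite /part e; case: (ltnP a k) => ak; first by rewrite nth_take.
rewrite nth_default; last by rewrite size_take_min (leq_trans (geq_minl _ _)).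
case: (ltnP a (size s)) => sa; last by rewrite nth_default.
have ks : (k < size s)%N by exact: leq_ltn_trans ak sa.
have /eqP k0 : nth 0%N s k == 0%N by apply: (@nth_find _ 0%N (pred1 0%N)); rewrite has_find.
have := sorted_leq_nth tr leqnn 0%N ss k a ks sa ak.
by rewrite /= k0 leqn0 => /eqP->.
Qed.

Section Product.
Variable n : nat.

Lemma part_of_mnm (m : 'X_{1..n}) :
  (forall i j : 'I_n, j = i.+1 :> nat -> (m j <= m i)%N) ->
  (size (part_of m) <= n)%N /\ mnm_of n (part (part_of m)) = m.
Proof.
move=> dm; have ss : sorted geq m.
  case: m dm => -[s sz] dm /=; apply/(sortedP 0%N) => i; rewrite (eqP sz) => i1.
  have := dm (Ordinal (ltnW i1)) (Ordinal i1) erefl.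
  by rewrite !(mnm_nth 0%N).
have [h1 h2] := part_ofP ss; rewrite size_tuple in h1; split=> //.
by apply/mnmP => i; rewrite mnmE h2 (mnm_nth 0%N).
Qed.

Lemma mnm_of_part_inj (p q : intpart) : (size p <= n)%N -> (size q <= n)%N ->
  mnm_of n (part p) = mnm_of n (part q) -> p = q.
Proof.
move=> pn qn e; apply: part_inj => a; case: (ltnP a n) => an.
  by have := congr1 (fun m : 'X_{1..n} => m (Ordinal an)) e; rewrite !mnmE.
by rewrite !part_r //; [exact: leq_trans qn an|exact: leq_trans pn an].
Qed.

Lemma content_anti (si p : intpart) (F : pfilling n p) : ptab F -> pgood si F ->
  forall i j : 'I_n, j = i.+1 :> nat -> (content_of si F j <= content_of si F i)%N.
Proof.
move=> /asboolP tF /goodP cg i j e; rewrite !mnmDE !mnmE e ![(count_boxes _ _ _ _ _ + _)%N]addnC.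
exact: (@colgood_ge _ _ (part si) _ _ (part_anti p) (@part_r p) (part_c p) tF
  (fun i => part_anti si (leqnSn i)) i 0 cg).
Qed.

Definition nu_of (si p : intpart) (F : pfilling n p) : intpart := part_of (content_of si F).

Lemma nu_ofP (si p : intpart) (F : pfilling n p) : ptab F -> pgood si F ->
  (size (nu_of si F) <= n)%N /\ mnm_of n (part (nu_of si F)) = content_of si F.
Proof. by move=> tF gF; apply: part_of_mnm; exact: content_anti. Qed.

Theorem Gpoly_prod (si p : intpart) : (size si <= n)%N ->
  Gpoly n si * Gpoly n p = \sum_(F : pfilling n p | ptab F && pgood si F)
    (-1) ^+ (mdeg (weight F) + sumn p) *: Gpoly n (nu_of si F).
Proof.
move=> sn; apply: (mulIf (bialt0_neq0 n)); rewrite mulrAC Gpoly_bialt0 // mulrC Gpoly_bialt.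
rewrite mulr_suml; apply: eq_bigr => F /andP[tF gF]; have [sz e] := nu_ofP tF gF.
by rewrite -scalerAl Gpoly_bialt0 // e.
Qed.

(** Induction on |nu|: after multiplication by the numerator of exponent 0, the
    coefficient of x^(nu+delta) only involves nu and smaller partitions. *)
Theorem Gpoly_free (S : {fset intpart}) (a : intpart -> int) :
  (forall nu, nu \in S -> (size nu <= n)%N) ->
  \sum_(nu <- S) a nu *: Gpoly n nu = 0 -> forall nu, nu \in S -> a nu = 0.
Proof.
move=> Sn e0; have e : \sum_(nu <- S) a nu *: bialt (mnm_of n (part nu)) = 0.
  rewrite -[RHS](mul0r (bialt (mnm_of n (fun=> 0%N)))) -[X in _ = X * _]e0 mulr_suml.
  by apply: eq_big_seq => nu /Sn h; rewrite -scalerAl Gpoly_bialt0.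
move=> nu; have [k] := ubnP (sumn nu); elim: k nu => // k IH nu nk nuS.
have := congr1 (mcoeff (mnm_of n (part nu) + delta n)) e; rewrite mcoeff0 raddf_sum /=.
rewrite (big_fsetD1 nu) //= mcoeffZ bialt_coeff ?eqxx ?mulr1; last 3 first.
- by move=> i; exact: part_anti.
- by move=> i; exact: part_anti.
- by [].
rewrite big_seq big1 ?addr0 // => ka; rewrite in_fsetD1 => /andP[ne kS].
rewrite mcoeffZ; case: (ltnP (sumn ka) (sumn nu)) => h.
  by rewrite IH ?mul0r //; exact: leq_trans h (ltnSE nk).
rewrite bialt_coeff ?mdeg_part ?Sn //; try by move=> i; exact: part_anti.
case: eqP => [e'|]; last by rewrite mulr0.
by rewrite (mnm_of_part_inj (Sn _ nuS) (Sn _ kS) e') eqxx in ne.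
Qed.

End Product.

Local Open Scope classical_set_scope.

(** * Power series in infinitely many variables *)

Lemma fsbig_fin (I : finType) (P : pred I) (R : Type) (idx : R) (op : Monoid.com_law idx)
    (F : I -> R) :
  \big[op/idx]_(x \in [set x | P x]) F x = \big[op/idx]_(x | P x) F x.
Proof.
rewrite (fsbigE (enum P)) ?enum_uniq //; last first.
- by move=> i /= Pi; rewrite mem_enum /in_mem /= Pi.
- by move=> i /=; rewrite mem_enum.
rewrite big_enum_cond /=; apply: eq_bigl => i.
by apply/andP/idP => [[]//|Pi]; split=> //; rewrite inE.
Qed.

Notation cmon := (monalg.cmonom nat).

Lemma cmon_ext (m1 m2 : cmon) : (forall k, m1 k = m2 k) -> m1 = m2.
Proof. by move=> h; apply/eqP/monalg.cmP. Qed.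

Lemma cmon_bigE (I : Type) (r : seq I) (F : I -> cmon) k :
  (\big[monalg.mmul/monalg.mone]_(i <- r) F i) k = (\sum_(i <- r) F i k)%N.
Proof.
by apply: (big_morph (fun m : cmon => m k)) => [x y|]; [exact: monalg.cmM|exact: monalg.cm1].
Qed.

Lemma svt_monE T k : svt_mon T k = (\sum_(r <- svt_rows T) \sum_(A <- r) (k \in A))%N.
Proof.
rewrite /svt_mon big_flatten cmon_bigE; apply: eq_bigr => r _; rewrite cmon_bigE.
apply: eq_bigr => A _; rewrite cmon_bigE -count_uniq_mem ?fset_uniq // -sum1_count
  [RHS]big_mkcond /=.
by apply: eq_bigr => i _; rewrite monalg.cmU; case: (i == k).
Qed.

Lemma svt_monS T a :
  svt_mon T a.+1 = count_boxes (size (svt_shape T)) (part (svt_shape T) 0) (svf T) predT a.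
Proof.
rewrite svt_monE -count_svt_word.
by rewrite -(count_rows_word a.+1 T).
Qed.

Lemma svt_mon0 T : svt_mon T 0%N = 0%N.
Proof.
rewrite svt_monE (big_nth [::]) big1_seq // => s _; rewrite (big_nth fset0) big1_seq // => t _.
by have := zero_notin_box T s t; rewrite /box => /negbTE->.
Qed.

Section Truncate.
Variable n : nat.

Definition supp_in (m : cmon) : Prop := m 0%N = 0%N /\ forall k, (n < k)%N -> m k = 0%N.

(** The variable of index 0 never occurs, so n variables are those of index 1 to n. *)
Definition restr (m : cmon) : 'X_{1..n} := [multinom m a.+1 | a < n].

Definition extm (k : 'X_{1..n}) : cmon :=
  monalg.cmonom_of_fsfun monalg.cmonom_key
    [fsfun i in [fset a.+1 | a in iota 0 n]%fset => (if i is a.+1 then nth 0 k a else 0)%N | 0%N].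

Lemma extmE k i : extm k i = (if i is a.+1 then nth 0%N k a else 0%N).
Proof.
rewrite monalg.cmE fsfun_fun; case: ifP => // h; case: i h => // a h.
rewrite nth_default // size_tuple leqNgt; apply/negP => an; move/negP: h; apply.
by apply/imfsetP; exists a; rewrite //= mem_iota add0n.
Qed.

Lemma supp_extm k : supp_in (extm k).
Proof.
split=> [|[|i]]; rewrite extmE // ltnS => ni.
by rewrite nth_default // size_tuple.
Qed.

Lemma restrK m : supp_in m -> extm (restr m) = m.
Proof.
move=> [m0 mn]; apply: cmon_ext => -[|a]; rewrite extmE //.
case: (ltnP a n) => an; last by rewrite mn // nth_default // size_tuple.
by rewrite -(mnm_nth 0%N (restr m) (Ordinal an)) mnmE.
Qed.

Lemma extmK k : restr (extm k) = k.
Proof. by apply/mnmP => a; rewrite mnmE extmE -mnm_nth. Qed.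

Lemma supp_mul m1 m2 : supp_in (monalg.mmul m1 m2) -> supp_in m1 /\ supp_in m2.
Proof.
move=> [z h]; have s k : monalg.mmul m1 m2 k = 0%N -> m1 k = 0%N /\ m2 k = 0%N.
  by rewrite monalg.cmM => /eqP; rewrite addn_eq0 => /andP[/eqP-> /eqP->].
have [z1 z2] := s _ z.
by split; split=> // k /h/s[].
Qed.

Lemma restr_mul m1 m2 : restr (monalg.mmul m1 m2) = (restr m1 + restr m2)%MM.
Proof. by apply/mnmP => a; rewrite mnmDE !mnmE monalg.cmM. Qed.

Lemma extm_mul k1 k2 : monalg.mmul (extm k1) (extm k2) = extm (k1 + k2)%MM.
Proof.
rewrite -[LHS]restrK ?restr_mul ?extmK //; split; first by rewrite monalg.cmM !extmE.
by move=> [|k] // nk; rewrite monalg.cmM !extmE !nth_default // size_tuple.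
Qed.

Lemma mdeg_restr m : supp_in m -> mdeg (restr m) = monalg.mdeg m.
Proof.
move=> [m0 mn]; rewrite mdegE (@monalg.mdegEw _ _ [fset a.+1 | a in iota 0 n]%fset); last first.
  apply/fsubsetP => k; rewrite -monalg.cmE_neq0 => mk; apply/imfsetP.
  case: k mk => [|k] mk; first by rewrite m0 in mk.
  exists k => //=; rewrite mem_iota add0n ltnNge; apply: contra mk => nk.
  by rewrite mn.
rewrite big_imfset /=; last by move=> a b _ _ [].
rewrite undup_id ?iota_uniq // (eq_bigr (fun a : 'I_n => m a.+1)) => [|a _]; last by rewrite mnmE.
by rewrite -(big_mkord xpredT (fun a => m a.+1)) /index_iota subn0.
Qed.

(** Both factors of a monomial in the variables 1, ..., n only involve these variables. *)
Lemma fpseries_mul_mpoly (f g : fpseries) (p q : {mpoly int[n]}) m : supp_in m ->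
  (forall m', supp_in m' -> f m' = p@_(restr m')) ->
  (forall m', supp_in m' -> g m' = q@_(restr m')) ->
  fpseries_mul f g m = (p * q)@_(restr m).
Proof.
move=> sm fp gq; rewrite mcoeffM /fpseries_mul.
pose B := 'X_{1..n < (mdeg (restr m)).+1}.
pose h (k : B * B) : cmon * cmon := (extm k.1, extm k.2).
rewrite (@reindex_fsbig _ _ _ _ _ h [set k : B * B | restr m == (k.1 + k.2)%MM]); last first.
  split=> [[k1 k2] /= /eqP e|[k1 k2] [l1 l2] _ _ [e1 e2]|[m1 m2] /= e].
  - by rewrite extm_mul -e restrK.
  - congr (_, _); apply: val_inj => /=.
      by rewrite -(extmK k1) e1 extmK.
    by rewrite -(extmK k2) e2 extmK.
  - have [s1 s2] : supp_in m1 /\ supp_in m2 by apply: supp_mul; rewrite e.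
    have e' : restr m = (restr m1 + restr m2)%MM by rewrite -restr_mul e.
    have d1 : (mdeg (restr m1) < (mdeg (restr m)).+1)%N by rewrite e' mdegD ltnS leq_addr.
    have d2 : (mdeg (restr m2) < (mdeg (restr m)).+1)%N by rewrite e' mdegD ltnS leq_addl.
    exists (BMultinom d1, BMultinom d2); first by rewrite /= e'.
    by rewrite /h /= !restrK.
rewrite fsbig_fin; apply: eq_bigr => -[k1 k2] _ /=.
by rewrite fp ?gq ?extmK //; exact: supp_extm.
Qed.
End Truncate.

Lemma supp_ex (m : cmon) n0 : m 0%N = 0%N -> exists2 n, (n0 <= n)%N & supp_in n m.
Proof.
move=> m0; exists (n0 + \sum_(k <- finsupp m) k)%N; first exact: leq_addr.
split=> // k h; apply/eqP; rewrite monalg.cmE_eq0; apply/negP => kf.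
by move: h; rewrite (big_fsetD1 k) //=; lia.
Qed.

(** * Finite fillings and set-valued tableaux *)

Definition nil_svt : svtableau := @SVTableau [::] isT.

Section Transfer.
Variables (n : nat) (p : intpart).
Implicit Types F : pfilling n p.

Definition toT F : svtableau := insubd nil_svt (build_rows n p (inbox F)).

Lemma toTE F : ptab F -> svt_shape (toT F) = p /\ forall s t a, svf (toT F) s t a = inbox F s t a.
Proof.
move=> /asboolP tF; have fn s t a : inbox F s t a -> (a < n)%N by case/inbox_bound.
have -> : toT F = build tF fn.
  by apply: val_inj; rewrite /toT val_insubd (is_svt_build tF fn).
by split; [exact: build_shape|exact: build_svf].
Qed.

Definition toF (T : svtableau) : pfilling n p := fill _ _ _ (svf T).

Lemma toFE T : svt_shape T = p -> (forall s t a, svf T s t a -> (a < n)%N) ->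
  [/\ ptab (toF T), forall s t a, inbox (toF T) s t a = svf T s t a & toT (toF T) = T].
Proof.
move=> sh fn; have tT : tab (part p) (svf T) by rewrite -sh; exact: svf_tab.
have e := inbox_fill_tab (@part_r p) (part_c p) tT fn.
have pt : ptab (toF T) by apply: istab_fill fn => //; [exact: part_r|exact: part_c].
split=> //; have [e1 e2] := toTE pt.
by apply: svt_ext; [rewrite e1|move=> s t a; rewrite e2 e].
Qed.

Lemma toT_inj F F' : ptab F -> ptab F' -> toT F = toT F' -> F = F'.
Proof.
move=> pF pF' e; apply: inbox_inj => s t a.
by rewrite -(toTE pF).2 -(toTE pF').2 e.
Qed.

Lemma weight_toT F (a : 'I_n) : ptab F -> weight F a = svt_mon (toT F) a.+1.
Proof.
move=> pF; have [e1 e2] := toTE pF; rewrite svt_monS e1 mnmE.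
by apply: eq_cnt => // s t _; rewrite e2.
Qed.

Lemma supp_toT F : ptab F -> supp_in n (svt_mon (toT F)).
Proof.
move=> pF; have [e1 e2] := toTE pF; split=> [|[|a] // na]; first exact: svt_mon0.
rewrite svt_monS e1 cnt0 // => s t _; rewrite e2; apply/negP => /inbox_bound[_ _].
by rewrite ltnNge -ltnS na.
Qed.

Lemma letters_supp T : supp_in n (svt_mon T) -> forall s t a, svf T s t a -> (a < n)%N.
Proof.
move=> [_ h] s t a fa; rewrite ltnNge; apply/negP => na.
have := h a.+1 na; rewrite svt_monS cntE => e.
have sT : (t < part (svt_shape T) s)%N := tab_sub (svf_tab T) fa.
have sr : (s < size (svt_shape T))%N.
  by rewrite ltnNge; apply/negP => /part_r e'; rewrite e' in sT.
have tc : (t < part (svt_shape T) 0)%N by apply: leq_trans sT (part_c _ _).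
have := @ltn_cells _ _ (fun _ _ => false) (fun s t =>
  predT t && svf T s t a) s t sr tc (fun _ _ => fun h => False_ind _ (notF h)) isT fa.
by rewrite e ltn0.
Qed.

(** Every box contains at least one letter; so the truncated difference in [groth] is
    a difference. *)
Lemma mdeg_weight_ge F : ptab F -> (sumn p <= mdeg (weight F))%N.
Proof.
move=> /asboolP tF; rewrite mdegE.
have -> : sumn p = cells (size p) (part p 0) (fun s t => (t < part p s)%N).
  rewrite sumnE (big_nth 0%N); apply: eq_bigr => s _; rewrite -/(part p s).
  by rewrite sum_ltn // part_c.
rewrite (eq_bigr (fun a : 'I_n => \sum_(0 <= s < size p) \sum_(0 <= t < part p 0) inbox F s t
  a)%N); last first.
  by move=> a _; rewrite mnmE.
rewrite exchange_big /=; apply: leq_sum => s _; rewrite exchange_big /=; apply: leq_sum => t _.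
case: ltnP => // ts; have [a fa] := tab_ex tF ts; have [_ _ an] := inbox_bound fa.
by rewrite (bigD1 (Ordinal an)) //= fa.
Qed.

End Transfer.

Lemma groth_Gpoly n p m : supp_in n m -> groth p m = (Gpoly n p)@_(restr n m).
Proof.
move=> sm; rewrite /groth.
rewrite (@reindex_fsbig _ _ _ _ _ (@toT n p)
  [set F : pfilling n p | ptab F && (weight F == restr n m)]); last first.
  split=> [F /= /andP[pF /eqP wF]|F F'|T /= [sh mT]].
  - split; first by have [] := toTE pF.
    rewrite -(restrK (supp_toT pF)) -(restrK sm) -wF; congr extm.
    by apply/mnmP => a; rewrite mnmE weight_toT.
  - by rewrite !inE => /andP[pF _] /andP[pF' _]; exact: toT_inj.
  - have fn := letters_supp (n := n) (T := T); rewrite mT in fn.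
    have [pt e eT] := toFE sh (fn sm); exists (toF n p T) => //=.
    rewrite pt; apply/eqP/mnmP => a; rewrite weight_toT // eT mT mnmE //.
rewrite fsbig_fin /Gpoly mcoeffZ /gpoly raddf_sum /= mulr_sumr [RHS](bigID (fun F =>
  weight F == restr n m)) /=.
rewrite [X in _ + X]big1 ?addr0 => [|F /andP[_ /negbTE ne]]; last first.
  by rewrite mcoeffZ mcoeffX ne !mulr0.
apply: eq_bigr => F /andP[pF /eqP wF].
rewrite /term mcoeffZ mcoeffX wF eqxx mulr1.
have -> : monalg.mdeg (svt_mon (toT F)) = mdeg (weight F).
  rewrite -(mdeg_restr (supp_toT pF)); congr mdeg.
  by apply/mnmP => a; rewrite mnmE weight_toT.
rewrite -wF -exprD -signr_odd -[RHS]signr_odd oddD oddB ?mdeg_weight_ge //.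
by rewrite addbC.
Qed.

(** * The Littlewood-Richardson rule *)

Definition LR (si p nu : intpart) : set svtableau :=
  [set T | [/\ svt_shape T = p, reverse_lattice (svt_word T ++ part_word si)
             & has_content (svt_word T ++ part_word si) nu]].

Section Count.
Variables (n : nat) (si p : intpart).
Hypothesis n_ge : (size si + size p <= n)%N.
Implicit Types F : pfilling n p.

Let sn : (size si <= n)%N. Proof. exact: leq_trans (leq_addr _ _) n_ge. Qed.

Lemma pgoodP F : ptab F -> pgood si F <-> rowgood (size p) (part p 0) (part si) (inbox F).
Proof.
move=> /asboolP tF; split=> [/goodP|] g.
  exact: (colgood_rowgood (part_anti p) (@part_r p) (part_c p) tF (fun i =>
    part_anti si (leqnSn i)) g).
by apply/goodP; exact: (rowgood_colgood (part_anti p) tF g).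
Qed.

Lemma eq_rowgood r c al f g : (forall s t a, f s t a = g s t a) ->
  rowgood r c al f -> rowgood r c al g.
Proof.
move=> e h s t i; rewrite -e => /h; rewrite /bef.
rewrite (@eq_cells _ _ _ (fun s' t' => before s t s' t' && g s' t' i.+1)) => [|? ?];
  last by rewrite e.
by rewrite (@eq_cells _ _ (fun s' t' => before s t s' t' && f s' t' i) (fun s' t' =>
  before s t s' t' && g s' t' i)) => [|? ?]; last by rewrite e.
Qed.

Lemma part_nu_of F a : ptab F -> pgood si F ->
  part (nu_of si F) a = (count_boxes (size p) (part p 0) (inbox F) predT a + part si a)%N.
Proof.
move=> pF gF; have [sz e] := nu_ofP pF gF; case: (ltnP a n) => an.
  by have := congr1 (fun m : 'X_{1..n} => m (Ordinal an)) e; rewrite !mnmE.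
rewrite (part_r (leq_trans sz an)) (part_r (leq_trans sn an)) cnt0 // => s t _.
by apply/negP => /inbox_bound[_ _]; rewrite ltnNge an.
Qed.

(** A tableau counted by the rule has no letter beyond size si + size p, so n letters
    are enough for all of them. *)
Lemma LR_bij (nu : intpart) : set_bij
  [set F : pfilling n p | (ptab F && pgood si F) && (nu_of si F == nu)] (LR si p nu) (@toT n p).
Proof.
split=> [F /= /andP[/andP[pF gF] /eqP nF]|F F'|T /= [sh rl ct]].
- have [e1 e2] := toTE pF; split=> //.
    apply/reverse_lattice_rowgood; rewrite e1; apply: (eq_rowgood (fun s t a => esym (e2 s t a))).
    exact/pgoodP.
  apply/has_content_cnt => a; rewrite -nF part_nu_of // e1; congr (_ + _)%N.
  by apply: eq_cnt => // s t _; rewrite e2.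
- by rewrite !inE => /andP[/andP[pF _] _] /andP[/andP[pF' _] _]; exact: toT_inj.
have tT : tab (part p) (svf T) by rewrite -sh; exact: svf_tab.
have rg : rowgood (size p) (part p 0) (part si) (svf T).
  by rewrite -sh; exact/reverse_lattice_rowgood.
have fn s t a : svf T s t a -> (a < n)%N.
  move=> fa; have := rowgood_bound tT (@part_r si) rg fa.
  have sp : (s < size p)%N.
    by rewrite ltnNge; apply/negP => /part_r e; have := tab_sub tT fa; rewrite e.
  by move: n_ge sp; lia.
have [pt e eT] := toFE sh fn.
have gF : pgood si (toF n p T) by apply/pgoodP => //; apply: eq_rowgood rg => s t a; rewrite e.
exists (toF n p T) => //=; rewrite pt gF /=; apply/eqP/part_inj => a; rewrite part_nu_of //.
have /has_content_cnt/(_ a) <- := ct; rewrite sh; congr (_ + _)%N.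
by apply: eq_cnt => // s t _; rewrite e.
Qed.

Definition LRcount (nu : intpart) : int := \sum_(T \in LR si p nu) (1 : int).

Lemma LRcountE nu :
  LRcount nu = \sum_(F : pfilling n p | (ptab F && pgood si F) && (nu_of si F == nu)) (1 : int).
Proof.
rewrite /LRcount (@reindex_fsbig _ _ _ _ _ (@toT n p)
  [set F : pfilling n p | (ptab F && pgood si F) && (nu_of si F == nu)]) ?fsbig_fin //.
exact: LR_bij.
Qed.

Lemma LR_finite nu : finite_set (LR si p nu).
Proof.
have [_ _ sj] := LR_bij nu; apply: sub_finite_set sj _; apply: finite_image.
exact: finite_finset.
Qed.

End Count.

Lemma nu_of_size n (si p : intpart) (F : pfilling n p) : (size si <= n)%N -> ptab F -> pgood si F ->
  (sumn (nu_of si F) = mdeg (weight F) + sumn si)%N.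
Proof.
move=> sn pF gF; have [sz e] := nu_ofP pF gF.
by rewrite -(mdeg_part sz) e mdegD mdeg_part.
Qed.

Definition Kc_value (si p nu : intpart) : int :=
  (-1) ^+ (sumn nu + sumn si + sumn p) * LRcount si p nu.

Lemma Kc_value_supp (n : nat) (si p : intpart) : (size si + size p <= n)%N ->
  forall nu, Kc_value si p nu != 0 ->
  nu \in [fset nu_of si F | F : pfilling n p & ptab F && pgood si F]%fset.
Proof.
move=> np nu; rewrite /Kc_value (LRcountE np).
case: (pickP (fun F : pfilling n p => (ptab F && pgood si F) && (nu_of si F == nu))) =>
  [F /andP[h /eqP<-] _|h].
  by apply/imfsetP; exists F.
by rewrite big_pred0 ?mulr0 ?eqxx.
Qed.

Lemma Kc_value_nu n (si p : intpart) (F : pfilling n p) : (size si + size p <= n)%N ->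
  ptab F -> pgood si F ->
  Kc_value si p (nu_of si F) != 0.
Proof.
move=> np pF gF; rewrite /Kc_value mulf_neq0 ?signr_eq0 // (LRcountE np).
rewrite (bigD1 F) /= ?pF ?gF ?eqxx //; apply: lt0r_neq0; apply: ltr_wpDr => //.
exact: sumr_ge0.
Qed.

Definition Kc_fun (si p : intpart) : {fsfun intpart -> int with 0} :=
  [fsfun nu in [fset nu_of si F | F : pfilling (size si + size p) p & ptab F && pgood si F]%fset
     => Kc_value si p nu | 0].

Lemma Kc_funE si p nu : Kc_fun si p nu = Kc_value si p nu.
Proof.
rewrite fsfun_fun; case: ifPn => // h; apply/esym/eqP; apply: contraNT h.
exact: Kc_value_supp.
Qed.

Lemma Gpoly_expansion n (si p : intpart) : (size si + size p <= n)%N ->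
  Gpoly n si * Gpoly n p = \sum_(nu <- finsupp (Kc_fun si p)) Kc_fun si p nu *: Gpoly n nu.
Proof.
move=> np; have sn : (size si <= n)%N by exact: leq_trans (leq_addr _ _) np.
rewrite Gpoly_prod //.
pose e nu : int := (-1) ^+ (sumn nu + sumn si + sumn p).
have E nu : Kc_fun si p nu *: Gpoly n nu =
    \sum_(F : pfilling n p | (ptab F && pgood si F) && (nu_of si F == nu)) e nu *: Gpoly n nu.
  by rewrite Kc_funE /Kc_value (LRcountE np) mulr_sumr scaler_suml; apply: eq_bigr => F _;
    rewrite mulr1.
rewrite (eq_bigr _ (fun nu _ => E nu)).
rewrite (exchange_big_dep (fun F : pfilling n p => ptab F && pgood si F)) /=;
  last by move=> nu F _ /andP[].
apply: eq_bigr => F /andP[pF gF]; rewrite pF gF /=.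
have nuS : nu_of si F \in finsupp (Kc_fun si p).
  by rewrite mem_finsupp Kc_funE (Kc_value_nu np).
rewrite big_mkcond (big_fsetD1 _ nuS) /= eqxx big_seq big1 ?addr0 => [|nu]; last first.
  by rewrite in_fsetD1 => /andP[/negbTE ne _]; rewrite eq_sym ne.
congr (_ *: _); rewrite /e nu_of_size // -signr_odd -[RHS]signr_odd !oddD.
by case: (odd (sumn si)); case: (odd (sumn p)); case: (odd (mdeg _)).
Qed.

Lemma groth0 p (m : monalg.cmonom nat) : m 0%N != 0%N -> groth p m = 0.
Proof. by move=> m0; rewrite /groth fsbig1 // => T [_ e]; rewrite -e svt_mon0 in m0. Qed.

Lemma Kc_fun_expansion si p :
  groth_expansion (fpseries_mul (groth si) (groth p)) (Kc_fun si p).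
Proof.
move=> m; case: (eqVneq (m 0%N) 0%N) => m0; last first.
  rewrite big1 => [|nu _]; last by rewrite groth0 ?mulr0.
  rewrite /fpseries_mul fsbig1 // => -[m1 m2] /= e.
  move: m0; rewrite -e monalg.cmM addn_eq0 negb_and => /orP[] h.
    by rewrite groth0 ?mul0r.
  by rewrite [X in _ * X]groth0 ?mulr0.
have [n np sm] := supp_ex (size si + size p) m0.
rewrite (fpseries_mul_mpoly sm (fun m' => @groth_Gpoly n si m') (fun m' => @groth_Gpoly n p m')).
rewrite (Gpoly_expansion np) raddf_sum /=; apply: eq_bigr => nu _.
by rewrite mcoeffZ -groth_Gpoly.
Qed.

(** In a number of variables that bounds the lengths of all partitions involved, the
    polynomials are linearly independent. *)
Lemma groth_expansion_uniq (f : fpseries) (a b : {fsfun intpart -> int with 0}) :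
  groth_expansion f a -> groth_expansion f b -> a = b.
Proof.
move=> ea eb; pose S := (finsupp a `|` finsupp b)%fset.
pose n := (\sum_(nu <- S) size nu)%N.
have Sn nu : nu \in S -> (size nu <= n)%N.
  by move=> nuS; rewrite /n (big_fsetD1 nu) //= leq_addr.
have wide (c : {fsfun intpart -> int with 0}) m : (finsupp c `<=` S)%fset ->
    \sum_(nu <- finsupp c) c nu * groth nu m = \sum_(nu <- S) c nu * groth nu m.
  move=> cS; apply: big_fset_incl => // nu nuS; rewrite memNfinsupp => /eqP->.
  by rewrite mul0r.
have e0 : \sum_(nu <- S) (a nu - b nu) *: Gpoly n nu = 0.
  apply/mpolyP => k; rewrite mcoeff0 raddf_sum /= -(extmK k).
  transitivity (\sum_(nu <- S) a nu * groth nu (extm k) - \sum_(nu <- S) b nu * groth nu (extm k)).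
    rewrite -sumrB; apply: eq_bigr => nu _; rewrite mcoeffZ mulrBl.
    by rewrite (groth_Gpoly nu (supp_extm k)).
  rewrite -!wide ?fsubsetUl ?fsubsetUr //.
  by rewrite -ea -eb subrr.
apply/fsfunP => nu; case: (boolP (nu \in S)) => nuS.
  by apply/eqP; rewrite -subr_eq0; apply/eqP; exact: (Gpoly_free Sn e0).
by move: nuS; rewrite in_fsetU negb_or !memNfinsupp => /andP[/eqP-> /eqP->].
Qed.

(** Buch's Littlewood-Richardson rule.  The polynomial identities in n variables, for all
    large n, determine every coefficient of the series. *)
Theorem Kc_LR si p nu : Kc si p nu = Kc_value si p nu.
Proof.
rewrite -Kc_funE /Kc (@xget_unique _ _ _ (Kc_fun si p)) //; first exact: Kc_fun_expansion.
by move=> b eb; exact: groth_expansion_uniq eb (Kc_fun_expansion si p).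
Qed.

Lemma part_rect r c s : part (rect r c) s = rectL r c s.
Proof.
rewrite /part /rect /= /rect_seq /rectL; case: eqP => [->|_]; first by rewrite nth_nil if_same.
by rewrite nth_nseq.
Qed.

Lemma part_rho la mu i : part (rho la mu) i =
  if (i < hull_rows la mu)%N then (hull_cols la mu + part mu i)%N
  else part la (i - hull_rows la mu).
Proof.
rewrite /part /= nth_cat size_map size_iota; case: ifP => // ip.
by rewrite (nth_map 0%N) ?size_iota // nth_iota.
Qed.

Lemma sumn_rect r c : sumn (rect r c) = (r * c)%N.
Proof. by rewrite /= /rect_seq; case: eqP => [->|_]; rewrite ?muln0 // sumn_nseq mulnC. Qed.

Lemma sumn_rho la mu : sumn (rho la mu) =
  (hull_rows la mu * hull_cols la mu + sumn mu + sumn la)%N.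
Proof.
rewrite /= sumn_cat; congr (_ + _)%N; rewrite sumnE big_map big_split /=.
rewrite big_const_seq count_predT size_iota iter_addn_0 mulnC; congr (_ + _)%N.
have mup : (size mu <= hull_rows la mu)%N by exact: leq_maxr.
rewrite -(mdeg_part mup) mdegE (eq_bigr (fun i : 'I_(hull_rows la mu) => part mu i)) => [|i _].
  by rewrite -(big_mkord xpredT (part mu)) /index_iota subn0.
by rewrite mnmE.
Qed.

Lemma cells_rect r c Q : cells (size (rect r c)) (part (rect r c) 0) Q = cells r c Q.
Proof.
rewrite part_rect /rectL /= /rect_seq; case: eqP => [->|_].
  rewrite if_same /= /cells big_geq // big1 // => s _; exact: big_geq.
rewrite size_nseq; case: r => //; by rewrite /cells !big_geq.
Qed.

Lemma cnt_rect r c f a : count_boxes (size (rect r c)) (part (rect r c) 0) f predT a =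
  count_boxes r c f predT a.
Proof. by rewrite !cntE cells_rect. Qed.

Lemma rowgood_rect r c al f :
  rowgood (size (rect r c)) (part (rect r c) 0) al f <-> rowgood r c al f.
Proof. by split=> h s t i /h; rewrite /bef !cells_rect. Qed.

Lemma rook_complementaryP r c si la : rook_complementary r c si la <-> rook_cells r c la si.
Proof.
split=> [[h1 h2 h3 h4]|[h1 h2 h3 h4]].
  split=> [s|s|s t sr tc|s t s' t'].
  - by rewrite -part_rect; exact: h1.
  - by rewrite -part_rect; exact: h2.
  - have := finset.in_setT (Ordinal sr, Ordinal tc); rewrite -h3 !inE /=.
    by rewrite /rotc sr tc.
  - move=> ts rs ts' rs' e.
    have inR s0 t0 : rotc r c la s0 t0 -> (s0 < r)%N /\ (t0 < c)%N by case/and3P.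
    have [sr tc] := inR _ _ rs; have [sr' tc'] := inR _ _ rs'.
    have m1 : (Ordinal sr, Ordinal tc) \in (diagram r c si :&: rotated_diagram r c la)%SET.
      by rewrite !inE /= ts; case/and3P: rs.
    have m2 : (Ordinal sr', Ordinal tc') \in (diagram r c si :&: rotated_diagram r c la)%SET.
      by rewrite !inE /= ts'; case/and3P: rs'.
    have E : (Ordinal sr, Ordinal tc) = (Ordinal sr', Ordinal tc').
      by apply: h4 => //; case: e => e; [left|right]; exact: val_inj.
    by case: E.
split.
- by move=> s; rewrite part_rect.
- by move=> s; rewrite part_rect.
- apply/setP => -[s t]; rewrite !inE /=; have := h3 s t (ltn_ord s) (ltn_ord t).
  by rewrite /rotc !ltn_ord.
- move=> [s t] [s' t']; rewrite !inE /= => /andP[a1 a2] /andP[b1 b2] e.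
  have ra : rotc r c la s t by rewrite /rotc !ltn_ord.
  have rb : rotc r c la s' t' by rewrite /rotc !ltn_ord.
  have [] := h4 _ _ _ _ a1 ra b1 rb; first by case: e => ->; [left|right].
  by move=> e1 e2; congr (_, _); exact: val_inj.
Qed.

(** The half-turn of the rectangle exchanges the two partitions. *)
Lemma rook_cells_sym r c la mu : rook_cells r c la mu -> rook_cells r c mu la.
Proof.
move=> [h1 h2 h3 h4].
have R la' s t : (s < r)%N -> (t < c)%N -> rotc r c la' (r - s.+1) (c - t.+1) = (t < part la' s)%N.
  move=> sr tc; rewrite /rotc; have -> : (r - s.+1 < r)%N by lia.
  have -> : (c - t.+1 < c)%N by lia.
  have -> : (r - (r - s.+1).+1 = s)%N by lia.
  by have -> : (c - (c - t.+1).+1 = t)%N by lia.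
have M la' s t : rotc r c la' s t -> [/\ (s < r)%N, (t < c)%N & (c - t.+1 < part la' (r - s.+1))%N].
  by case/and3P.
split=> // [s t sr tc|s t s' t' a1 ra b1 rb e].
  have s'r : (r - s.+1 < r)%N by lia.
  have t'c : (c - t.+1 < c)%N by lia.
  have := h3 _ _ s'r t'c; rewrite R // orbC => /orP[->//|h].
  by rewrite /rotc sr tc h orbT.
have [sr tc ma] := M _ _ _ ra; have [sr' tc' mb] := M _ _ _ rb.
have ra' : rotc r c la (r - s.+1) (c - t.+1) by rewrite R.
have rb' : rotc r c la (r - s'.+1) (c - t'.+1) by rewrite R.
have [|e1 e2] := h4 _ _ _ _ ma ra' mb rb'; first by case: e => ->; [left|right].
by split; lia.
Qed.

(** Letters below p satisfy the lattice condition after the word of (q)^p, which is neutral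
    for them; for the letter p the q copies of p-1 make it automatic, since at most q
    copies of p occur. *)
Lemma LR_rect r c la mu (p := hull_rows la mu) (q := hull_cols la mu) T :
  LR (rect p q) (rect r c) (rho la mu) T <->
  [/\ svt_shape T = rect r c, rook_cells r c la mu
    & forall s t a, svf T s t a = rect_fill r c p la mu s t a].
Proof.
have lap : (size la <= p)%N by exact: leq_maxl.
have mup : (size mu <= p)%N by exact: leq_maxr.
have laq : (part la 0 <= q)%N by exact: leq_maxl.
have eR : part (rect r c) = rectL r c by apply/funext => s; exact: part_rect.
have eA : part (rect p q) = hullA p q by apply/funext => i; rewrite part_rect.
have content T0 : svt_shape T0 = rect r c ->
    has_content (svt_word T0 ++ part_word (rect p q)) (rho la mu) <->
    (forall i, (i < p)%N -> count_boxes r c (svf T0) predT i = part mu i) /\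
    (forall y, count_boxes r c (svf T0) predT (p + y) = part la y).
  move=> sh; rewrite has_content_cnt sh; split=> [h|[hl hh] i].
    split=> [i ip|y]; [have := h i|have := h (p + y)%N];
      rewrite cnt_rect part_rho eA /hullA -/p -/q.
      by rewrite ip; lia.
    by rewrite ltnNge leq_addr /= addn0 addKn.
  rewrite cnt_rect part_rho eA /hullA -/p -/q; case: ltnP => ip; first by rewrite hl // addnC.
  by rewrite addn0 -hh subnKC.
split=> [[sh /reverse_lattice_rowgood rg /(content _ sh)[cl ch]]|[sh rook ef]].
  rewrite sh in rg; move/rowgood_rect: rg; rewrite eA => rg.
  have tT : tab (rectL r c) (svf T) by rewrite -eR -sh; exact: svf_tab.
  split=> //; first exact: (rect_rook_cells lap mup laq tT rg cl ch).
  by move=> s t a; exact: (rect_fill_uniq lap mup laq tT rg cl ch).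
have tF := rect_fill_tab lap mup laq rook.
have rg : rowgood r c (hullA p q) (rect_fill r c p la mu).
  apply: (colgood_rowgood (@rectL_anti r c) (@rectL_out r c) (@rectL_le r c) tF).
    by move=> i; rewrite -eA; exact: part_anti.
  exact: (rect_fill_colgood lap mup laq rook).
split=> //.
  apply/reverse_lattice_rowgood; rewrite sh; apply/rowgood_rect; rewrite eA.
  by apply: eq_rowgood rg => s t a; rewrite ef.
apply/(content _ sh); split=> [i ip|y].
  by rewrite -(cnt_low lap mup laq rook ip); apply: eq_cnt => // s t _; rewrite ef.
by rewrite -(cnt_high lap mup laq rook y); apply: eq_cnt => // s t _; rewrite ef.
Qed.

Lemma LRcount_rect r c la mu :
  LRcount (rect (hull_rows la mu) (hull_cols la mu)) (rect r c) (rho la mu) =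
  (`[< rook_cells r c la mu >])%:R.
Proof.
rewrite /LRcount; case: asboolP => rook; last first.
  by rewrite fsbig1 // => T /LR_rect[].
set p := hull_rows la mu.
have lap : (size la <= p)%N by exact: leq_maxl.
have mup : (size mu <= p)%N by exact: leq_maxr.
have laq : (part la 0 <= hull_cols la mu)%N by exact: leq_maxl.
have eR : part (rect r c) = rectL r c by apply/funext => s; exact: part_rect.
have tF := rect_fill_tab lap mup laq rook.
have tR : tab (part (rect r c)) (rect_fill r c p la mu) by rewrite eR.
have fn s t a : rect_fill r c p la mu s t a -> (a < p + r)%N.
  rewrite /rect_fill; case: ltnP => ap; first by move=> _; lia.
  case/andP=> /and3P[sr _ _] /eqP->; rewrite ltn_add2l /rdepth; apply: leq_ltn_trans sr.
  rewrite -[X in (_ <= X)%N]subn0 -[X in (_ <= X)%N]muln1 -sum_nat_const_nat.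
  by apply: leq_sum => s' _; case: (rotc _ _ _ _ _).
rewrite (_ : LR _ _ _ = [set build tR fn]) ?fsbig_set1 //.
apply/seteqP; split=> [T /LR_rect[sh _ ef]|_ ->].
  by apply: svt_ext; rewrite ?build_shape // => s t a; rewrite build_svf ef.
by apply/LR_rect; split=> //; [exact: build_shape|move=> s t a; exact: build_svf].
Qed.

Lemma Kd_rect r c la mu : Kd la mu (rect r c) =
  (-1) ^+ (sumn la + sumn mu + r * c) * (`[< rook_cells r c la mu >])%:R.
Proof.
rewrite /Kd Kc_LR /Kc_value LRcount_rect; congr (_ * _).
rewrite sumn_rho !sumn_rect -signr_odd -[RHS]signr_odd !oddD.
by case: (odd (_ * hull_cols _ _)); case: (odd (sumn mu)); case: (odd (sumn la));
  case: (odd (r * c)).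
Qed.

Lemma finite_sub_rect r c : finite_set [set p : intpart | sub_part p (rect r c)].
Proof.
pose h (g : {ffun 'I_r -> 'I_c.+1}) : intpart := part_of [seq nat_of_ord (g i) | i <- enum 'I_r].
apply: (@sub_finite_set _ _ (h @` setT)); last by apply: finite_image; exact: finite_finset.
move=> p /= sp; have pc i : (part p i < c.+1)%N.
  by rewrite ltnS; apply: leq_trans (sp i) _; rewrite part_rect rectL_le.
exists [ffun i : 'I_r => Ordinal (pc i)] => //; apply: part_inj => a.
rewrite /h; set s := map _ _.
have es : s = mkseq (part p) r.
  rewrite /s /mkseq -val_enum_ord -map_comp; apply: eq_map => i /=; by rewrite ffunE.
have ss : sorted geq s.
  apply/(sortedP 0%N) => i; rewrite es size_mkseq => ir.
  by rewrite !nth_mkseq ?(ltnW ir) //; exact: part_anti.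
have [_ ->] := part_ofP ss; rewrite es.
case: (ltnP a r) => ar; first by rewrite nth_mkseq.
rewrite nth_default ?size_mkseq //; have := sp a; rewrite part_rect /rectL ltnNge ar /=.
by rewrite leqn0 => /eqP.
Qed.

Lemma fsbig_fibres (I J : choiceType) (A : set J) (B : set I) (g : I -> J) (F : I -> int) :
  finite_set A -> finite_set B -> (forall x, B x -> A (g x)) ->
  \sum_(x \in B) F x = \sum_(y \in A) \sum_(x \in B `&` g @^-1` [set y]) F x.
Proof.
move=> fA fB gA.
have E y : \sum_(x \in B `&` g @^-1` [set y]) F x = \sum_(x \in B) (if g x == y then F x else 0).
  rewrite (fsbig_mkcondr _ B (g @^-1` [set y]) F); apply: eq_fsbigr => x _.
  by congr (if _ then _ else _); apply/idP/eqP; rewrite inE.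
rewrite (eq_fsbigr _ _ (fun y _ => E y)) exchange_fsbig //; apply: eq_fsbigr => x;
  rewrite inE => Bx.
rewrite (fsbigD1 (g x) A) //=; last exact: gA.
rewrite eqxx fsbig1 ?addr0 // => y [_ /= ne]; case: eqP => // e; by case: ne.
Qed.

Section Final.
Variables (m11 m12 m23 m33 : nat) (la mu nu : intpart).

Definition pairs : set (intpart * svtableau) :=
  [set p : intpart * svtableau |
          [/\ rook_complementary m12 m33 p.1 la,
              rook_complementary m23 m11 (svt_shape p.2) nu,
              reverse_lattice (svt_word p.2 ++ part_word p.1)
            & has_content (svt_word p.2 ++ part_word p.1) mu]].

(** The pairs (sigma, tau) for which both factors d are nonzero. *)
Definition shapes : set (intpart * intpart) :=
  [set st | rook_cells m12 m33 la st.1 /\ rook_cells m23 m11 nu st.2].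

Lemma finite_shapes : finite_set shapes.
Proof.
apply: (sub_finite_set _ (finite_setX (@finite_sub_rect m12 m33) (@finite_sub_rect m23 m11))).
by move=> [si ta] /= [[h _ _ _] [h' _ _ _]]; split=> s /=; rewrite part_rect.
Qed.

Lemma pairsP x : pairs x <-> shapes (x.1, svt_shape x.2) /\ LR x.1 (svt_shape x.2) mu x.2.
Proof.
split=> [[/rook_complementaryP h1 /rook_complementaryP h2 h3 h4]|[[h1 h2] [_ h3 h4]]] //.
by split=> //; exact/rook_complementaryP.
Qed.

Lemma finite_pairs : finite_set pairs.
Proof.
apply: (@sub_finite_set _ _ (\bigcup_(st in shapes) [set (st.1, T) | T in LR st.1 st.2 mu])).
  move=> [si T] /pairsP[/= h1 h2]; exists (si, svt_shape T) => //=; by exists T.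
apply: bigcup_finite; first exact: finite_shapes.
by move=> st _; apply: finite_image; exact: (LR_finite (leqnn _)).
Qed.

Lemma card_pairs : (#|` fset_set pairs |%fset)%:Z = \sum_(st \in shapes) LRcount st.1 st.2 mu.
Proof.
transitivity (\sum_(x \in pairs) (1 : int)).
  rewrite (fsbig_finite _ _ finite_pairs) big_const_seq count_predT.
  by rewrite -[RHS]/(iter _ _ _) iter_addr_0 natz.
rewrite (fsbig_fibres (g := fun x => (x.1, svt_shape x.2)) _ finite_shapes finite_pairs) =>
  [|x /pairsP[]//].
apply: eq_fsbigr => -[si ta]; rewrite inE => st /=; rewrite /LRcount.
rewrite (@reindex_fsbig _ _ _ _ _ (fun T => (si, T)) (LR si ta mu)) //.
split=> [T /= [sh rl ct]|T T' _ _ [] //|[si' T] /= [/pairsP[_ hL] [<- e]]].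
  by split=> /=; [apply/pairsP; rewrite /= sh|rewrite sh].
by exists T => //; rewrite -e.
Qed.

Lemma c_three_sum : c_three m11 m12 m23 m33 la mu nu =
  (-1) ^+ (sumn la + sumn mu + sumn nu + m33 * m12 + m11 * m23) *
  \sum_(st \in shapes) LRcount st.1 st.2 mu.
Proof.
rewrite fsbig_distrr; last exact: finite_shapes.
rewrite /c_three -(@fsbig_widen _ _ _ _ shapes setT) //; last first.
  move=> [si ta] /= [_ ns]; rewrite !Kd_rect.
  case: asboolP => h1; last by rewrite mulr0 !mul0r.
  case: asboolP => h2; last by rewrite mulr0 mulr0 mul0r.
  by case: ns; split=> //=; exact: rook_cells_sym.
apply: eq_fsbigr => -[si ta]; rewrite inE => -[/= h1 h2]; rewrite !Kd_rect Kc_LR /Kc_value.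
rewrite !asboolT //; last exact: rook_cells_sym.
rewrite !mulr1 mulrA -!exprD; congr (_ * _);
  rewrite -[LHS]signr_odd -[RHS]signr_odd !oddD !(mulnC m33) !(mulnC m11).
by case: (odd (sumn la)); case: (odd (sumn si)); case: (odd (sumn ta)); case: (odd (sumn mu));
  case: (odd (sumn nu)); case: (odd (m12 * m33)); case: (odd (m23 * m11)).
Qed.
End Final.

(* The set of pairs is finite, so [fset_set] really counts its elements. *)
Theorem proposition7p1 (m11 m12 m23 m33 : nat) (la mu nu : intpart) :
  c_three m11 m12 m23 m33 la mu nu =
  (-1) ^ ((sumn la)%:Z + (sumn mu)%:Z + (sumn nu)%:Z
          - (m33 * m12)%N%:Z - (m11 * m23)%N%:Z) *
  (#|` fset_set
        [set p : intpart * svtableau |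
          [/\ rook_complementary m12 m33 p.1 la,
              rook_complementary m23 m11 (svt_shape p.2) nu,
              reverse_lattice (svt_word p.2 ++ part_word p.1)
            & has_content (svt_word p.2 ++ part_word p.1) mu]] |%fset)%:Z.
Proof.
rewrite -[X in fset_set X]/(pairs m11 m12 m23 m33 la mu nu) card_pairs c_three_sum; congr (_ * _).
have u : (-1 : int) \is a GRing.unit by rewrite unitrN unitr1.
by rewrite !(exprzDr u) -!exprnN !invr_sign -!exprnP -!exprD.
Qed.
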